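(* Let $\mathcal{P}=\langle\Sigma\mid\mathcal{R}\rangle$ be a semigroup presentation and $w\in\Sigma^+$ a base word. Suppose that the Squier complex $S(\mathcal{P},w)$ is finite-dimensional and that the diagram group $D(\mathcal{P},w)$ is finitely generated. If $D(\mathcal{P},w)$ satisfies Property B, then its asymptotic dimension is bounded above by $\dim S(\mathcal{P},w)$.
   Context: A semigroup presentation $\mathcal{P}=\langle\Sigma\mid\mathcal{R}\rangle$ consists of an alphabet $\Sigma$ and a set $\mathcal{R}$ of relations $u=v$ with $u,v\in\Sigma^+$. Here $\Sigma^+$ is the free semigroup of non-empty words and $\Sigma^*=\Sigma^+\cup\{1\}$ also contains the empty word $1$. Convention: if $u=v\in\mathcal{R}$ then $v=u\notin\mathcal{R}$ (in particular $u=u\notin\mathcal{R}$). The Squier complex $S(\mathcal{P})$ is the cube complex whose vertices are the words over $\Sigma$; whose oriented edges are $(a,u\to v,b)$ with $a,b\in\Sigma^*$ and $u=v$ or $v=u$ in $\mathcal{R}$, going from $aub$ to $avb$ (and $(a,v\to u,b)$ is the same edge with opposite orientation); and whose $n$-cubes are similarly $(a_1,u_1\to v_1,\dots,a_n,u_n\to v_n,a_{n+1})$, spanned by the vertices $a_1w_1\cdots a_nw_na_{n+1}$ with $w_i\in\{u_i,v_i\}$. $S(\mathcal{P},w)$ is the connected component containing $w$. A semigroup diagram over $\mathcal{P}$ is a finite connected planar graph $\Delta$ (considered up to isotopy) with edges oriented and labelled by $\Sigma$ such that: $\Delta$ has exactly one source vertex $\iota$ and exactly one sink vertex $\tau$;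 the boundary of each cell (bounded face) has the form $pq^{-1}$, where $p$ (top path of the cell) and $q$ (bottom path) are positive paths whose labels satisfy $p=q\in\mathcal{R}$ or $q=p\in\mathcal{R}$; every vertex lies on a positive path from $\iota$ to $\tau$; every positive path is simple. $\Delta$ is bounded by two positive paths from $\iota$ to $\tau$, its top and bottom paths; it is a $(u,v)$-diagram if these are labelled $u$ and $v$. A dipole is a $(u,v)$-cell (top label $u$, bottom label $v$) together with a $(v,u)$-cell such that the top path of the first is the bottom path of the second; it is reduced by removing the common path and identifying the top path of the second cell with the bottom path of the first. A diagram is reduced if it has no dipoles; every diagram has a unique reduced form. The diagram group $D(\mathcal{P},w)$ is the set of reduced $(w,w)$-diagrams with product $\Delta_1\cdot\Delta_2$ = reduced form of the diagram obtained by gluing the bottom path of $\Delta_1$ to the top path of $\Delta_2$. It is naturally isomorphic to $\pi_1(S(\mathcal{P},w),w)$ (each edge of a loop gives a cell). $\#(\Delta)$ denotes the number of cells of $\Delta$. Property B: for a finitely generated $D(\mathcal{P},w)$ with word length $|\cdot|$ with respect to a finite generating set, there exist $C_1,C_2>0$ such that $C_1\cdot\#(\Delta)\leq|\Delta|\leq C_2\cdot\#(\Delta)$ for all $\Delta\in D(\mathcal{P},w)$. *)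

(* Defs.v *)
From Stdlib Require Import Relation_Operators.
From mathcomp Require Import all_boot all_order all_algebra.
From mathcomp Require Import boolp classical_sets cardinality reals.

Set Implicit Arguments.
Unset Strict Implicit.
Unset Printing Implicit Defensive.

Import Order.TTheory GRing.Theory Num.Theory.
Local Open Scope classical_set_scope.

(** * Semigroup presentations *)

Record presentation (Sg : Type) := Presentation {
  relation_of : seq Sg -> seq Sg -> Prop;
  relation_nonempty :
    forall u v, relation_of u v -> u <> [::] /\ v <> [::];
  relation_oriented :
    forall u v, relation_of u v -> ~ relation_of v u }.

Definition move (Sg : Type) (P : presentation Sg) (u v : seq Sg) : Prop :=
  relation_of P u v \/ relation_of P v u.

(** * The Squier complex *)

(* (a_1, u_1 -> v_1, ..., a_n, u_n -> v_n, a_{n+1}).  Replacing u_i -> v_i by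
   v_i -> u_i gives the same cube with another orientation, so this type has
   2 ^ n elements for each n-cube of the complex; only the dimension and the
   set of vertices of a cube are used below. *)
Record cube (Sg : Type) (P : presentation Sg) (n : nat) := Cube {
  cube_gap : 'I_n -> seq Sg;
  cube_from : 'I_n -> seq Sg;
  cube_to : 'I_n -> seq Sg;
  cube_last : seq Sg;
  cube_move : forall i, move P (cube_from i) (cube_to i) }.

Definition cube_vertex (Sg : Type) (P : presentation Sg) (n : nat)
    (c : cube P n) (s : 'I_n -> bool) : seq Sg :=
  (\big[cat/[::]]_(i < n)
     (cube_gap c i ++ (if s i then cube_to c i else cube_from c i)))
  ++ cube_last c.

Definition squier_edge (Sg : Type) (P : presentation Sg) (x y : seq Sg) : Prop :=
  exists a u v b, [/\ move P u v, x = a ++ u ++ b & y = a ++ v ++ b].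

Definition squier_connected (Sg : Type) (P : presentation Sg) :
    seq Sg -> seq Sg -> Prop :=
  clos_refl_trans (seq Sg) (squier_edge P).

Definition squier_has_cube (Sg : Type) (P : presentation Sg) (w : seq Sg)
    (n : nat) : Prop :=
  exists c : cube P n, forall s, squier_connected P w (cube_vertex c s).

Definition squier_finite_dim (Sg : Type) (P : presentation Sg) (w : seq Sg) :
    Prop :=
  exists N, forall n, squier_has_cube P w n -> (n <= N)%N.

(* Junk value 0 when S(P, w) is infinite-dimensional. *)
Definition squier_dim (Sg : Type) (P : presentation Sg) (w : seq Sg) : nat :=
  xget 0%N [set n | squier_has_cube P w n /\
                    forall m, squier_has_cube P w m -> (m <= n)%N].

(** * Semigroup diagrams *)

(* A finite graph with labelled oriented edges, with cells given by their top
   and bottom paths; [dtop] and [dbot] are the top and bottom paths of the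
   whole figure. *)
Record complex (Sg : Type) := Complex {
  nvert : nat;
  nedge : nat;
  ncell : nat;
  src : 'I_nedge -> 'I_nvert;
  tgt : 'I_nedge -> 'I_nvert;
  lab : 'I_nedge -> Sg;
  ctop : 'I_ncell -> seq 'I_nedge;
  cbot : 'I_ncell -> seq 'I_nedge;
  dtop : seq 'I_nedge;
  dbot : seq 'I_nedge }.

Notation vert K := 'I_(nvert K).
Notation edge K := 'I_(nedge K).
Notation cell K := 'I_(ncell K).

Section Complexes.
Variable Sg : Type.
Implicit Types K : complex Sg.

Definition label K (p : seq (edge K)) : seq Sg := map (@lab Sg K) p.

Fixpoint pos_path K (x : vert K) (p : seq (edge K)) (y : vert K) : bool :=
  if p is e :: q then (src e == x) && pos_path (tgt e) q y else x == y.

Definition adjacent K : rel (vert K) :=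
  fun x y => [exists e : edge K,
    (src e == x) && (tgt e == y) || (src e == y) && (tgt e == x)].

(* A dart (e, b) is the edge e traversed along its orientation if b = true,
   against it if b = false. *)
Definition flip K (d : edge K * bool) : edge K * bool := (d.1, ~~ d.2).

Definition origin K (d : edge K * bool) : vert K :=
  if d.2 then src d.1 else tgt d.1.

Definition closed_walk K (p q : seq (edge K)) : seq (edge K * bool) :=
  [seq (e, true) | e <- p] ++ [seq (e, false) | e <- rev q].

(* The boundary of a face, read with the face on the right: p q^-1 for a cell
   with top path p and bottom path q.  [None] stands for the unbounded face,
   which lies below the bottom path and above the top path of the figure. *)
Definition face_boundary K (f : option (cell K)) : seq (edge K * bool) :=
  if f is Some c then closed_walk (ctop c) (cbot c)
  else closed_walk (dbot K) (dtop K).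

(* Two darts with the same origin that are neighbours in the cyclic order
   around it, namely flip d and the successor of d on the boundary of a face. *)
Definition rotation K : rel (edge K * bool) :=
  fun x y => [exists f : option (cell K),
    (flip x \in face_boundary f) && (next (face_boundary f) (flip x) == y)].

(* Planarity, in the usual combinatorial form: gluing the faces (including
   the unbounded one) along the edges yields a closed orientable surface --
   each side of each edge is on exactly one face, and the darts issued from a
   vertex form a single cycle -- which is connected and has Euler
   characteristic 2, i.e. is the sphere.  The last clause is
   V - E + (C + 1) = 2. *)
Definition planar K : Prop :=
  [/\ forall x y : vert K, connect (@adjacent K) x y,
      forall d : edge K * bool,
        (\sum_(f : option (cell K)) count_mem d (face_boundary f) = 1)%N,
      forall d d' : edge K * bool,
        origin d = origin d' -> connect (@rotation K) d d'
    & (nvert K + ncell K = nedge K + 1)%N].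

Definition is_source K (x : vert K) : Prop := forall e, tgt e <> x.
Definition is_sink K (x : vert K) : Prop := forall e, src e <> x.

Definition is_diagram (P : presentation Sg) K : Prop :=
  planar K /\
  exists iota tau : vert K,
  [/\ is_source iota /\ (forall x, is_source x -> x = iota),
      is_sink tau /\ (forall x, is_sink x -> x = tau),
      pos_path iota (dtop K) tau /\ pos_path iota (dbot K) tau,
      forall c : cell K,
        (exists x y, pos_path x (ctop c) y /\ pos_path x (cbot c) y) /\
        move P (label (ctop c)) (label (cbot c))
    & (forall x, exists p q, pos_path iota p x /\ pos_path x q tau) /\
      (forall x p y, pos_path x p y -> uniq (x :: map (@tgt Sg K) p))].

Definition preserves K K' (fV : vert K -> vert K') (fE : edge K -> edge K')
    (fC : cell K -> cell K') : Prop :=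
  [/\ forall e, src (fE e) = fV (src e),
      forall e, tgt (fE e) = fV (tgt e),
      forall e, lab (fE e) = lab e,
      forall c, ctop (fC c) = map fE (ctop c)
    & forall c, cbot (fC c) = map fE (cbot c)].

(* Equality of planar figures up to isotopy of the plane. *)
Definition isotopic K K' : Prop :=
  exists fV fE fC,
  [/\ @preserves K K' fV fE fC,
      [/\ bijective fV, bijective fE & bijective fC],
      dtop K' = map fE (dtop K)
    & dbot K' = map fE (dbot K)].

Definition on_path K (p : seq (edge K)) (x : vert K) : Prop :=
  exists2 e, e \in p & x = src e \/ x = tgt e.

(* K is obtained by gluing the bottom path of K1 to the top path of K2 (both
   non-empty), and by no other identification. *)
Definition concatenation K1 K2 K : Prop :=
  exists (f1V : vert K1 -> vert K) f1E f1C (f2V : vert K2 -> vert K) f2E f2C,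
  [/\ preserves f1V f1E f1C /\ preserves f2V f2E f2C,
      [/\ injective f1V, injective f1E & injective f1C] /\
      [/\ injective f2V, injective f2E & injective f2C],
      [/\ forall x, (exists y, x = f1V y) \/ (exists y, x = f2V y),
          forall e, (exists d, e = f1E d) \/ (exists d, e = f2E d)
        & forall c, (exists b, c = f1C b) \/ (exists b, c = f2C b)],
      [/\ dtop K = map f1E (dtop K1),
          map f1E (dbot K1) = map f2E (dtop K2)
        & dbot K = map f2E (dbot K2)]
    & [/\ forall x y, f1V x = f2V y -> on_path (dbot K1) x,
          forall d e, f1E d = f2E e -> d \in dbot K1
        & forall b c, f1C b <> f2C c]].

Definition dipole K (c1 c2 : cell K) : Prop :=
  ctop c1 = cbot c2 /\ label (cbot c1) = label (ctop c2).

Definition reduced K : Prop := forall c1 c2 : cell K, ~ dipole c1 c2.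

(* K' is obtained from K by removing c1, c2 and their common path [ctop c1],
   and by identifying the top path of c2 with the bottom path of c1.  The
   values of fV, fE on the removed items are irrelevant; gC points back from
   the cells of K' to the remaining cells of K, since K' may have no cell. *)
Definition dipole_removal K (c1 c2 : cell K) K' : Prop :=
  let keptE e := e \notin ctop c1 in
  let keptV x :=
    ~ exists d e, [/\ d \in ctop c1, e \in ctop c1, x = tgt d & x = src e] in
  let keptC c := c <> c1 /\ c <> c2 in
  let gluedE d e := (d, e) \in zip (ctop c2) (cbot c1) in
  let gluedV x y := exists d e, gluedE d e /\
    ((x = src d /\ y = src e) \/ (x = tgt d /\ y = tgt e)) in
  exists fV fE (gC : cell K' -> cell K),
  [/\ [/\ forall e, keptE e -> src (fE e) = fV (src e),
          forall e, keptE e -> tgt (fE e) = fV (tgt e),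
          forall e, keptE e -> lab (fE e) = lab e,
          forall c, ctop c = map fE (ctop (gC c))
        & forall c, cbot c = map fE (cbot (gC c))],
      dtop K' = map fE (dtop K) /\ dbot K' = map fE (dbot K),
      [/\ forall x' : vert K', exists2 x, keptV x & x' = fV x,
          forall e' : edge K', exists2 e, keptE e & e' = fE e
        & forall c, keptC c <-> exists c', c = gC c'],
      map fE (ctop c2) = map fE (cbot c1)
    & [/\ forall x y, keptV x -> keptV y -> fV x = fV y ->
            [\/ x = y, gluedV x y | gluedV y x],
          forall d e, keptE d -> keptE e -> fE d = fE e ->
            [\/ d = e, gluedE d e | gluedE e d]
        & injective gC]].

(* The reflection exchanging top and bottom. *)
Definition mirror K : complex Sg :=
  @Complex Sg (nvert K) (nedge K) (ncell K) (@src Sg K) (@tgt Sg K) (@lab Sg K)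
    (@cbot Sg K) (@ctop Sg K) (dbot K) (dtop K).

End Complexes.

Record diagram (Sg : Type) (P : presentation Sg) := Diagram {
  figure :> complex Sg;
  diagramP : is_diagram P figure }.

(** * The diagram group *)

Section DiagramGroup.
Variables (Sg : Type) (P : presentation Sg) (w : seq Sg).
Implicit Types (D : diagram P) (X Y : set (diagram P)).

Definition uv_diagram (u v : seq Sg) D : Prop :=
  label (dtop D) = u /\ label (dbot D) = v.

Definition isotopy_class D : set (diagram P) := [set D' | isotopic D D'].

Definition dipole_reduction D D' : Prop :=
  exists c1 c2 : cell D, dipole c1 c2 /\ dipole_removal c1 c2 D'.

Definition reduced_form D D' : Prop :=
  clos_refl_trans (diagram P) dipole_reduction D D' /\ reduced D'.

Definition diagram_group : set (set (diagram P)) :=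
  [set X | exists D, [/\ uv_diagram w w D, reduced D & X = isotopy_class D]].

(* On isotopy classes of reduced (w, w)-diagrams: the isotopy class of the
   reduced form of the concatenation; the class of the diagram with top label
   w and no cell; the class of the mirror image. *)
Definition dg_mul X Y : set (diagram P) :=
  [set D | exists D1 D2 D0,
    [/\ X D1, Y D2, concatenation D1 D2 D0 & reduced_form D0 D]].

Definition dg_one : set (diagram P) :=
  [set D | uv_diagram w w D /\ ncell D = 0%N].

Definition dg_inv X : set (diagram P) :=
  [set D | exists2 D', X D' & isotopic (mirror D') D].

(** ** Word length *)

Implicit Type S : set (set (diagram P)).

Definition letter S : set (set (diagram P)) :=
  [set X | S X \/ exists2 Y, S Y & X = dg_inv Y].

Definition is_product S (n : nat) X : Prop :=
  exists s : 'I_n -> set (diagram P),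
    (forall i, letter S (s i)) /\ X = \big[dg_mul/dg_one]_(i < n) s i.

Definition finite_generating_set S : Prop :=
  [/\ finite_set S, S `<=` diagram_group
    & forall X, diagram_group X -> exists n, is_product S n X].

Definition finitely_generated : Prop := exists S, finite_generating_set S.

Definition word_length S X : nat :=
  xget 0%N [set n | is_product S n X /\
                    forall m, is_product S m X -> (n <= m)%N].

Definition word_dist S X Y : nat := word_length S (dg_mul (dg_inv X) Y).

Local Open Scope ring_scope.

Definition property_B (R : realType) : Prop :=
  exists2 S, finite_generating_set S &
  exists C1 C2 : R, [/\ 0 < C1, 0 < C2 &
    forall D, uv_diagram w w D -> reduced D ->
      C1 * (ncell D)%:R <= (word_length S (isotopy_class D))%:R
        <= C2 * (ncell D)%:R].

End DiagramGroup.

Arguments diagram_group {Sg} P w _.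
Arguments dg_one {Sg} P w _.

(** * Asymptotic dimension *)

Local Open Scope ring_scope.

(* For every r there is a cover of A by n + 1 uniformly bounded r-disjoint
   families of subsets. *)
Definition asdim_le (R : realType) (T : Type) (A : set T) (d : T -> T -> R)
    (n : nat) : Prop :=
  forall r : R, 0 < r ->
  exists (U : 'I_n.+1 -> set (set T)) (B : R),
  [/\ forall i V, U i V -> V `<=` A,
      forall x, A x -> exists i, exists2 V, U i V & V x,
      forall i V x y, U i V -> V x -> V y -> d x y <= B
    & forall i V W x y, U i V -> U i W -> V <> W -> V x -> W y -> r < d x y].

(* A finitely generated group carries the word metric of any finite generating
   set. *)
Definition diagram_group_asdim_le (R : realType) (Sg : Type)
    (P : presentation Sg) (w : seq Sg) (n : nat) : Prop :=
  forall S, finite_generating_set w S ->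
    asdim_le (diagram_group P w)
      (fun X Y => (word_dist w S X Y)%:R : R) n.

(* Main.v *)
(* The group embeds coarsely in a product of n = dim S(P, w) trees.  Give the
   move (a, u -> v, b) the colour dim S(P, a) < n: of two commuting moves the one
   on the right has the larger colour, so moves of equal colour never commute and
   the cells of colour k of a reduced diagram are linearly ordered.  Their
   sequence is a vertex of a tree, on which right multiplication by a cell acts
   by at most one push or pop; this makes the map to the product of trees
   Lipschitz.  Two reduced diagrams have a common prefix after which they share no
   cell, and every cell beyond it occurs, in its colour, after the point where
   the two sequences separate; so diagrams with close images differ by few cells,
   hence, by Property B, are close in the word metric.  A tree is cut into bounded
   pieces along heights modulo l; with n + 1 shifts of the gaps between pieces,
   every n-tuple of heights avoids, by pigeonhole, the gaps of one of them. *)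

Require Import Defs.
From Stdlib Require Import Relation_Operators.
From HB Require Import structures.
From mathcomp Require Import all_boot all_order all_algebra.
From mathcomp Require Import boolp classical_sets cardinality reals.
From mathcomp Require Import zify.

Set Implicit Arguments.
Unset Strict Implicit.
Unset Printing Implicit Defensive.

(** * Cubes and commuting moves *)

Section SquierDim.
Variables (Sg : Type) (P : presentation Sg).
Implicit Types a b u v w x y : seq Sg.

(** The colouring speaks of sequences of moves, while the group consists of planar figures. Much of
    the work is therefore a dictionary: sweeping a front from the top path to the bottom path turns
    a figure into a sequence of moves, unique up to exchanging commuting neighbours, and dipoles
    become cancelling pairs. The colour is a dimension because that of [a] depends only on the
    component of [a], so moves inside [a] do not change it, and because a cube over [a] times the
    edge [u -> v] is a larger cube over [a ++ u ++ b]. A tree vertex must determine more than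
    labels, since equal labels may sit at different places of two diagrams. Hence a cell is named by
    its history, which contains all cells it depends on; equal names then mean equal pasts, and this
    is what produces a common prefix. One stack per colour computes the sequences. The state of the
    stacks is a homotopy invariant, which gives both the uniqueness of reduced forms and the
    Lipschitz bound. *)

Lemma moveC u v : move P u v -> move P v u.
Proof. by case; [right | left]. Qed.

Lemma move_nonempty u v : move P u v -> (u <> [::]) * (v <> [::]).
Proof. by case=> /relation_nonempty []. Qed.

Lemma move_neq u v : move P u v -> u <> v.
Proof. by move=> h e; subst v; case: h => h; exact: (relation_oriented h h). Qed.

Lemma connected_refl x : squier_connected P x x.
Proof. exact: rt_refl. Qed.

Lemma connected_trans y x z :
  squier_connected P x y -> squier_connected P y z -> squier_connected P x z.
Proof. exact: rt_trans. Qed.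

Lemma connected_sym x y : squier_connected P x y -> squier_connected P y x.
Proof.
elim=> [x' y' [a [u [v [b [uv -> ->]]]]]|x'|x' y' z' _ h1 _ h2].
- by apply: rt_step; exists a, v, u, b; split=> //; apply: moveC.
- exact: rt_refl.
- exact: rt_trans h2 h1.
Qed.

Lemma connected_move a u v b :
  move P u v -> squier_connected P (a ++ u ++ b) (a ++ v ++ b).
Proof. by move=> uv; apply: rt_step; exists a, u, v, b. Qed.

Lemma connected_cat l r x y :
  squier_connected P x y -> squier_connected P (l ++ x ++ r) (l ++ y ++ r).
Proof.
elim=> [x' y' [a [u [v [b [uv -> ->]]]]]|x'|x' y' z' _ h1 _ h2].
- have := connected_move (l ++ a) (b ++ r) uv.
  by rewrite -!catA.
- exact: rt_refl.
- exact: rt_trans h1 h2.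
Qed.

Lemma has_cube_connected x y n :
  squier_connected P x y -> squier_has_cube P x n -> squier_has_cube P y n.
Proof.
move=> xy [c hc]; exists c => s.
exact: connected_trans (connected_sym xy) (hc s).
Qed.

Lemma squier_dim_connected x y :
  squier_connected P x y -> squier_dim P x = squier_dim P y.
Proof.
move=> xy; rewrite /squier_dim; congr xget.
have E n : squier_has_cube P x n <-> squier_has_cube P y n.
  by split; apply: has_cube_connected => //; apply: connected_sym.
apply/seteqP; split=> n [h1 h2]; split; first by apply/E.
- by move=> m /E; apply: h2.
- by apply/E.
- by move=> m /E; apply: h2.
Qed.

Lemma has_cube0 x : squier_has_cube P x 0.
Proof.
exists (@Cube Sg P 0 (fun=> [::]) (fun=> [::]) (fun=> [::]) x
  (fun i => match i with Ordinal _ h => match notF h with end end)).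
by move=> s; rewrite /cube_vertex big_ord0; apply: connected_refl.
Qed.

(** The product of a cube with one edge to its right: the last word of the cube becomes the gap
    before the new factor. *)
Lemma has_cube_extend a u v b n : move P u v ->
  squier_has_cube P a n -> squier_has_cube P (a ++ u ++ b) n.+1.
Proof.
move=> uv [c hc].
pose ext T (f : 'I_n -> T) z (i : 'I_n.+1) := oapp f z (unlift ord_max i).
have extE T (f : 'I_n -> T) z i : ext T f z (widen_ord (leqnSn n) i) = f i.
  rewrite /ext (_ : widen_ord _ _ = lift ord_max i) ?liftK //.
  by apply: val_inj; rewrite /= /bump leqNgt ltn_ord.
have extM T (f : 'I_n -> T) z : ext T f z ord_max = z.
  by rewrite /ext unlift_none.
have mvs i : move P (ext _ (cube_from c) u i) (ext _ (cube_to c) v i).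
  by rewrite /ext; case: (unlift ord_max i) => //= j; apply: cube_move.
exists (Cube (ext _ (cube_gap c) (cube_last c)) b mvs) => s.
rewrite /cube_vertex /= big_ord_recr /= !extM -!catA.
rewrite (eq_bigr (fun i : 'I_n => cube_gap c i ++
  (if s (widen_ord (leqnSn n) i) then cube_to c i else cube_from c i)));
  last by move=> i _; rewrite !extE.
have h := hc (fun i => s (widen_ord (leqnSn n) i)).
(* From [a ++ u ++ b], first go to the vertex of the old cube with [u ++ b] on its right, then apply
   [u -> v] if [s] selects it. *)
apply: connected_trans (connected_cat [::] (u ++ b) h) _.
rewrite /cube_vertex /= -!catA.
case: (s ord_max); last exact: connected_refl.
have := connected_move ((\big[cat/[::]]_(i < n) (cube_gap c i ++
  (if s (widen_ord (leqnSn n) i) then cube_to c i else cube_from c i)))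
  ++ cube_last c) b uv.
by rewrite -!catA.
Qed.

(** The 0-cube and the bound [N] make the maximum exist, so [xget] returns it and not its
    default. *)
Lemma squier_dimP x : squier_finite_dim P x ->
  squier_has_cube P x (squier_dim P x) /\
  forall m, squier_has_cube P x m -> (m <= squier_dim P x)%N.
Proof.
move=> [N hN]; rewrite /squier_dim.
set A := (X in xget _ X).
suff [n An] : exists n, A n by exact: (xgetPex 0%N (ex_intro _ n An)).
pose Q := [pred n | `[< squier_has_cube P x n >]].
have exQ : exists n, Q n by exists 0%N; apply/asboolP; apply: has_cube0.
have ubQ i : Q i -> (i <= N)%N by move/asboolP/hN.
case: (ex_maxnP exQ ubQ) => n /asboolP hn max_n.
by exists n; split=> // m hm; apply: max_n; apply/asboolP.
Qed.

Lemma finite_dim_connected x y : squier_connected P x y ->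
  squier_finite_dim P x -> squier_finite_dim P y.
Proof.
move=> xy [N hN]; exists N => n hn; apply: hN.
exact: has_cube_connected (connected_sym xy) hn.
Qed.

(* A cube at the left of a move extends by that move to a larger cube. *)
Lemma squier_dim_left a u v b : move P u v ->
  squier_finite_dim P (a ++ u ++ b) ->
  (squier_dim P a < squier_dim P (a ++ u ++ b))%N.
Proof.
move=> uv fin; have [_ max_ub] := squier_dimP fin.
have fin_a : squier_finite_dim P a.
  case: fin => N hN; exists N => n hn.
  exact: leq_trans (leqnSn n) (hN _ (has_cube_extend b uv hn)).
apply: max_ub; apply: has_cube_extend uv _.
by case: (squier_dimP fin_a).
Qed.

End SquierDim.

(** * Derivations up to homotopy *)

Section Derivations.
Variables (Sg : Type) (P : presentation Sg).
Implicit Types a b u v x y z : seq Sg.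

(** An oriented edge of the Squier complex as bare data. That [mu -> mv] is a move is asked in
    [dpath], so equality of edges is equality of words. *)
Record medge := Medge { ml : seq Sg; mu : seq Sg; mv : seq Sg; mr : seq Sg }.
Implicit Types (m : medge) (d e : seq medge).

Definition msrc m := ml m ++ mu m ++ mr m.
Definition mtgt m := ml m ++ mv m ++ mr m.
Definition minv m := Medge (ml m) (mv m) (mu m) (mr m).

Fixpoint dpath x d y : Prop :=
  if d is m :: d' then [/\ move P (mu m) (mv m), x = msrc m & dpath (mtgt m) d' y]
  else x = y.

Lemma dpath_cat x d1 d2 z :
  dpath x (d1 ++ d2) z <-> exists2 y, dpath x d1 y & dpath y d2 z.
Proof.
elim: d1 x => [|m d1 IH] x /=.
  by split=> [h|[y -> //]]; exists x.
split=> [[h1 h2 /IH [y h3 h4]]|[y [h1 h2 h3] h4]]; first by exists y.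
by split=> //; apply/IH; exists y.
Qed.

Lemma dpath_fun x d y y' : dpath x d y -> dpath x d y' -> y = y'.
Proof.
elim: d x => [|m d IH] x /=; first by move=> <- <-.
by case=> _ _ h [_ _]; apply: IH.
Qed.

Lemma dpath_connected x d y : dpath x d y -> squier_connected P x y.
Proof.
elim: d x => [|m d IH] x /=; first by move=> ->; apply: connected_refl.
case=> h -> /IH; apply: connected_trans; exact: connected_move.
Qed.

Definition drev d := rev (map minv d).

Lemma dpath_rev x d y : dpath x d y -> dpath y (drev d) x.
Proof.
elim: d x => [|m d IH] x /=; first by move=> ->.
case=> h -> /IH {}IH; rewrite /drev map_cons rev_cons -cats1.
apply/dpath_cat; exists (mtgt m) => //=; split=> //; exact: moveC.
Qed.

(** The two ways around a square of the Squier complex. Endpoints and relations are not recorded;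
    [swap_dpath] recovers them, and [swap] stays a congruence of plain lists. *)
Inductive swap : seq medge -> seq medge -> Prop :=
| swap_refl d : swap d d
| swap_sym d d' : swap d d' -> swap d' d
| swap_trans d' d d'' : swap d d' -> swap d' d'' -> swap d d''
| swap_step d1 a u v b u' v' c d2 :
    swap (d1 ++ [:: Medge a u v (b ++ u' ++ c);
                    Medge (a ++ v ++ b) u' v' c] ++ d2)
         (d1 ++ [:: Medge (a ++ u ++ b) u' v' c;
                    Medge a u v (b ++ v' ++ c)] ++ d2).

Lemma swap_cat l r d d' : swap d d' -> swap (l ++ d ++ r) (l ++ d' ++ r).
Proof.
elim=> [d0|d0 d1 _ h|d0 d1 d2 _ h1 _ h2|d1 a u v b u' v' c d2].
- exact: swap_refl.
- exact: swap_sym.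
- exact: swap_trans h1 h2.
- by have := swap_step (l ++ d1) a u v b u' v' c (d2 ++ r); rewrite -!catA.
Qed.

Lemma swap_size d d' : swap d d' -> size d = size d'.
Proof.
elim=> [//|//|d0 d1 d2 _ -> _ -> //|d1 a u v b u' v' c d2].
by rewrite !size_cat.
Qed.

Lemma swap_dpath x y d d' : swap d d' -> (dpath x d y <-> dpath x d' y).
Proof.
elim=> [//|d0 d1 _ [h1 h2]|d0 d1 d2 _ h1 _ h2|d1 a u v b u' v' c d2].
- by split.
- by split=> [/h1 /h2|/h2 /h1].
- split=> /dpath_cat [z h1 /= [m1 zE [m2 _ h4]]]; apply/dpath_cat; exists z => //;
    move: h4; rewrite zE /msrc /mtgt /= -?catA => h4;
    by split; [|by rewrite /msrc /= -?catA|split]; rewrite // /msrc /mtgt /= -?catA.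
Qed.

(** Homotopy of edge paths with fixed ends: squares and backtracking. The classes of loops at [w]
    form the fundamental group of the complex. *)
Inductive hom x y : seq medge -> seq medge -> Prop :=
| hom_swap d d' : dpath x d y -> swap d d' -> hom x y d d'
| hom_sym d d' : hom x y d d' -> hom x y d' d
| hom_trans d' d d'' : hom x y d d' -> hom x y d' d'' -> hom x y d d''
| hom_cancel d1 m d2 : dpath x (d1 ++ [:: m; minv m] ++ d2) y ->
    hom x y (d1 ++ [:: m; minv m] ++ d2) (d1 ++ d2).

Lemma hom_refl x y d : dpath x d y -> hom x y d d.
Proof. by move=> h; apply: hom_swap h _; apply: swap_refl. Qed.

Lemma dpath_cancel x y d1 m d2 :
  dpath x (d1 ++ [:: m; minv m] ++ d2) y -> dpath x (d1 ++ d2) y.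
Proof.
move=> /dpath_cat [z h1 /= [h2 h3 [_ _ h4]]]; apply/dpath_cat; exists z => //.
by rewrite h3.
Qed.

Lemma hom_dpath x y d d' : hom x y d d' -> dpath x d y /\ dpath x d' y.
Proof.
elim=> [d0 d1 h s|d0 d1 _ [] //|d0 d1 d2 _ [h1 _] _ [_ h2]|d1 m d2 h].
- by split=> //; apply/(swap_dpath x y s).
- by [].
- by split=> //; apply: dpath_cancel h.
Qed.

Lemma hom_cat x x' y y' l r d d' :
  dpath x' l x -> dpath y r y' -> hom x y d d' ->
  hom x' y' (l ++ d ++ r) (l ++ d' ++ r).
Proof.
move=> hl hr.
have ext e : dpath x e y -> dpath x' (l ++ e ++ r) y'.
  by move=> he; apply/dpath_cat; exists x => //; apply/dpath_cat; exists y.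
elim=> [d0 d1 h s|d0 d1 _ h|d0 d1 d2 _ h1 _ h2|d1 m d2 h].
- by apply: hom_swap; [apply: ext|apply: swap_cat].
- exact: hom_sym.
- exact: hom_trans h1 h2.
- have := ext _ h; rewrite -!catA [l ++ d1 ++ _]catA => /hom_cancel.
  by rewrite -!catA.
Qed.

Lemma hom_rev_cancel x y d : dpath x d y -> hom x x (d ++ drev d) [::].
Proof.
elim: d x => [|m d IH] x /=; first by move=> _; apply: hom_refl.
case=> h1 -> h2; rewrite /drev map_cons rev_cons -/(drev d) -cats1.
have hm : dpath (msrc m) [:: m] (mtgt m) by [].
have hm' : dpath (mtgt m) [:: minv m] (msrc m).
  by split=> //; apply: moveC.
have := hom_cat hm hm' (IH _ h2); rewrite -catA /= => h; apply: hom_trans h _.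
by apply: (@hom_cancel _ _ [::] m [::]) => /=; do !split=> //; apply: moveC.
Qed.

Lemma drevK d : drev (drev d) = d.
Proof.
rewrite /drev map_rev revK -map_comp -[RHS]map_id; apply: eq_map.
by case.
Qed.

(** The counterpart of a diagram without dipoles: the two cells of a dipole need not be consecutive
    in [d], hence the passage through [swap]. *)
Definition dreduced d :=
  forall d1 m d2, ~ swap d (d1 ++ [:: m; minv m] ++ d2).

Lemma dreduced_catl d1 d2 : dreduced (d1 ++ d2) -> dreduced d1.
Proof.
move=> h e1 m e2 /(swap_cat [::] d2) /= s; apply: (h e1 m (e2 ++ d2)).
by apply: swap_trans s _; rewrite -!catA; apply: swap_refl.
Qed.

(** Each cancellation shortens the list by two. The bound on the size later converts the length of a
    path into a number of cells. *)
Lemma hom_dreduced x y d : dpath x d y ->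
  exists d', [/\ hom x y d d', dreduced d' & size d' <= size d].
Proof.
elim: {d}_.+1 {-2}d (ltnSn (size d)) => // n IH d; rewrite ltnS => dn hd.
have [red|] := pselect (dreduced d).
  by exists d; split=> //; apply: hom_refl.
move=> /existsNP [d1 /existsNP [m /existsNP [d2 /contrapT s]]].
have hd' := (swap_dpath x y s).1 hd.
have sz := swap_size s; rewrite !size_cat /= in sz.
have [|d' [h1 h2 h3]] := IH (d1 ++ d2) _ (dpath_cancel hd').
  by rewrite size_cat; lia.
exists d'; split=> //; last by rewrite size_cat in h3; lia.
apply: hom_trans (hom_swap hd s) _; apply: hom_trans h1; exact: hom_cancel.
Qed.

End Derivations.

(** * Histories of cells *)

(* The history of an edge of a diagram: either the [n]-th edge of the top path
   or the [j]-th bottom edge of a cell, which is itself given by its colour,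
   the histories of its top edges, and its two labels. *)
Inductive wire (Sg : Type) :=
| Init of nat
| Out of tcell Sg & nat
with tcell (Sg : Type) :=
| TCell of nat & seq (wire Sg) & seq Sg & seq Sg.

HB.instance Definition _ (Sg : Type) := gen_eqMixin (wire Sg).
HB.instance Definition _ (Sg : Type) := gen_eqMixin (tcell Sg).

Lemma cat_eq_split (T : Type) (a u b a1 v1 b1 : seq T) :
  a ++ u ++ b = a1 ++ v1 ++ b1 -> size a + size u <= size a1 ->
  exists c, a1 = a ++ u ++ c /\ b = c ++ v1 ++ b1.
Proof.
move=> E s.
have Ea1 : a1 = take (size a1) (a ++ u ++ b) by rewrite E take_size_cat.
have Eb1 : v1 ++ b1 = drop (size a1) (a ++ u ++ b) by rewrite E drop_size_cat.
exists (take (size a1 - (size a + size u)) b).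
have lt1 : (size a1 < size a) = false by lia.
have lt2 : (size a1 - size a < size u) = false by lia.
rewrite [X in X = _]Ea1 Eb1 !take_cat !drop_cat lt1 lt2 -subnDA.
by rewrite cat_take_drop.
Qed.

Lemma mem_nth_mid (T : eqType) (x0 : T) (a u b : seq T) i :
  size a <= i < size a + size u -> nth x0 (a ++ u ++ b) i \in u.
Proof.
move=> /andP[h1 h2]; rewrite !nth_cat ltnNge h1 /=.
have -> : i - size a < size u by lia.
by apply: mem_nth; lia.
Qed.

(** The witness sits at position [maxn (size a) (size a1)], where the later of the two segments
    begins. *)
Lemma cat_eq_overlap (T : eqType) (a u b a1 v1 b1 : seq T) :
  a ++ u ++ b = a1 ++ v1 ++ b1 -> u != [::] -> v1 != [::] ->
  size a < size a1 + size v1 -> size a1 < size a + size u ->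
  exists2 x, x \in u & x \in v1.
Proof.
case: u v1 => [|x0 u] // [|y0 v1] // E _ _ lt1 lt2.
exists (nth x0 (a ++ (x0 :: u) ++ b) (maxn (size a) (size a1))).
  by apply: mem_nth_mid; move: lt1 lt2 => /=; lia.
by rewrite E; apply: mem_nth_mid; move: lt1 lt2 => /=; lia.
Qed.

Section Histories.
Variables (Sg : Type) (P : presentation Sg).
Implicit Types (s : seq (wire Sg)) (m : medge Sg) (d e : seq (medge Sg)).
Implicit Types (c : tcell Sg) (C : seq (tcell Sg)) (x y z w : seq Sg).

Definition tcol c := let: TCell k _ _ _ := c in k.
Definition tins c := let: TCell _ U _ _ := c in U.
Definition ttop c := let: TCell _ _ u _ := c in u.
Definition tbot c := let: TCell _ _ _ v := c in v.

Definition outs c := [seq Out c j | j <- iota 0 (size (tbot c))].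

Lemma size_outs c : size (outs c) = size (tbot c).
Proof. by rewrite size_map size_iota. Qed.

Lemma outs_uniq c : uniq (outs c).
Proof. by rewrite map_inj_uniq ?iota_uniq // => i j []. Qed.

Lemma mem_outs c c' j : Out c' j \in outs c -> c' = c.
Proof. by case/mapP=> i _ []. Qed.

Lemma outs_inter c c' t : t \in outs c -> t \in outs c' -> c = c'.
Proof. by case/mapP=> i _ -> /mem_outs. Qed.

(** The name of a cell must survive swaps. The right context is absent from it, and the left one
    enters only through the dimension of its component, which commuting moves do not alter. *)
Definition gcell s m :=
  TCell (squier_dim P (ml m)) (take (size (mu m)) (drop (size (ml m)) s))
    (mu m) (mv m).

Definition gstep s m :=
  take (size (ml m)) s ++ outs (gcell s m) ++ drop (size (ml m) + size (mu m)) s.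

Fixpoint gcells s d :=
  if d is m :: d' then gcell s m :: gcells (gstep s m) d' else [::].

Definition gend s d := foldl gstep s d.

Lemma gend_cat s d e : gend s (d ++ e) = gend (gend s d) e.
Proof. exact: foldl_cat. Qed.

Lemma gcells_cat s d e : gcells s (d ++ e) = gcells s d ++ gcells (gend s d) e.
Proof. by elim: d s => //= m d IH s; rewrite IH. Qed.

Lemma size_gcells s d : size (gcells s d) = size d.
Proof. by elim: d s => //= m d IH s; rewrite IH. Qed.

Lemma wire_split s m : size s = size (msrc m) -> exists A U B,
  [/\ s = A ++ U ++ B, size A = size (ml m), size U = size (mu m)
    & size B = size (mr m)].
Proof.
rewrite !size_cat => h.
exists (take (size (ml m)) s), (take (size (mu m)) (drop (size (ml m)) s)),
  (drop (size (mu m)) (drop (size (ml m)) s)).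
rewrite !cat_take_drop; split=> //.
- by rewrite size_takel //; lia.
- by rewrite size_takel // size_drop; lia.
- by rewrite !size_drop; lia.
Qed.

Lemma gcellE A U B m : size A = size (ml m) -> size U = size (mu m) ->
  gcell (A ++ U ++ B) m = TCell (squier_dim P (ml m)) U (mu m) (mv m).
Proof. by move=> hA hU; rewrite /gcell -hA -hU drop_size_cat ?take_size_cat. Qed.

Lemma gstepE A U B m : size A = size (ml m) -> size U = size (mu m) ->
  gstep (A ++ U ++ B) m =
  A ++ outs (TCell (squier_dim P (ml m)) U (mu m) (mv m)) ++ B.
Proof.
move=> hA hU; rewrite /gstep gcellE // -hA take_size_cat //.
by rewrite -hU addnC -drop_drop drop_size_cat // drop_size_cat.
Qed.

Lemma size_gstep s m :
  size s = size (msrc m) -> size (gstep s m) = size (mtgt m).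
Proof.
move=> /wire_split [A [U [B [-> hA hU hB]]]].
by rewrite gstepE // !size_cat size_outs hA hB.
Qed.

Lemma size_gend s x d y :
  dpath P x d y -> size s = size x -> size (gend s d) = size y.
Proof.
elim: d x s => [|m d IH] x s /=; first by move=> ->.
by case=> _ -> h1 h2; apply: IH h1 _; apply: size_gstep.
Qed.

(** The two moves read disjoint segments of wires, and the colour of the right one is the same
    before and after [u -> v], since [a ++ u ++ b] and [a ++ v ++ b] lie in one component. *)
Lemma swap_gstep s (a u v b u' v' r : seq Sg) :
    size s = size (a ++ u ++ b ++ u' ++ r) -> move P u v ->
  let m1 := Medge a u v (b ++ u' ++ r) in
  let m2 := Medge (a ++ v ++ b) u' v' r in
  let m2' := Medge (a ++ u ++ b) u' v' r in
  let m1' := Medge a u v (b ++ v' ++ r) in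
  [/\ gcell (gstep s m2') m1' = gcell s m1, gcell (gstep s m1) m2 = gcell s m2'
    & gstep (gstep s m2') m1' = gstep (gstep s m1) m2].
Proof.
move=> hs uv m1 m2 m2' m1'.
have [A [U [R [-> hA hU]]]] : exists A U R, [/\ s = A ++ U ++ R,
   size A = size a, size U = size u & size R = size (b ++ u' ++ r)].
  exact: (@wire_split s m1).
move=> /(@wire_split R (Medge b u' v' r)) [B [U' [C [-> /= hB hU' hC]]]].
have dimE : squier_dim P (a ++ v ++ b) = squier_dim P (a ++ u ++ b).
  exact: squier_dim_connected (connected_move _ _ (moveC uv)).
rewrite (@gcellE A U _ m1) // (@gstepE A U _ m1) //.
have E : A ++ U ++ B ++ U' ++ C = (A ++ U ++ B) ++ U' ++ C by rewrite -!catA.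
have s1 : size (A ++ U ++ B) = size (ml m2').
  by rewrite /= !size_cat hA hU hB.
rewrite E (gcellE _ s1 hU') (gstepE _ s1 hU') -!catA.
rewrite (@gcellE A U _ m1') // (@gstepE A U _ m1') //.
set O := outs _.
have E' X : A ++ O ++ B ++ X ++ C = (A ++ O ++ B) ++ X ++ C by rewrite -!catA.
have s2 : size (A ++ O ++ B) = size (ml m2).
  by rewrite /= !size_cat hA hB size_outs.
by rewrite !E' (gcellE _ s2 hU') (gstepE _ s2 hU') /= dimE.
Qed.

Definition wires_of s C := s ++ flatten (map tins C).

(** The bookkeeping that makes names faithful: a wire is consumed at most once and then leaves the
    front for good, and the producer of every wire met so far has been listed. *)
Definition history s C :=
  [/\ uniq (wires_of s C), forall c j, Out c j \in wires_of s C -> c \in C,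
      uniq C & forall c, c \in C -> tins c != [::]].

Lemma history_step s C m : size s = size (msrc m) -> move P (mu m) (mv m) ->
  history s C -> history (gstep s m) (rcons C (gcell s m)).
Proof.
move=> /wire_split [A [U [B [-> hA hU hB]]]] uv [h1 h2 h3 h4].
rewrite gstepE // gcellE //; set c := TCell _ _ _ _.
have U0 : U != [::] by case: (U) hU (move_nonempty uv) => //=; case: (mu m) => // _ [].
(* A repeated cell would have its first input both on the front and among the wires already
   consumed. *)
have cC : c \notin C.
  apply/negP => cC; case EU: U U0 => [|t0 U1] // _.
  move: h1; rewrite /wires_of EU cat_uniq => /and3P[_ /hasPn h _].
  have /h : t0 \in flatten (map tins C).
    by apply/flattenP; exists (tins c); [apply: map_f|rewrite /= EU inE eqxx].
  by rewrite !mem_cat inE eqxx orbT.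
have perm : perm_eq (wires_of (A ++ outs c ++ B) (rcons C c))
    (outs c ++ wires_of (A ++ U ++ B) C).
  rewrite /wires_of map_rcons -cats1 flatten_cat /= cats0.
  by apply/permP => p; rewrite !count_cat; lia.
have oN t : t \in outs c -> t \notin wires_of (A ++ U ++ B) C.
  by case/mapP=> i _ ->; apply/negP => /h2; apply/negP.
split.
- rewrite (perm_uniq perm) cat_uniq outs_uniq h1 andbT /=.
  by apply/hasPn => t ht; apply/negP => /oN; rewrite ht.
- move=> c' j; rewrite (perm_mem perm) mem_cat mem_rcons inE => /orP[/mem_outs ->|/h2 ->].
    by rewrite eqxx.
  by rewrite orbT.
- by rewrite rcons_uniq cC.
- by move=> c'; rewrite mem_rcons inE => /orP[/eqP->|/h4].
Qed.

Lemma history_gend x d y s C : dpath P x d y -> size s = size x ->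
  history s C -> history (gend s d) (C ++ gcells s d).
Proof.
elim: d x s C => [|m d IH] x s C /=; first by rewrite cats0.
case=> uv -> h hs hist; rewrite -cat_rcons.
apply: IH h _ _; first exact: size_gstep.
exact: history_step.
Qed.

Definition inits w : seq (wire Sg) := [seq Init Sg i | i <- iota 0 (size w)].

Lemma size_inits w : size (inits w) = size w.
Proof. by rewrite size_map size_iota. Qed.

Lemma history_inits w d y :
  dpath P w d y -> history (gend (inits w) d) (gcells (inits w) d).
Proof.
move=> h; rewrite -[gcells _ _]cat0s; apply: history_gend h _ _.
  exact: size_inits.
split=> //; rewrite /wires_of cats0.
- by rewrite map_inj_uniq ?iota_uniq // => i j [].
- by move=> c j /mapP[].
Qed.

End Histories.

Arguments gcell : simpl never.
Arguments gstep : simpl never.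

(** * Reordering derivations and extracting a common prefix *)

Section CommonPrefix.
Variables (Sg : Type) (P : presentation Sg).
Implicit Types (s : seq (wire Sg)) (m : medge Sg) (d e z : seq (medge Sg)).
Implicit Types (c : tcell Sg) (C : seq (tcell Sg)) (x y w : seq Sg).

Lemma swap_gend d d' : swap d d' -> forall x y s, dpath P x d y ->
  size s = size x ->
  gend P s d = gend P s d' /\ perm_eq (gcells P s d) (gcells P s d').
Proof.
elim=> [//|d0 d1 sw IH|d0 d1 d2 sw1 IH1 sw2 IH2|d1 a u v b u' v' r d2] x y s h hs.
- have /(IH _ _ s)/(_ hs) [-> p] := (swap_dpath P x y sw).2 h.
  by rewrite perm_sym.
- have [-> p1] := IH1 _ _ _ h hs.
  have /(IH2 _ _ s)/(_ hs) [-> p2] := (swap_dpath P x y sw1).1 h.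
  by split=> //; apply: perm_trans p1 p2.
- move/dpath_cat: h => [t h1 /= [h2 et _]].
  have hs1 := size_gend h1 hs; rewrite et in hs1.
  rewrite !gend_cat !gcells_cat /=.
  have [-> -> ->] := swap_gstep v' hs1 h2.
  by split=> //; apply/permP => p; rewrite !count_cat /=; lia.
Qed.

(** Finite dimension passes from the whole word to the prefix [a ++ u ++ b], because the second move
    extends every cube of that prefix to a cube of the whole word. *)
Lemma commuting_colors x d a u v b u' v' r t :
  squier_finite_dim P x -> dpath P x d t -> t = a ++ u ++ b ++ u' ++ r ->
  move P u v -> move P u' v' -> squier_dim P a < squier_dim P (a ++ u ++ b).
Proof.
move=> fin h et uv uv'; apply: squier_dim_left uv _.
have [N hN] := finite_dim_connected (dpath_connected h) fin.
exists N => n hn; apply: leq_trans (leqnSn n) _; apply: hN.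
by have := has_cube_extend r uv' hn; rewrite et -!catA.
Qed.

(** The two exchanged cells have different colours, so at most one of them survives the filter and
    their order is invisible. *)
Lemma swap_color d d' : swap d d' -> forall x y s k, dpath P x d y ->
  size s = size x -> squier_finite_dim P x ->
  [seq c <- gcells P s d | tcol c == k] = [seq c <- gcells P s d' | tcol c == k].
Proof.
elim=> [//|d0 d1 sw IH|d0 d1 d2 sw1 IH1 sw2 IH2|d1 a u v b u' v' r d2] x y s k h hs fin.
- by rewrite (IH x y) //; apply/(swap_dpath P x y sw).
- by rewrite (IH1 x y) // (IH2 x y) //; apply/(swap_dpath P x y sw1).
- move/dpath_cat: h => [t h1 /= [h2 et [h3 et' _]]].
  have hs1 := size_gend h1 hs; rewrite et in hs1.
  rewrite !gcells_cat /= !filter_cat; congr (_ ++ _).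
  have [-> -> ->] := swap_gstep v' hs1 h2.
  rewrite /=.
  have lt := commuting_colors fin h1 et h2 h3.
  case: (squier_dim P a =P k) => [ek|_]; case: (_ =P k) => // ek'.
  by move: lt; rewrite ek ek' ltnn.
Qed.

(** A converse of [swap_step], read off histories: as both sides of a relation are non-empty,
    overlapping segments would share a wire. Disjoint segments leave two cases, [m] to the right or
    to the left of [m1]. *)
Lemma adjacent_swap x y m1 m s : dpath P x [:: m1; m] y -> size s = size x ->
  {in tins (gcell P (gstep P s m1) m), forall t, t \notin outs (gcell P s m1)} ->
  exists m0 m1', [/\ swap [:: m1; m] [:: m0; m1'],
    gcell P s m0 = gcell P (gstep P s m1) m
    & gcell P (gstep P s m0) m1' = gcell P s m1].
Proof.
case=> uv1 -> [uv et _] hs dis.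
have over : ~~ ((size (ml m) < size (ml m1) + size (mv m1)) &&
                (size (ml m1) < size (ml m) + size (mu m))).
  apply/negP => /andP[lt2 lt1].
  have hs1 : size (gstep P s m1) = size (msrc m) by rewrite size_gstep // et.
  have [A1 [U1 [B1 [es hA1 hU1 hB1]]]] := wire_split hs.
  have [A [U [B [es1 hA hU hB]]]] := wire_split hs1.
  move: dis; rewrite es1 gcellE // es gcellE // => dis.
  have gE := gstepE P B1 hA1 hU1; rewrite -es es1 in gE.
  have [] := cat_eq_overlap gE.
  - by rewrite -size_eq0 hU; case: (mu m) (move_nonempty uv) => //= -[].
  - by rewrite -size_eq0 size_outs /=; case: (mv m1) (move_nonempty uv1) => //= -[].
  - by rewrite size_outs /= hA hA1.
  - by rewrite hA hA1 hU.
  - by move=> t /dis /negP.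
move: m1 m uv1 uv hs over et {dis} => [a1 u1 v1 b1] [a u v b] uv1 uv hs.
rewrite negb_and -!leqNgt /mtgt => over et.
case/orP: over => [le2|le1].
  have [r [ea eb]] := cat_eq_split et le2; simpl in ea, eb; subst a b1.
  exists (Medge (a1 ++ u1 ++ r) u v b), (Medge a1 u1 v1 (r ++ v ++ b)).
  have [E1 E2 _] := swap_gstep v hs uv1.
  by split=> //; exact: (@swap_step _ [::]).
have [r [ea1 eb]] := cat_eq_split (esym et) le1; simpl in ea1, eb; subst a1 b.
exists (Medge a u v (r ++ u1 ++ b1)), (Medge (a ++ v ++ r) u1 v1 b1).
have hs' : size s = size (a ++ u ++ r ++ u1 ++ b1).
  by rewrite hs /msrc /= -!catA.
have [E1 E2 _] := swap_gstep v1 hs' uv.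
by split=> //; apply: swap_sym; exact: (@swap_step _ [::]).
Qed.

(** A cell consuming no output of its predecessors bubbles up to the front, one adjacent exchange at
    a time. *)
Lemma front_swap x y e m s : dpath P x (rcons e m) y -> size s = size x ->
  {in gcells P s e & tins (gcell P (gend P s e) m),
    forall c t, t \notin outs c} ->
  exists m0 e', swap (rcons e m) (m0 :: e') /\
    gcell P s m0 = gcell P (gend P s e) m.
Proof.
elim/last_ind: e m y => [|e m1 IH] m y h hs dis.
  by exists m, [::]; split=> //; apply: swap_refl.
move: h dis; rewrite -!cats1 -catA gend_cat gcells_cat /= => h dis.
move/dpath_cat: (h) => [t h1 h2].
have hs1 := size_gend h1 hs.
have [t' ht' |m0 [m1' [sw gE gE1]]] := adjacent_swap h2 hs1.
  by apply: dis => //; rewrite mem_cat inE eqxx orbT.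
have sw' := swap_cat e [::] sw; rewrite !cats0 in sw'.
have h' := (swap_dpath P x y sw').1 h.
have /dpath_cat [t1 h3 _] : dpath P x (rcons e m0 ++ [:: m1']) y.
  by rewrite -cats1 -catA.
have [c' t' cin tin|m2 [e' [sw2 gE2]]] := IH _ _ h3 hs.
  by apply: dis; [rewrite mem_cat cin|move: tin; rewrite gE].
exists m2, (e' ++ [:: m1']); split; last by rewrite gE2 gE.
apply: swap_trans sw' _.
have := swap_cat [::] [:: m1'] sw2.
by rewrite -cats1 -catA /=.
Qed.

(** Nothing has consumed an output of [c], so no later cell depends on [c] and it can be made the
    last one. This exposes the cell that a later move might undo. *)
Lemma back_swap w y d c : dpath P w d y -> tbot c <> [::] ->
  {subset outs c <= gend P (inits w) d} ->
  exists d' m, swap d (rcons d' m) /\ gcell P (gend P (inits w) d') m = c.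
Proof.
elim/last_ind: d y => [|d m1 IH] y h nc sub.
  case E: (outs c) sub => [|t o] sub.
    by move: (congr1 size E); rewrite size_outs; case: (tbot c) nc.
  have : t \in inits w by apply: sub; rewrite inE eqxx.
  have : t \in outs c by rewrite E inE eqxx.
  by case/mapP=> i _ -> /mapP[].
have [e1|ne] := eqVneq (gcell P (gend P (inits w) d) m1) c.
  by exists d, m1; split=> //; apply: swap_refl.
have [hist_u _ _ _] := history_inits h.
move: (h) sub hist_u; rewrite -!cats1 gend_cat gcells_cat /= => h' sub hist_u.
move/dpath_cat: h' => [t h1 h2].
have hs1 := size_gend h1 (size_inits w).
have hsm : size (gend P (inits w) d) = size (msrc m1) by rewrite hs1; case: h2 => _ ->.
have [A [U [B [es hA hU hB]]]] := wire_split hsm.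
move: sub hist_u ne; rewrite es gstepE // gcellE //; set c1 := TCell _ _ _ _.
move=> sub hist_u ne.
have subd : {subset outs c <= gend P (inits w) d}.
  move=> o ho; move: (sub _ ho); rewrite es !mem_cat => /or3P[->//|ho1|->].
    by move: ne; rewrite (outs_inter ho ho1) eqxx.
  by rewrite !orbT.
have [d' [m [sw gm]]] := IH _ h1 nc subd.
have sw' : swap (d ++ [:: m1]) (d' ++ [:: m; m1]).
  by have := swap_cat [::] [:: m1] sw; rewrite -cats1 -catA.
have h' := (swap_dpath P w y sw').1; rewrite cats1 in h'.
move/dpath_cat: (h' h) => [t' h3 h4].
have hs2 := size_gend h3 (size_inits w).
have gE : gstep P (gend P (inits w) d') m = A ++ U ++ B.
  have [e2 _] := swap_gend sw h1 (size_inits w).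
  by rewrite -es e2 -cats1 gend_cat.
(* An input of [m1] that is an output of [c] would be consumed and still on the final front, against
   uniqueness of wires. *)
have [|m0 [m1' [sw2 _ gE2]]] := adjacent_swap h4 hs2.
  move=> o; rewrite gE gcellE //= gm => oU; apply/negP => /sub oc.
  move: hist_u; rewrite /wires_of map_cat flatten_cat /= cats0.
  rewrite catA cat_uniq => /and3P[_ /hasPn/(_ o oU)].
  by rewrite mem_cat oc.
exists (d' ++ [:: m0]), m1'; split.
  apply: swap_trans sw' _; rewrite -cats1 -catA.
  by have := swap_cat d' [::] sw2; rewrite !cats0.
by rewrite gend_cat /= gE2.
Qed.

(** Wires on a front are distinct, so the first consumed wire fixes the length of the left context,
    and the common source word then fixes both contexts. *)
Lemma gcell_inj s m m' : uniq s -> size s = size (msrc m) -> mu m <> [::] ->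
  msrc m = msrc m' -> gcell P s m = gcell P s m' -> m = m'.
Proof.
move=> us hs nu em; have hs' := hs; rewrite em in hs'.
have [A [U [B [es hA hU hB]]]] := wire_split hs.
have [A' [U' [B' [es' hA' hU' hB']]]] := wire_split hs'.
rewrite {1}es gcellE // es' gcellE // => -[_ eU eu ev].
have eA : size A = size A'.
  case: U eU es hU => [|t U] eU es hU; first by case: (mu m) nu hU.
  move: us; rewrite -eU in es'.
  have i1 : t \notin A -> index t s = size A.
    by move=> tA; rewrite es index_cat (negPf tA) /= eqxx addn0.
  have i2 : t \notin A' -> index t s = size A'.
    by move=> tA; rewrite es' index_cat (negPf tA) /= eqxx addn0.
  move=> us; rewrite -i1 ?i2 //; apply/negP => tA.
    by move: us; rewrite es' cat_uniq => /and3P[_ /hasPn/(_ t)]; rewrite inE eqxx tA => /(_ isT).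
  by move: us; rewrite es cat_uniq => /and3P[_ /hasPn/(_ t)]; rewrite inE eqxx tA => /(_ isT).
move: em eu ev; rewrite /msrc; case: (m) (m') hA hA' => [a u v b] [a' u' v' b'] /=.
move=> hA hA' em eu ev; subst u' v'.
have := congr1 (take (size a)) em; rewrite take_size_cat // -hA eA hA' take_size_cat // => ea.
subst a'; have := congr1 (drop (size a + size u)) em.
by rewrite ![in RHS]catA ![in LHS]catA !drop_size_cat ?size_cat // => ->.
Qed.

(** Shared cells are moved one by one into [z], by induction on the length of the tail of [d]. *)
Lemma common_prefix w y y' d d' : dpath P w d y -> dpath P w d' y' ->
  exists z e e', [/\ swap d (z ++ e), swap d' (z ++ e')
    & {in gcells P (gend P (inits w) z) e,
        forall c, c \notin gcells P (gend P (inits w) z) e'}].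
Proof.
move=> hd hd'.
suff H n z e e' : size e <= n -> swap d (z ++ e) -> swap d' (z ++ e') ->
    exists z e e', [/\ swap d (z ++ e), swap d' (z ++ e')
    & {in gcells P (gend P (inits w) z) e,
        forall c, c \notin gcells P (gend P (inits w) z) e'}].
  exact: (H (size d) [::] d d' (leqnn _) (swap_refl d) (swap_refl d')).
elim: n z e e' => [|n IH] z e e' hn sd sd'.
  by exists z, e, e'; split=> //; case: e hn {sd}.
have hz := (swap_dpath P w y sd).1 hd.
have hz' := (swap_dpath P w y' sd').1 hd'.
move/dpath_cat: (hz) => [t hzt hte]; move/dpath_cat: (hz') => [t' hzt' hte'].
have et := dpath_fun hzt hzt'; subst t'.
have hs := size_gend hzt (size_inits w).
set s := gend P (inits w) z in hs *.
have [/hasP[c0 c0e' c0e]|/hasPn dis] :=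
    boolP (has [in gcells P s e] (gcells P s e')); last first.
  exists z, e, e'; split=> // c ce; apply/negP => ce'.
  by move/negP: (dis _ ce'); apply.
(* The first cell [c] of [e] shared with [e'] can be moved to the front of both:
   a cell producing a wire consumed by [c] comes before [c] in [e] and in [e'],
   so it would be an earlier shared cell. *)
pose i := find [in gcells P s e'] (gcells P s e).
have hhas : has [in gcells P s e'] (gcells P s e) by apply/hasP; exists c0.
have lti : i < size e by rewrite -(size_gcells P s e) -has_find.
have [m0 _] : exists m0 : medge Sg, True by case: (e) lti => // m0; exists m0.
pose e1 := take i e; pose m := nth m0 e i; pose e2 := drop i.+1 e.
have ee : e = rcons e1 m ++ e2.
  by rewrite -cats1 -catA /= -drop_nth // cat_take_drop.
have se1 : size e1 = i by rewrite size_takel // ltnW.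
set c := gcell P (gend P s e1) m.
have gcE : gcells P s e = gcells P s e1 ++ c :: gcells P (gstep P (gend P s e1) m) e2.
  by rewrite {1}ee -cats1 -catA gcells_cat.
have ce' : c \in gcells P s e'.
  have := nth_find c hhas; rewrite -/i gcE nth_cat size_gcells se1 ltnn subnn.
  by [].
have before c1 : c1 \in gcells P s e1 -> c1 \notin gcells P s e'.
  move=> h1; apply/negP => h2.
  have lt1 : index c1 (gcells P s e1) < i by rewrite -se1 -(size_gcells P s) index_mem.
  have := before_find c1 lt1.
  by rewrite gcE nth_cat size_gcells se1 lt1 nth_index //= h2.
have [hu hO hC _] := history_inits hz.
have [hu' hO' hC' _] := history_inits hz'.
have [hu0 hO0 hC0 _] := history_inits hzt.
rewrite gcells_cat -/s in hC; rewrite gcells_cat -/s in hC'.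
pose i' := index c (gcells P s e').
have lti' : i' < size e' by rewrite -(size_gcells P s e') index_mem.
pose e1' := take i' e'; pose m' := nth m0 e' i'; pose e2' := drop i'.+1 e'.
have ee' : e' = rcons e1' m' ++ e2'.
  by rewrite -cats1 -catA /= -drop_nth // cat_take_drop.
have se1' : size e1' = i' by rewrite size_takel // ltnW.
have gcE' : gcells P s e' = gcells P s e1' ++
   gcell P (gend P s e1') m' :: gcells P (gstep P (gend P s e1') m') e2'.
  by rewrite {1}ee' -cats1 -catA gcells_cat.
have cE' : gcell P (gend P s e1') m' = c.
  have := nth_index c ce'; rewrite -/i' gcE' nth_cat size_gcells se1' ltnn subnn.
  by [].
have hte1 : exists y1, dpath P t (rcons e1 m) y1.
  by move: hte; rewrite ee => /dpath_cat [y1 h _]; exists y1.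
have hte1' : exists y1, dpath P t (rcons e1' m') y1.
  by move: hte'; rewrite ee' => /dpath_cat [y1 h _]; exists y1.
case: hte1 => y1 hte1; case: hte1' => y1' hte1'.
(* The history of [c] names the producers of its inputs, and in any derivation they must have been
   executed before [c]. *)
have pres e0 mm y0 : dpath P t (rcons e0 mm) y0 -> gcell P (gend P s e0) mm = c ->
    forall c1 j, Out c1 j \in tins c -> c1 \in gcells P (inits w) z ++ gcells P s e0.
  rewrite -cats1 => /dpath_cat [y2 h2 [_ eq _]] ec c1 j ho.
  have hz0 : dpath P w (z ++ e0) y2 by apply/dpath_cat; exists t.
  have [_ hO1 _ _] := history_inits hz0.
  rewrite gcells_cat gend_cat -/s in hO1; apply: (hO1 _ j).
  rewrite mem_cat; apply/orP; left.
  move: ho; rewrite -ec /=.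
  by move/mem_take/mem_drop.
have zdis c1 : c1 \in gcells P (inits w) z ->
    (c1 \notin gcells P s e) * (c1 \notin gcells P s e').
  move=> h1; split; apply/negP => h2.
    by move: hC; rewrite cat_uniq => /and3P[_ /hasPn/(_ _ h2)]; rewrite h1.
  by move: hC'; rewrite cat_uniq => /and3P[_ /hasPn/(_ _ h2)]; rewrite h1.
have dis1 : {in gcells P s e1 & tins (gcell P (gend P s e1) m),
    forall c t, t \notin outs c}.
  move=> c1 o h1 h2; apply/negP => h3.
  case/mapP: (h3) => j _ eo; subst o.
  have h1e : c1 \in gcells P s e by rewrite gcE mem_cat h1.
  have := pres _ _ _ hte1' cE' _ _ h2; rewrite mem_cat => /orP[/zdis[]|h4].
    by rewrite h1e.
  by move/negP: (before _ h1); apply; rewrite gcE' mem_cat h4.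
have dis2 : {in gcells P s e1' & tins (gcell P (gend P s e1') m'),
    forall c t, t \notin outs c}.
  move=> c1 o h1; rewrite cE' => h2; apply/negP => h3.
  case/mapP: (h3) => j _ eo; subst o.
  have h1e : c1 \in gcells P s e' by rewrite gcE' mem_cat h1.
  have := pres _ _ _ hte1 (erefl c) _ _ h2; rewrite mem_cat => /orP[/zdis[]|h4].
    by rewrite h1e.
  by move/negP: (before _ h4); apply.
have [n0 [f [sw gf]]] := front_swap hte1 hs dis1.
have [n0' [f' [sw' gf']]] := front_swap hte1' hs dis2.
have /= [uv en _] := (swap_dpath P _ _ sw).1 hte1.
have /= [uv' en' _] := (swap_dpath P _ _ sw').1 hte1'.
(* Both moves now start from the same word with the same wires and create the same cell. *)
have en0 : n0 = n0'.
  apply: (@gcell_inj s); rewrite -?en -?en' //.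
  - by move: hu0; rewrite /wires_of cat_uniq => /andP[].
  - by have := move_nonempty uv => -[].
  - by rewrite gf gf' cE'.
subst n0'; apply: (IH (z ++ [:: n0]) (f ++ e2) (f' ++ e2')).
- move: hn; rewrite ee !size_cat (swap_size sw) /=; lia.
- apply: swap_trans sd _; rewrite ee -catA /=.
  by have := swap_cat z e2 sw.
- apply: swap_trans sd' _; rewrite ee' -catA /=.
  by have := swap_cat z e2' sw'.
Qed.

End CommonPrefix.

(** * The product of trees *)

Section Machine.
Variables (Sg : Type) (P : presentation Sg).
Implicit Types (s U : seq (wire Sg)) (m : medge Sg) (d e z : seq (medge Sg)).
Implicit Types (c : tcell Sg) (C : seq (tcell Sg)) (u v x y w : seq Sg).

(* The cells of each colour form a stack, on which a move either pushes its
   cell or, if it undoes the top cell, pops it. *)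
Definition act k U u v C :=
  let push := (outs (TCell k U u v), TCell k U u v :: C) in
  if C is c :: C' then
    if (c == TCell k (tins c) v u) && (U == outs c) then (tins c, C') else push
  else push.

Definition upd (S : nat -> seq (tcell Sg)) k C := fun i => if i == k then C else S i.

Lemma upd_eq S k C : upd S k C k = C.
Proof. by rewrite /upd eqxx. Qed.

Lemma upd_neq S k C i : i != k -> upd S k C i = S i.
Proof. by rewrite /upd => /negPf ->. Qed.

Lemma upd_upd S k C C' : upd (upd S k C) k C' = upd S k C'.
Proof. by apply: funext => i; rewrite /upd; case: eqP. Qed.

Lemma upd_id S k : upd S k (S k) = S.
Proof. by apply: funext => i; rewrite /upd; case: eqP => [->|]. Qed.

Lemma updC S k C k' C' : k != k' ->
  upd (upd S k C) k' C' = upd (upd S k' C') k C.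
Proof.
move=> ne; apply: funext => i; rewrite /upd.
by case: (i =P k') => [->|//]; rewrite eq_sym (negPf ne).
Qed.

(** The front of wires, together with one stack for each colour. *)
Definition mstate := (seq (wire Sg) * (nat -> seq (tcell Sg)))%type.
Implicit Types st : mstate.

Definition mstep st m : mstate :=
  let k := squier_dim P (ml m) in
  let r := act k (take (size (mu m)) (drop (size (ml m)) st.1)) (mu m) (mv m)
    (st.2 k) in
  (take (size (ml m)) st.1 ++ r.1 ++ drop (size (ml m) + size (mu m)) st.1,
   upd st.2 k r.2).

Definition mrun st d := foldl mstep st d.

Lemma mstepE A U B S m : size A = size (ml m) -> size U = size (mu m) ->
  let k := squier_dim P (ml m) in
  let r := act k U (mu m) (mv m) (S k) in
  mstep (A ++ U ++ B, S) m = (A ++ r.1 ++ B, upd S k r.2).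
Proof.
move=> hA hU /=; rewrite /mstep /= -hA -hU take_size_cat // drop_size_cat //.
by rewrite take_size_cat // addnC -drop_drop !drop_size_cat.
Qed.

(** The condition under which [act] pops [c'] instead of pushing [c]. In [wf_stack] it is forbidden
    for consecutive entries, as a stack where it held would have been popped. *)
Definition undoes c c' :=
  (c' == TCell (tcol c) (tins c') (tbot c) (ttop c)) && (tins c == outs c').

Definition wf_stack k C :=
  (forall c, c \in C -> tcol c = k /\ size (tins c) = size (ttop c)) /\
  sorted (fun c c' => ~~ undoes c c') C.

Definition wf_state st x :=
  size st.1 = size x /\ forall k, wf_stack k (st.2 k).

Lemma act_wf k U u v C : size U = size u -> wf_stack k C ->
  size (act k U u v C).1 = size v /\ wf_stack k (act k U u v C).2.
Proof.
move=> hU [w1 w2]; rewrite /act; case: C w1 w2 => [|c C] w1 w2.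
  by rewrite size_outs; split=> //; split=> // c; rewrite inE => /eqP ->.
case: ifP => [/andP[/eqP ec _]|nc] /=.
  split; first by have [_ ->] := w1 c (mem_head _ _); rewrite ec.
  split; last exact: path_sorted w2.
  by move=> c' h; apply: w1; rewrite inE h orbT.
rewrite size_outs; split=> //; split.
  by move=> c'; rewrite inE => /orP[/eqP -> //|/w1].
by rewrite /= /undoes /= nc.
Qed.

Lemma mstep_wf st m : wf_state st (msrc m) -> wf_state (mstep st m) (mtgt m).
Proof.
case: st => s S [/= hs w]; have [A [U [B [es hA hU hB]]]] := wire_split hs.
subst s; rewrite mstepE //=.
have [h1 h2] := act_wf (mv m) hU (w (squier_dim P (ml m))).
split; first by rewrite /= !size_cat h1 hA hB.
by move=> k /=; rewrite /upd; case: eqP => [->|].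
Qed.

(** The delicate case is a pop: the reverse move has to push the popped cell back and not pop the
    entry below it. Sortedness of the stack ensures this. *)
Lemma actK k U u v C : wf_stack k C ->
  let r := act k U u v C in act k r.1 v u r.2 = (U, C).
Proof.
move=> [w1 w2] /=; rewrite {2 3}/act; case: C w1 w2 => [|c C] w1 w2 /=.
  by rewrite !eqxx.
case: ifP => [/andP[/eqP ec /eqP eU]|_] /=; last by rewrite !eqxx.
have -> : act k (tins c) v u C = (outs c, c :: C); last by rewrite eU.
have push : TCell k (tins c) v u = c by rewrite -ec.
rewrite /act push; case: C w2 {w1} => [|c' C] //= /andP[nu _].
move: nu; rewrite /undoes.
have [-> -> ->] : [/\ tcol c = k, tbot c = u & ttop c = v] by rewrite ec.
by move=> /negPf ->.
Qed.

Lemma mstepK st m : wf_state st (msrc m) -> mstep (mstep st m) (minv m) = st.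
Proof.
case: st => s S [/= hs w]; have [A [U [B [es hA hU hB]]]] := wire_split hs.
subst s; rewrite mstepE //=.
have [h1 _] := act_wf (mv m) hU (w (squier_dim P (ml m))).
rewrite (@mstepE _ _ _ _ (minv m)) //= upd_eq upd_upd.
by rewrite actK //= upd_id.
Qed.

(** Moves of different colours act on different stacks and on disjoint segments of wires. *)
Lemma swap_mstep st a u v b u' v' (r : seq Sg) :
    wf_state st (a ++ u ++ b ++ u' ++ r) -> move P u v ->
    squier_dim P a != squier_dim P (a ++ u ++ b) ->
  mstep (mstep st (Medge a u v (b ++ u' ++ r))) (Medge (a ++ v ++ b) u' v' r) =
  mstep (mstep st (Medge (a ++ u ++ b) u' v' r)) (Medge a u v (b ++ v' ++ r)).
Proof.
case: st => s S [/= hs w] uv ne.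
set m1 := Medge a u v (b ++ u' ++ r); set m2 := Medge (a ++ v ++ b) u' v' r.
set m2' := Medge (a ++ u ++ b) u' v' r; set m1' := Medge a u v (b ++ v' ++ r).
have [A [U [R [es hA hU hR]]]] := @wire_split _ s m1 hs.
have [B [U' [C [eR hB hU' hC]]]] := @wire_split _ R (Medge b u' v' r) hR.
subst s R; simpl in hA, hU, hB, hU', hC.
have dimE : squier_dim P (a ++ v ++ b) = squier_dim P (a ++ u ++ b).
  exact: squier_dim_connected (connected_move _ _ (moveC uv)).
rewrite (@mstepE A U _ _ m1) //=.
have E X Y : A ++ X ++ B ++ Y ++ C = (A ++ X ++ B) ++ Y ++ C by rewrite -!catA.
rewrite !E.
have [h1 _] := act_wf v hU (w (squier_dim P a)).
rewrite (@mstepE _ U' C _ m2) //= ?size_cat ?h1 ?hA ?hB //.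
rewrite (@mstepE _ U' C _ m2') //= ?size_cat ?hU ?hA ?hB //.
rewrite -!catA (@mstepE A U _ _ m1') //= dimE.
by rewrite upd_neq 1?eq_sym // updC // [in RHS]upd_neq.
Qed.

Lemma mrun_wf x d y st : dpath P x d y -> wf_state st x ->
  wf_state (mrun st d) y.
Proof.
elim: d x st => [|m d IH] x st /=; first by move=> ->.
by case=> _ -> h w; apply: IH h _; apply: mstep_wf.
Qed.

Lemma mrun_cat st d e : mrun st (d ++ e) = mrun (mrun st d) e.
Proof. exact: foldl_cat. Qed.

Lemma mrun_swap d d' : swap d d' -> forall x y st, squier_finite_dim P x ->
  dpath P x d y -> wf_state st x -> mrun st d = mrun st d'.
Proof.
elim=> [//|d0 d1 sw IH|d0 d1 d2 sw1 IH1 sw2 IH2|d1 a u v b u' v' r d2] x y st fin h hs.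
- by rewrite (IH x y) //; apply/(swap_dpath P x y sw).
- by rewrite (IH1 x y) // (IH2 x y) //; apply/(swap_dpath P x y sw1).
- move/dpath_cat: h => [t h1 /= [h2 et [h3 et' _]]].
  rewrite !mrun_cat /=; have w := mrun_wf h1 hs; rewrite et in w.
  by rewrite swap_mstep // neq_ltn (commuting_colors fin h1 et h2 h3).
Qed.

(** Squares do not matter because commuting moves differ in colour, backtracks because a move and
    its inverse restore the state. *)
Lemma mrun_hom x y d d' st : squier_finite_dim P x -> hom P x y d d' ->
  wf_state st x -> mrun st d = mrun st d'.
Proof.
move=> fin h w; elim: h => [d0 d1 h sw|d0 d1 _ -> //|d0 d1 d2 _ -> _ //|d1 m d2].
  exact: mrun_swap sw _ _ _ fin h w.
move/dpath_cat => [t h1 /= [_ et _]]; rewrite !mrun_cat /= mstepK // -et.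
exact: mrun_wf h1 w.
Qed.

Definition mstate0 w : mstate := (inits w, fun=> [::]).

Lemma mstate0_wf w : wf_state (mstate0 w) w.
Proof. by split; [apply: size_inits|move=> k; split]. Qed.

Lemma uniq_pos (T : eqType) (t : T) A B A' B' :
  uniq (A ++ t :: B) -> A ++ t :: B = A' ++ t :: B' -> A = A'.
Proof.
move=> un E; have un' := un; rewrite E in un'.
have i1 X Y : uniq (X ++ t :: Y) -> index t (X ++ t :: Y) = size X.
  rewrite cat_uniq => /and3P[_ /hasPn/(_ t) h _].
  by rewrite index_cat (negPf (h _)) ?mem_head //= eqxx addn0.
have sA : size A = size A' by rewrite -(i1 A B) // -(i1 A' B') // E.
by have := congr1 (take (size A)) E; rewrite take_size_cat // sA take_size_cat.
Qed.

(** On a reduced derivation no pop occurs, so the machine merely records the histories. If [m]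
    popped [c], all outputs of [c] would be on the front, so [c] could be made the last cell before
    [m], and [m] would be its inverse. *)
Lemma mrun_dreduced w y d : squier_finite_dim P w -> dpath P w d y ->
  dreduced d -> mrun (mstate0 w) d = (gend P (inits w) d,
    fun k => rev [seq c <- gcells P (inits w) d | tcol c == k]).
Proof.
move=> fin; elim/last_ind: d y => [//|d m IH] y h red.
have red_d : dreduced d by move: red; rewrite -cats1; apply: dreduced_catl.
move: (h); rewrite -cats1 => /dpath_cat [t h1 /= [uv et ey]].
rewrite mrun_cat (IH _ h1 red_d) /= gend_cat gcells_cat /=.
have hs := size_gend h1 (size_inits w); rewrite et in hs.
have [A [U [B [es hA hU hB]]]] := wire_split hs.
rewrite es mstepE // gstepE // gcellE //; set k := squier_dim P (ml m).
set C := rev _; set c0 := TCell k _ _ _.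
suff -> : act k U (mu m) (mv m) C = (outs c0, c0 :: C).
  congr (_, _); apply: funext => i; rewrite filter_cat rev_cat /= /upd.
  by rewrite [k == i]eq_sym; case: (i =P k) => [->|].
rewrite /act -/c0; case EC: C => [//|c C'].
case: ifP => // /andP[/eqP ec /eqP eU]; exfalso.
have nu := move_nonempty uv.
have tb : tbot c = mu m by rewrite ec.
have sub : {subset outs c <= gend P (inits w) d}.
  by move=> o ho; rewrite es eU !mem_cat ho orbT.
have [|d' [m' [sw gm]]] := back_swap h1 _ sub; first by rewrite tb; case: nu.
have h' := (swap_dpath P _ _ sw).1 h1.
move: h'; rewrite -cats1 => /dpath_cat [t' h2 /= [uv' et' em]].
have hs' := size_gend h2 (size_inits w); rewrite et' in hs'.
have [A' [U' [B' [es' hA' hU' hB']]]] := wire_split hs'.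
have [gE _] := swap_gend sw h1 (size_inits w).
move: gE; rewrite -cats1 gend_cat /= es' gstepE //.
move: gm; rewrite es' gcellE // => gm; rewrite gm es eU => gE.
(* The outputs of [c] occur only once on the front, so [m] acts exactly where the move of [c]
   did. *)
have eA : A = A'.
  case Eo: (outs c) gE => [|o O] gE.
    by move: (congr1 size Eo); rewrite size_outs tb; case: (mu m) nu => //= -[].
  apply: uniq_pos gE.
  have [un _ _ _] := history_inits h1.
  by move: un; rewrite /wires_of es eU Eo [X in is_true X -> _]cat_uniq => /andP[].
have mm : m = minv m'.
  move: gm; rewrite ec => -[_ _ e1 e2].
  move: em; rewrite et /mtgt /msrc /minv.
  have s1 : size (ml m') = size (ml m) by rewrite -hA -hA' eA.
  case: (m) (m') e1 e2 s1 => [a u v b] [a' u' v' b'] /= e1 e2 s1 E; subst u' v'.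
  have := congr1 (take (size a)) E; rewrite -{1}s1 !take_size_cat // => ea; subst a'.
  by have := congr1 (drop (size a + size u)) E;
    rewrite !catA !drop_size_cat ?size_cat // => ->.
apply: (red d' m' [::]); rewrite cats0 -mm.
by have := swap_cat [::] [:: m] sw; rewrite -!cats1 -catA.
Qed.

(** Equal final stacks mean equal sets of cells. After the common prefix the tails share no cell,
    while each of their cells must occur in the other derivation; hence both tails are empty. *)
Lemma dreduced_unique w y d d' : squier_finite_dim P w -> hom P w y d d' ->
  dreduced d -> dreduced d' -> swap d d'.
Proof.
move=> fin h r r'; have [hd hd'] := hom_dpath h.
have mE := mrun_hom fin h (mstate0_wf w).
rewrite (mrun_dreduced fin hd r) (mrun_dreduced fin hd' r') in mE.
case: mE => _ /(congr1 (fun f => f _)) mE.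
have [z [e [e' [sw sw' dis]]]] := common_prefix hd hd'.
have memE c : (c \in gcells P (inits w) d) = (c \in gcells P (inits w) d').
  have := congr1 rev (mE (tcol c)); rewrite !revK => E.
  by have := congr1 (fun C => c \in C) E; rewrite !mem_filter eqxx.
have [_ p] := swap_gend sw hd (size_inits w).
have [_ p'] := swap_gend sw' hd' (size_inits w).
have memE' c : (c \in gcells P (inits w) (z ++ e)) =
    (c \in gcells P (inits w) (z ++ e')).
  by rewrite -(perm_mem p) -(perm_mem p').
have nil f f' : dpath P w (z ++ f) y ->
    (forall c, (c \in gcells P (inits w) (z ++ f)) ->
    (c \in gcells P (inits w) (z ++ f'))) ->
    {in gcells P (gend P (inits w) z) f,
        forall c, c \notin gcells P (gend P (inits w) z) f'} -> f = [::].
  move=> hf sub df; case: f hf sub df => [//|m f] hf sub df; exfalso.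
  have [_ _ un _] := history_inits hf.
  move: un sub df; rewrite !gcells_cat /=; set c := gcell _ _ _ => un sub df.
  have := sub c; rewrite !mem_cat mem_head orbT => /(_ isT) /orP[hz|hf'].
    by move: un; rewrite cat_uniq /= => /and3P[_ /norP[/negP]].
  by have := df c (mem_head _ _); rewrite hf'.
have ee : e = [::].
  apply: (nil e e') dis; first by apply/(swap_dpath P _ _ sw).
  by move=> c; rewrite memE'.
have ee' : e' = [::].
  apply: (nil e' e); first by apply/(swap_dpath P _ _ sw').
    by move=> c; rewrite memE'.
  by move=> c; rewrite ee.
by subst e e'; apply: swap_trans sw (swap_sym sw').
Qed.

Lemma act_stack k U u v C : let C' := (act k U u v C).2 in
  (exists c, C' = c :: C) \/ (exists c, C = c :: C').
Proof.
rewrite /act; case: C => [|c C] /=; first by left; eexists.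
by case: ifP => _ /=; [right|left]; eexists.
Qed.

(** [Z] is the lowest part of the stack left untouched throughout; [X] and [Y] are the old and new
    cells above it. *)
Lemma stack_lipschitz st d k : exists X Y Z,
  [/\ st.2 k = X ++ Z, (mrun st d).2 k = Y ++ Z, size X <= size d
    & size Y <= size d].
Proof.
elim/last_ind: d => [|d m [X [Y [Z [e1 e2 s1 s2]]]]].
  by exists [::], [::], (st.2 k).
rewrite -cats1 mrun_cat size_cat addn1 /=; set st' := mrun st d in e2 *.
have [ek|ne] := eqVneq k (squier_dim P (ml m)); last first.
  exists X, Y, Z; rewrite /mstep /= upd_neq //.
  by split=> //; apply: leqW.
rewrite /mstep /= -ek upd_eq.
set U := take _ _; have := act_stack k U (mu m) (mv m) (st'.2 k).
set C' := (act _ _ _ _ _).2 => /= -[[c eC]|[c eC]].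
  by exists X, (c :: Y), Z; rewrite eC e2; split=> //; apply: leqW.
(* A pop takes a cell of [Y], or, when [Y] is empty, the top of [Z], which then has to be counted in
   [X]. *)
move: eC; rewrite e2; case: Y {e2} s2 => [|c' Y] /= s2.
  case: Z e1 => [//|c' Z] e1 [_ <-].
  by exists (rcons X c'), [::], Z; rewrite size_rcons cat_rcons.
by move=> [_ <-]; exists X, Y, Z; split=> //; [apply: leqW|lia].
Qed.

(* A move changes the stack of each colour by at most one push or pop: the map
   to the tree of cell sequences of colour [k] is 1-Lipschitz. *)
Lemma color_lipschitz w y y' d d' q k : squier_finite_dim P w ->
  dpath P w d y -> dreduced d -> dreduced d' -> hom P w y' d' (d ++ q) ->
  exists Z X Y, [/\
    [seq c <- gcells P (inits w) d | tcol c == k] = Z ++ X,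
    [seq c <- gcells P (inits w) d' | tcol c == k] = Z ++ Y,
    size X <= size q & size Y <= size q].
Proof.
move=> fin hd red red' h.
have := mrun_hom fin h (mstate0_wf w); have [hd' _] := hom_dpath h.
rewrite mrun_cat (mrun_dreduced fin hd red) (mrun_dreduced fin hd' red') => E.
have [X [Y [Z [/= e1 e2 s1 s2]]]] := stack_lipschitz (gend P (inits w) d,
  fun k => rev [seq c <- gcells P (inits w) d | tcol c == k]) q k.
exists (rev Z), (rev X), (rev Y); rewrite !size_rev -!rev_cat; split=> //.
  by rewrite -e1 revK.
by rewrite -e2 -E /= revK.
Qed.

(** The move extends the cubes of its left context, whose dimension is thus smaller than that of the
    whole word. *)
Lemma gcells_color w y d c : squier_finite_dim P w -> dpath P w d y ->
  c \in gcells P (inits w) d -> tcol c < squier_dim P w.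
Proof.
move=> fin; elim/last_ind: d y => [//|d m IH] y.
rewrite -cats1 => /dpath_cat [t h1 /= [uv et _]].
rewrite gcells_cat mem_cat inE => /orP[/(IH _ h1) //|/eqP -> /=].
have con := dpath_connected h1.
rewrite (squier_dim_connected con) et; apply: squier_dim_left uv _.
by rewrite -/(msrc m) -et; apply: finite_dim_connected fin.
Qed.

End Machine.

(** * Diagrams swept cell by cell *)

Section Lists.

(** As [l] lists all of [T], no default in [T'] is needed; both types may be empty. *)
Lemma list_map (T T' : eqType) (l : seq T) (l' : seq T') :
  uniq l -> size l = size l' -> (forall x, x \in l) -> exists f, map f l = l'.
Proof.
move=> ul sl all.
have [x|f hf] := @choice T T' (fun x y => forall y0, nth y0 l' (index x l) = y).
  case E: l' sl => [|y l1] sl; first by move: (all x); rewrite (size0nil sl).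
  by exists (nth y l' (index x l)) => y0; rewrite -E; apply: set_nth_default;
    rewrite E -sl index_mem.
exists f; case: l ul sl all hf => [|x0 l] ul sl all hf.
  by case: l' sl {hf}.
case E: l' sl => [//|y0 l1] sl; rewrite -E in sl *.
apply: (@eq_from_nth _ y0); rewrite size_map // => j hj.
by rewrite (nth_map x0) // -(hf _ y0) index_uniq.
Qed.

Lemma list_map_default (T T' : eqType) (y0 : T') (l : seq T) (l' : seq T') :
  uniq l -> size l = size l' -> exists f, map f l = l'.
Proof.
move=> ul sl; exists (fun x => nth y0 l' (index x l)).
case: l ul sl => [|x0 l] ul sl; first by case: l' sl.
apply: (@eq_from_nth _ y0); rewrite size_map // => j hj.
by rewrite (nth_map x0) // index_uniq.
Qed.

Lemma map_injective (T T' : eqType) (f : T -> T') (l : seq T) :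
  uniq (map f l) -> {in l &, injective f}.
Proof.
move=> u x y hx hy e.
have x0 := x; rewrite -(nth_index x hx) -(nth_index x hy).
have := e; rewrite -{1}(nth_index x hx) -{1}(nth_index x hy).
rewrite -!(nth_map x (f x)) ?index_mem // => /eqP.
by rewrite nth_uniq ?size_map ?index_mem // => /eqP ->.
Qed.

Lemma map_bijective (T T' : eqType) (f : T -> T') (l : seq T) (l' : seq T') :
  uniq l' -> (forall x, x \in l) -> (forall y, y \in l') -> map f l = l' ->
  bijective f.
Proof.
move=> u' all all' fl.
have inj : injective f.
  by move=> x y; apply: (@map_injective _ _ f l); rewrite ?fl.
have [y|g hg] := @choice T' T (fun y x => f x = y).
  by have := all' y; rewrite -fl => /mapP[x _ ->]; exists x.
by exists g => [x|//]; apply: inj; rewrite hg.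
Qed.

Lemma cat_inj_size (T : Type) (l1 l2 l1' l2' : seq T) :
  size l1 = size l1' -> l1 ++ l2 = l1' ++ l2' -> l1 = l1' /\ l2 = l2'.
Proof.
elim: l1 l1' => [|x l1 IH] [|x' l1'] //= [s] [-> E].
by have [-> ->] := IH _ s E.
Qed.

Lemma map_cat_eq (T T' : Type) (f : T -> T') (l1 l2 : seq T) (l1' l2' : seq T') :
  size l1 = size l1' -> map f (l1 ++ l2) = l1' ++ l2' ->
  map f l1 = l1' /\ map f l2 = l2'.
Proof.
by rewrite map_cat => s; apply: cat_inj_size; rewrite size_map.
Qed.

End Lists.

Section Sweeps.
Variables (Sg : Type) (P : presentation Sg).
Implicit Type K : complex Sg.

Lemma pos_path_cat K (x y : vert K) p q :
  reflect (exists2 z, pos_path x p z & pos_path z q y) (pos_path x (p ++ q) y).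
Proof.
apply: (iffP idP) => [|[z]].
  elim: p x => [|e p IH] x /=; first by exists x.
  by case/andP=> -> /IH [z h1 h2]; exists z.
elim: p x => [|e p IH] x /=; first by move=> /eqP ->.
by case/andP=> -> h1 h2; apply: IH.
Qed.

Lemma pos_path_src K (x y : vert K) e p : pos_path x (e :: p) y -> src e = x.
Proof. by case/andP=> /eqP. Qed.

Lemma pos_path_tgt K (x y : vert K) e p : pos_path x (rcons p e) y -> tgt e = y.
Proof. by rewrite -cats1 => /pos_path_cat [z _ /andP[_ /eqP]]. Qed.

(** The interior vertices of a path: the sources of all edges but the first. *)
Definition inner K (p : seq (edge K)) : seq (vert K) :=
  map (@src _ K) (behead p).

Definition cell_ok K (c : cell K) : Prop :=
  (exists x y, pos_path x (ctop c) y /\ pos_path x (cbot c) y) /\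
  move P (label (ctop c)) (label (cbot c)).

Lemma label_nonempty K (p : seq (edge K)) : label p <> [::] -> p <> [::].
Proof. by move=> h e; rewrite e in h. Qed.

Lemma cell_ok_nonempty K (c : cell K) :
  cell_ok c -> (ctop c <> [::]) * (cbot c <> [::]).
Proof.
by case=> _ /move_nonempty [h1 h2]; split; apply: label_nonempty.
Qed.

(** A front descends from [p] to [q], crossing the cells [cs] in order; [d] is the edge path of the
    Squier complex read off the labels of the fronts. *)
Inductive sweep K : seq (edge K) -> seq (cell K) -> seq (medge Sg) ->
    seq (edge K) -> Prop :=
| sweep_nil p : sweep p [::] [::] p
| sweep_cons A c B cs d q : sweep (A ++ cbot c ++ B) cs d q ->
    sweep (A ++ ctop c ++ B) (c :: cs)
      (Medge (label A) (label (ctop c)) (label (cbot c)) (label B) :: d) q.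

Lemma sweep_consP K p c cs d (q : seq (edge K)) : sweep p (c :: cs) d q ->
  exists A B d', [/\ p = A ++ ctop c ++ B,
    d = Medge (label A) (label (ctop c)) (label (cbot c)) (label B) :: d'
    & sweep (A ++ cbot c ++ B) cs d' q].
Proof.
move E: (c :: cs) => cs' h; case: h E => // A c' B cs1 d' q' h [-> ->].
by exists A, B, d'.
Qed.

Lemma sweep_nilP K p d (q : seq (edge K)) :
  sweep p [::] d q -> d = [::] /\ p = q.
Proof. by move E: [::] => cs h; case: h E. Qed.

Lemma sweep_size K p cs d (q : seq (edge K)) : sweep p cs d q -> size cs = size d.
Proof. by elim=> //= A c B cs' d' q' _ ->. Qed.

Lemma sweep_cat K p cs1 d1 q cs2 d2 (r : seq (edge K)) :
  sweep p cs1 d1 q -> sweep q cs2 d2 r -> sweep p (cs1 ++ cs2) (d1 ++ d2) r.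
Proof.
elim=> [//|A c B cs d q' _ IH] /IH h; exact: sweep_cons.
Qed.

Lemma sweep_split K p cs1 cs2 d (r : seq (edge K)) :
  sweep p (cs1 ++ cs2) d r -> exists d1 d2 q,
  [/\ d = d1 ++ d2, sweep p cs1 d1 q & sweep q cs2 d2 r].
Proof.
elim: cs1 p d => [|c cs1 IH] p d h.
  by exists [::], d, p; split=> //; apply: sweep_nil.
have [A [B [d' [-> -> /IH [d1 [d2 [q [-> h1 h2]]]]]]]] := sweep_consP h.
by eexists (_ :: d1), d2, q; split=> //; apply: sweep_cons.
Qed.

Lemma sweep_splitd K p cs d1 d2 (r : seq (edge K)) :
  sweep p cs (d1 ++ d2) r -> exists cs1 cs2 q,
  [/\ cs = cs1 ++ cs2, sweep p cs1 d1 q & sweep q cs2 d2 r].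
Proof.
move=> h; have sz := sweep_size h.
rewrite -(cat_take_drop (size d1) cs) in h.
have [d1' [d2' [q [E h1 h2]]]] := sweep_split h.
have s1 : size d1 = size d1'.
  rewrite -(sweep_size h1) size_takel // sz size_cat; lia.
have [e1 e2] := cat_inj_size s1 E.
subst d1' d2'; exists (take (size d1) cs), (drop (size d1) cs), q.
by rewrite cat_take_drop.
Qed.

Lemma label_cat K (p q : seq (edge K)) : label (p ++ q) = label p ++ label q.
Proof. exact: map_cat. Qed.

Lemma sweep_dpath K p cs d (q : seq (edge K)) : (forall c : cell K, cell_ok c) ->
  sweep p cs d q -> dpath P (label p) d (label q).
Proof.
move=> ok; elim=> //= A c B cs' d' q' _ h; split.
- by case: (ok c).
- by rewrite !label_cat.
- by move: h; rewrite !label_cat.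
Qed.

(** Conservation of edges: whatever enters the front, initially or through the bottom of a cell,
    leaves it through a top or stays to the end. *)
Lemma sweep_perm K p cs d (q : seq (edge K)) : sweep p cs d q ->
  perm_eq (p ++ flatten [seq cbot c | c <- cs])
    (q ++ flatten [seq ctop c | c <- cs]).
Proof.
elim=> [//|A c B cs' d' q' _ /permP h]; apply/permP => a; have := h a.
by rewrite /= !count_cat; lia.
Qed.

(** Both segments start at [x], so exchanging them changes the interior vertices of the long path
    only by their own interiors. *)
Lemma inner_perm K (x y : vert K) A s s' B :
  pos_path x s y -> pos_path x s' y -> s <> [::] -> s' <> [::] ->
  perm_eq (inner (A ++ s ++ B) ++ inner s') (inner (A ++ s' ++ B) ++ inner s).
Proof.
case: s s' => [|e s] // [|e' s'] //= /andP[/eqP es _] /andP[/eqP es' _] _ _.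
apply/permP => a; case: A => [|f A] /=; rewrite /inner /= !map_cat !count_cat /=.
  by lia.
by rewrite es es' !map_cat !count_cat; lia.
Qed.

Lemma sweep_inner_perm K p cs d (q : seq (edge K)) :
  (forall c : cell K, cell_ok c) -> sweep p cs d q ->
  perm_eq (inner p ++ flatten [seq inner (cbot c) | c <- cs])
          (inner q ++ flatten [seq inner (ctop c) | c <- cs]).
Proof.
move=> ok; elim=> [//|A c B cs' d' q' _ /permP h]; apply/permP => a; have := h a.
have [n1 n2] := cell_ok_nonempty (ok c); have [[x [y [h1 h2]]] _] := ok c.
have /permP/(_ a) := inner_perm A B h1 h2 n1 n2.
by rewrite /= !count_cat; lia.
Qed.

Lemma pos_path_cell K (i t : vert K) A c B : cell_ok c ->
  pos_path i (A ++ ctop c ++ B) t = pos_path i (A ++ cbot c ++ B) t.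
Proof.
move=> ok; have [[x [y [h1 h2]]] _] := ok.
have [n1 n2] := cell_ok_nonempty ok.
have key s s' : pos_path x s y -> pos_path x s' y -> s <> [::] ->
    pos_path i (A ++ s ++ B) t -> pos_path i (A ++ s' ++ B) t.
  move=> hs hs' ns /pos_path_cat [z1 hA /pos_path_cat [z2 hz hB]].
  have [e1 e2] : z1 = x /\ z2 = y.
    case/lastP: s hs hz ns => [//|s e] hs hz _; split.
      by case: s hs hz => [|e' s] /andP[/eqP <- _] /andP[/eqP <- _].
    by rewrite -(pos_path_tgt hs) (pos_path_tgt hz).
  subst; apply/pos_path_cat; exists x => //; apply/pos_path_cat; by exists y.
by apply/idP/idP; apply: key.
Qed.

Lemma sweep_pos_path K i t p cs d (q : seq (edge K)) :
  (forall c : cell K, cell_ok c) -> sweep p cs d q ->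
  pos_path i p t = pos_path i q t.
Proof.
by move=> ok; elim=> [//|A c B cs' d' q' _ <-]; apply: pos_path_cell.
Qed.

Definition edges_by K (cs : seq (cell K)) :=
  dtop K ++ flatten [seq cbot c | c <- cs].

Definition verts_by K (i t : vert K) (cs : seq (cell K)) :=
  i :: t :: inner (dtop K) ++ flatten [seq inner (cbot c) | c <- cs].

(* The cells of K can be added one by one, in the order [cs], to the top path;
   each of them brings new edges and new vertices. *)
Record layered K cs d (i t : vert K) : Prop := Layered {
  lay_sweep : sweep (dtop K) cs d (dbot K);
  lay_uniq : uniq cs;
  lay_cells : forall c, c \in cs;
  lay_ok : forall c : cell K, cell_ok c;
  lay_path : pos_path i (dtop K) t;
  lay_ne : dtop K <> [::];
  lay_uniqe : uniq (edges_by cs);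
  lay_edges : forall e, e \in edges_by cs;
  lay_uniqv : uniq (verts_by i t cs);
  lay_verts : forall x, x \in verts_by i t cs }.

Definition realizes K d := exists cs i t, @layered K cs d i t.

Lemma perm_flatten_map (T T' : eqType) (f : T -> seq T') (l l' : seq T) :
  perm_eq l l' -> perm_eq (flatten (map f l)) (flatten (map f l')).
Proof. by move=> h; apply/perm_flatten/perm_map. Qed.

Lemma layered_perm K cs cs' d d' i t : @layered K cs d i t -> perm_eq cs' cs ->
  sweep (dtop K) cs' d' (dbot K) -> layered cs' d' i t.
Proof.
move=> [h1 h2 h3 h4 h5 h6 h7 h8 h9 h10] p sw.
have pe : perm_eq (edges_by cs') (edges_by cs).
  by rewrite perm_cat2l; apply: perm_flatten_map.
have pv : perm_eq (verts_by i t cs') (verts_by i t cs).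
  by rewrite /verts_by !perm_cons perm_cat2l; apply: perm_flatten_map.
split=> //.
- by rewrite (perm_uniq p).
- by move=> c; rewrite (perm_mem p).
- by rewrite (perm_uniq pe).
- by move=> c; rewrite (perm_mem pe).
- by rewrite (perm_uniq pv).
- by move=> c; rewrite (perm_mem pv).
Qed.

End Sweeps.

(** * Comparison of two swept complexes *)

Section Transport.
Variables (Sg : Type) (P : presentation Sg) (K K' : complex Sg).
Variables (fV : vert K -> vert K') (fE : edge K -> edge K').

(** Compatibility edge by edge, so that it can be propagated along the layers. *)
Definition good (e : edge K) : Prop :=
  [/\ src (fE e) = fV (src e), tgt (fE e) = fV (tgt e) & lab (fE e) = lab e].

Lemma good_path x y s : pos_path x s y ->
  pos_path (fV x) (map fE s) (fV y) -> map fV (inner s) = inner (map fE s) ->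
  label (map fE s) = label s -> forall e, e \in s -> good e.
Proof.
elim: s x => [//|e s IH] x /= /andP[/eqP ex h] /andP[/eqP ex' h'].
rewrite /inner /= => hi [le lr].
case: s IH h h' hi lr => [|e2 s] IH /= h h' hi lr.
  move=> e'; rewrite inE => /eqP ->; split=> //; first by rewrite ex' ex.
  by move: h h' => /eqP -> /eqP ->.
case: hi => hi1 hi2 e'; rewrite inE => /orP[/eqP ->|he].
  split=> //; first by rewrite ex' ex.
  case/andP: h => /eqP <- _; case/andP: h' => /eqP <- _; by rewrite hi1.
apply: (IH (tgt e)) he => //=.
have -> : fV (tgt e) = tgt (fE e).
  by case/andP: h => /eqP <- _; case/andP: h' => /eqP <- _; rewrite hi1.
by [].
Qed.

Lemma good_endpoints x y x' y' s s' : s <> [::] -> pos_path x s y ->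
  pos_path x' s' y' -> map fE s = s' -> (forall e, e \in s -> good e) ->
  x' = fV x /\ y' = fV y.
Proof.
move=> ns h h' e g; subst s'; split.
  case: s ns h h' g => [//|e s] _ /= /andP[/eqP <- _] /andP[/eqP <- _] g.
  by have [-> _ _] := g e (mem_head _ _).
case/lastP: s ns h h' g => [//|s e] _ h; rewrite map_rcons => h' g.
rewrite -(pos_path_tgt h) -(pos_path_tgt h').
by have [|_ -> _] := g e; rewrite // mem_rcons mem_head.
Qed.

Hypothesis okK : forall c : cell K, cell_ok P c.
Hypothesis okK' : forall c : cell K', cell_ok P c.

Lemma label_eq_size (L L' : complex Sg) (s : seq (edge L)) (s' : seq (edge L')) :
  label s = label s' -> size s = size s'.
Proof. by move/(congr1 size); rewrite !size_map. Qed.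

Lemma size_inner (L : complex Sg) (s : seq (edge L)) : size (inner s) = (size s).-1.
Proof. by rewrite size_map size_behead. Qed.

(* Matching the new edges and new inner vertices of two layer-by-layer
   constructions forces a match of all incidences. *)
Lemma sweep_transport p cs d q p' cs' q' :
  sweep p cs d q -> sweep p' cs' d q' -> map fE p = p' ->
  (forall e, e \in p -> good e) ->
  map fE (flatten [seq cbot c | c <- cs]) = flatten [seq cbot c | c <- cs'] ->
  map fV (flatten [seq inner (cbot c) | c <- cs]) =
    flatten [seq inner (cbot c) | c <- cs'] ->
  [/\ map fE q = q',
      forall e, e \in flatten [seq cbot c | c <- cs] -> good e,
      forall e, e \in q -> good e,
      [seq map fE (ctop c) | c <- cs] = [seq ctop c | c <- cs']
    & [seq map fE (cbot c) | c <- cs] = [seq cbot c | c <- cs']].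
Proof.
move=> sw; elim: sw p' cs' => {p cs d q} [p|A c B cs d q sw IH] p' cs' h'.
  case: cs' h' => [|c' cs'] h' e g _ _; last by have := sweep_size h'.
  by have [_ <-] := sweep_nilP h'.
case: cs' h' => [|c' cs'] h'; first by have := sweep_size h'.
have [A' [B' [d' [ep ed h1]]]] := sweep_consP h'; subst p'.
case: ed => eA et eb eB ed; subst d'.
move=> ep g eE eV.
have [fA ep'] := map_cat_eq (label_eq_size eA) ep.
have [ft fB] := map_cat_eq (label_eq_size et) ep'.
have [fb eE'] := map_cat_eq (label_eq_size eb) eE.
have si : size (inner (cbot c)) = size (inner (cbot c')).
  by rewrite !size_inner (label_eq_size eb).
have [fi eV'] := map_cat_eq si eV.
have [[x [y [h2 h3]]] uv] := okK c; have [[x' [y' [h2' h3']]] _] := okK' c'.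
have [nt nb] := cell_ok_nonempty (okK c).
have gt e : e \in ctop c -> good e.
  by move=> he; apply: g; rewrite !mem_cat he orbT.
have [ex ey] := good_endpoints nt h2 h2' ft gt; subst x' y'.
have gb : forall e, e \in cbot c -> good e.
  by apply: (good_path h3); rewrite fb // -eb.
have [|e|e1 g1 g2 e2 e3] := IH _ _ h1 _ _ eE' eV'.
- by rewrite !map_cat fA fb fB.
- rewrite !mem_cat => /or3P[he|/gb //|he]; apply: g; rewrite !mem_cat he ?orbT //.
split=> //=.
- by move=> e; rewrite mem_cat => /orP[/gb|/g1].
- by rewrite ft e2.
- by rewrite fb e3.
Qed.

End Transport.

Section Isotopy.
Variables (Sg : Type) (P : presentation Sg).
Implicit Type K : complex Sg.

Lemma eq_map_mem (T : eqType) (T' : Type) (f g : T -> T') (s : seq T) :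
  map f s = map g s -> {in s, f =1 g}.
Proof.
elim: s => //= x s IH [e /IH h] y; rewrite inE => /orP[/eqP -> //|/h //].
Qed.

Lemma map_zip_cells (T T' : eqType) (f : T -> T') (U : Type) (g : T -> U)
    (g' : T' -> U) s :
  map g s = map g' (map f s) -> {in s, forall x, g x = g' (f x)}.
Proof. by rewrite -map_comp => /eq_map_mem. Qed.

Lemma sweep_same_size K K' p cs d q p' cs' q' :
  @sweep _ K p cs d q -> @sweep _ K' p' cs' d q' ->
  size (flatten [seq cbot c | c <- cs]) = size (flatten [seq cbot c | c <- cs']) /\
  size (flatten [seq inner (cbot c) | c <- cs]) =
  size (flatten [seq inner (cbot c) | c <- cs']).
Proof.
move=> sw; elim: sw p' cs' => {p cs d q} [p|A c B cs0 d0 q sw IH] p' cs0' h'.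
  by have := sweep_size h'; case: cs0' h'.
case: cs0' h' => [|c' cs0'] h'; first by have := sweep_size h'.
have [A' [B' [d' [ep [eA et eb eB ed] h1]]]] := sweep_consP h'; subst.
have [e1 e2] := IH _ _ h1.
by rewrite /= !size_cat e1 e2 !size_inner (label_eq_size eb).
Qed.

(** List edges, vertices and cells in their order of creation. As [d] prescribes the length and
    place of every layer, matching equal positions respects all incidences. *)
Lemma layered_isotopic K K' cs cs' d i t i' t' :
  @layered _ P K cs d i t -> label (dtop K) = label (dtop K') ->
  @layered _ P K' cs' d i' t' -> isotopic K K'.
Proof.
move=> l el l'.
have sz_cells : size cs = size cs'.
  by rewrite (sweep_size (lay_sweep l)) (sweep_size (lay_sweep l')).
have [szE szV] := sweep_same_size (lay_sweep l) (lay_sweep l').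
have szT := label_eq_size el.
have [fE hE] : exists fE, map fE (edges_by cs) = edges_by cs'.
  apply: list_map (lay_uniqe l) _ (lay_edges l).
  by rewrite !size_cat szE szT.
have [fV hV] : exists fV, map fV (verts_by i t cs) = verts_by i' t' cs'.
  apply: list_map (lay_uniqv l) _ (lay_verts l).
  by rewrite /= !size_cat szV !size_inner szT.
have [fC hC] := list_map (lay_uniq l) sz_cells (lay_cells l).
have [hT hE'] := map_cat_eq szT hE.
have [ei et hV'] : [/\ fV i = i', fV t = t' & map fV
    (inner (dtop K) ++ flatten [seq inner (cbot c) | c <- cs]) =
    (inner (dtop K') ++ flatten [seq inner (cbot c) | c <- cs'])].
  by case: hV => -> -> ->.
have szI : size (inner (dtop K)) = size (inner (dtop K')) by rewrite !size_inner szT.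
have [hI hV''] := map_cat_eq szI hV'.
have gT : forall e, e \in dtop K -> good fV fE e.
  apply: (good_path (lay_path l)); rewrite hT ?ei ?et //; exact: lay_path l'.
have [eB gE _ eC1 eC2] := sweep_transport (lay_ok l) (lay_ok l')
  (lay_sweep l) (lay_sweep l') hT gT hE' hV''.
rewrite -hC in eC1 eC2; exists fV, fE, fC; split=> //.
- have gA e : good fV fE e.
    by have := lay_edges l e; rewrite mem_cat => /orP[/gT|/gE].
  split; try by move=> e; case: (gA e).
    by move=> c; apply/esym; rewrite (map_zip_cells eC1 (lay_cells l c)).
  by move=> c; apply/esym; rewrite (map_zip_cells eC2 (lay_cells l c)).
- split.
  + exact: map_bijective (lay_uniqv l') (lay_verts l) (lay_verts l') hV.
  + exact: map_bijective (lay_uniqe l') (lay_edges l) (lay_edges l') hE.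
  + exact: map_bijective (lay_uniq l') (lay_cells l) (lay_cells l') hC.
Qed.

Lemma realizes_isotopic K K' d : realizes P K d -> realizes P K' d ->
  label (dtop K) = label (dtop K') -> isotopic K K'.
Proof.
move=> [cs [i [t l]]] [cs' [i' [t' l']]] el; exact: layered_isotopic l el l'.
Qed.

End Isotopy.

(** * Sweeping an arbitrary diagram *)

Lemma next_mid (T : eqType) (s1 s2 : seq T) x y :
  uniq (s1 ++ x :: y :: s2) -> next (s1 ++ x :: y :: s2) x = y.
Proof.
move=> u; rewrite next_nth mem_cat mem_head orbT.
case: s1 u => [|a s1] /=; first by rewrite eqxx.
case/andP=> na; rewrite cat_uniq => /and3P[_ nx _].
have ax : (a == x) = false.
  by apply/negP => /eqP ax; move: na; rewrite ax mem_cat mem_head orbT.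
have xs : x \notin s1.
  by apply: contra nx => h; apply/hasP; exists x; rewrite // mem_head.
rewrite ax index_cat (negPf xs) /= eqxx addn0 nth_cat ltnNge leqnSn /=.
by rewrite subSnn.
Qed.

Lemma next_wrap (T : eqType) (s : seq T) x y :
  uniq (y :: rcons s x) -> next (y :: rcons s x) x = y.
Proof.
rewrite cons_uniq => /andP[ny]; rewrite rcons_uniq => /andP[nx _].
rewrite next_nth inE mem_rcons mem_head orbT.
have yx : (y == x) = false.
  by apply/negP => /eqP e; move: ny; rewrite e mem_rcons mem_head.
rewrite /= yx -cats1 index_cat (negPf nx) /= eqxx addn0.
by rewrite nth_default // size_cat addn1.
Qed.

Lemma count1_uniq (T : eqType) (s : seq T) :
  (forall x, count_mem x s = 1) -> uniq s /\ forall x, x \in s.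
Proof.
move=> h; have all x : x \in s by rewrite -has_pred1 has_count h.
by split=> //; apply: count_mem_uniq => x; rewrite h all.
Qed.

(** * Faces and rotation around a vertex *)

Section Faces.
Variables (Sg : Type) (K : complex Sg).
Implicit Types (f : option (cell K)) (e : edge K) (x : vert K).

(** The unbounded face lies below the bottom path of the figure, so the bottom path is its top and
    the top path its bottom. *)
Definition ftop f := if f is Some c then ctop c else dbot K.
Definition fbot f := if f is Some c then cbot c else dtop K.

Definition faces : seq (option (cell K)) := enum {: option (cell K)}.

Lemma face_boundaryE f : face_boundary f = closed_walk (ftop f) (fbot f).
Proof. by case: f. Qed.

Lemma mem_walk_true p q e : ((e, true) \in @closed_walk _ K p q) = (e \in p).
Proof.
rewrite mem_cat; apply/idP/idP => [/orP[/mapP[e' h [->]] //|/mapP[e' _ []] //]|h].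
by apply/orP; left; apply: map_f.
Qed.

Lemma mem_walk_false p q e : ((e, false) \in @closed_walk _ K p q) = (e \in q).
Proof.
rewrite mem_cat; apply/idP/idP => [/orP[/mapP[e' _ []] //|/mapP[e' h [->]]]|h].
  by rewrite -mem_rev.
by apply/orP; right; apply: map_f; rewrite mem_rev.
Qed.

Lemma count_walk p q e b :
  count_mem (e, b) (@closed_walk _ K p q) = count_mem e (if b then p else q).
Proof.
rewrite count_cat !count_map; case: b => /=.
  rewrite -[RHS]addn0; congr (_ + _).
    by apply: eq_count => e' /=; rewrite -pair_eqE /= andbT.
  by rewrite -[RHS](count_pred0 (rev q)); apply: eq_count => e' /=; rewrite -pair_eqE /= andbF.
rewrite -[RHS]add0n; congr (_ + _).
  by rewrite -[RHS](count_pred0 p); apply: eq_count => e' /=; rewrite -pair_eqE /= andbF.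
by rewrite -(count_rev _ q); apply: eq_count => e' /=; rewrite -pair_eqE /= andbT.
Qed.

Hypothesis hcount : forall d : edge K * bool,
  (\sum_(f : option (cell K)) count_mem d (face_boundary f) = 1)%N.
Hypothesis hne : forall f, (ftop f <> [::]) * (fbot f <> [::]).

Lemma count_faces (g : option (cell K) -> seq (edge K)) e :
  count_mem e (flatten [seq g f | f <- faces]) =
  (\sum_(f : option (cell K)) count_mem e (g f))%N.
Proof. by rewrite count_flatten -map_comp sumnE big_map big_enum. Qed.

(** A dart [(e, true)] can only come from a top, so the count of darts says that each edge is on
    exactly one top. *)
Lemma ftop_list : uniq (flatten [seq ftop f | f <- faces]) /\
  forall e, e \in flatten [seq ftop f | f <- faces].
Proof.
apply: count1_uniq => e; rewrite count_faces -(hcount (e, true)).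
by apply: eq_bigr => f _; rewrite face_boundaryE count_walk.
Qed.

Lemma fbot_list : uniq (flatten [seq fbot f | f <- faces]) /\
  forall e, e \in flatten [seq fbot f | f <- faces].
Proof.
apply: count1_uniq => e; rewrite count_faces -(hcount (e, false)).
by apply: eq_bigr => f _; rewrite face_boundaryE count_walk.
Qed.

Lemma ftop_ex e : exists f, e \in ftop f.
Proof. by have [_ /(_ e) /flattenP[s /mapP[f _ ->] h]] := ftop_list; exists f. Qed.

Lemma fbot_ex e : exists f, e \in fbot f.
Proof. by have [_ /(_ e) /flattenP[s /mapP[f _ ->] h]] := fbot_list; exists f. Qed.

Lemma boundary_unique (d : edge K * bool) f f' :
  d \in face_boundary f -> d \in face_boundary f' -> f = f'.
Proof.
move=> h h'; apply/eqP/negP => /negP ne.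
have := hcount d; rewrite (bigD1 f) //= (bigD1 f') 1?eq_sym //=.
have pos g : d \in face_boundary g -> 0 < count_mem d (face_boundary g).
  by rewrite -has_count has_pred1.
move: (pos _ h) (pos _ h'); move: (count_mem d _) (count_mem d _) => a b.
by case: a b => [|a] [|b] // _ _; rewrite !addSn addnS.
Qed.

Lemma ftop_unique e f f' : e \in ftop f -> e \in ftop f' -> f = f'.
Proof.
by move=> h h'; apply: (@boundary_unique (e, true)); rewrite face_boundaryE mem_walk_true.
Qed.

Lemma fbot_unique e f f' : e \in fbot f -> e \in fbot f' -> f = f'.
Proof.
by move=> h h'; apply: (@boundary_unique (e, false)); rewrite face_boundaryE mem_walk_false.
Qed.

Lemma boundary_uniq f : uniq (face_boundary f).
Proof.
apply: count_mem_uniq => d; have := hcount d; rewrite (bigD1 f) //= -has_pred1 has_count.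
by case: (count_mem d (face_boundary f)) => [|[|n]].
Qed.

(** The next dart around the end of [e] is read on the face with [e] on its top: the following edge
    of this top or, if [e] is its last edge, the last edge of the bottom, again incoming. *)
Lemma rotation_in e d : rotation (e, false) d <-> exists f,
  (exists s1 e' s2, ftop f = s1 ++ e :: e' :: s2 /\ d = (e', true)) \/
  (exists s1 b e', [/\ ftop f = rcons s1 e, fbot f = rcons b e' & d = (e', false)]).
Proof.
split=> [/existsP[f /andP[]]|[f h]].
  rewrite /flip /= face_boundaryE mem_walk_true => he /eqP <-; exists f.
  have un := boundary_uniq f; move: un; rewrite face_boundaryE.
  case/splitPr: he => s1 s2.
  case: s2 => [|e' s2]; last first.
    rewrite /closed_walk map_cat /= -catA => un; rewrite next_mid //.
    by left; exists s1, e', s2.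
  right; case/lastP E: (fbot f) (hne f) => [|b e'] [_ //] _.
  exists s1, b, e'; split=> //; first by rewrite cats1.
  move: un; rewrite /closed_walk ?E rev_rcons !map_cat /= -!catA /=.
  exact: next_mid.
apply/existsP; exists f; rewrite /flip /=; have un := boundary_uniq f.
move: un; rewrite face_boundaryE mem_walk_true.
case: h => [[s1 [e' [s2 [E ->]]]]|[s1 [b [e' [E E' ->]]]]].
  rewrite E mem_cat mem_head orbT /=.
  by rewrite /closed_walk map_cat /= -catA => un; rewrite next_mid.
rewrite E E' mem_rcons mem_head /= /closed_walk rev_rcons -cats1 map_cat /= -catA /=.
by move=> un; rewrite next_mid.
Qed.

(** The dual turn around the start of [e]: through the face with [e] on its bottom, to the preceding
    edge of this bottom, or to the first edge of the top, again outgoing. *)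
Lemma rotation_out e d : rotation (e, true) d <-> exists f,
  (exists s1 e' s2, fbot f = s1 ++ e' :: e :: s2 /\ d = (e', false)) \/
  (exists s s' e', [/\ fbot f = e :: s, ftop f = e' :: s' & d = (e', true)]).
Proof.
split=> [/existsP[f /andP[]]|[f h]].
  rewrite /flip /= face_boundaryE mem_walk_false => he /eqP <-; exists f.
  have un := boundary_uniq f; move: un; rewrite face_boundaryE.
  case/splitPr: he => s1 s2.
  case/lastP: s1 => [|s1 e']; last first.
    rewrite /closed_walk cat_rcons rev_cat !rev_cons -!cats1 -!catA !map_cat /=.
    rewrite catA => un; rewrite next_mid //.
    by left; exists s1, e', s2.
  right; case E: (ftop f) (hne f) => [|e' s'] [// _ _].
  exists s2, s', e'; split=> //.
  move: un; rewrite /closed_walk ?E /= rev_cons map_rcons -rcons_cat.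
  exact: next_wrap.
apply/existsP; exists f; rewrite /flip /=; have un := boundary_uniq f.
move: un; rewrite face_boundaryE mem_walk_false.
case: h => [[s1 [e' [s2 [E ->]]]]|[s [s' [e' [E E' ->]]]]].
  rewrite E mem_cat inE mem_head !orbT /=.
  rewrite /closed_walk rev_cat !rev_cons -!cats1 -!catA !map_cat /= catA => un.
  by rewrite next_mid.
rewrite E E' mem_head andTb /closed_walk rev_cons map_rcons map_cons cat_cons -rcons_cat => un.
by rewrite next_wrap.
Qed.

End Faces.

Lemma size_flatten_behead (T : Type) (s : seq (seq T)) :
  (forall l, List.In l s -> l <> [::]) ->
  size (flatten [seq behead l | l <- s]) + size s = size (flatten s).
Proof.
elim: s => //= l s IH h; rewrite !size_cat -IH => [|l' hl]; last by apply: h; right.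
by case: l h => [/(_ [::] (or_introl erefl))|x l h] //=; lia.
Qed.

Lemma size_full (T : finType) (s : seq T) :
  uniq s -> (forall x, x \in s) -> size s = #|T|.
Proof. by move=> /card_uniqP <- h; apply: eq_card => x; rewrite h. Qed.

Lemma full_uniq (T : finType) (s : seq T) :
  (forall x, x \in s) -> size s <= #|T| -> uniq s.
Proof.
move=> h sz; apply: (@leq_size_uniq _ (enum T)); first exact: enum_uniq.
  by move=> x _; apply: h.
by rewrite -cardE.
Qed.

Lemma uniq_flatten_sub (T T' : eqType) (g : T -> seq T') (F s : seq T) :
  uniq (flatten (map g F)) -> uniq F -> uniq s -> {subset s <= F} ->
  uniq (flatten (map g s)).
Proof.
move=> u uF us sub.
have p : perm_eq F (s ++ filter (predC (mem s)) F).
  rewrite -(perm_filterC (mem s)) perm_cat2r; apply: uniq_perm => //.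
    exact: filter_uniq.
  by move=> x; rewrite mem_filter /=; case: (boolP (x \in s)) => // /sub ->.
have := perm_uniq (perm_flatten_map g p).
by rewrite u map_cat flatten_cat cat_uniq => /esym /andP[].
Qed.

Lemma split_first (T : Type) (a : pred T) s : has a s ->
  exists s1 y s2, [/\ s = s1 ++ y :: s2, a y & ~~ has a s1].
Proof.
by case/split_find=> y s1 s2 ay ns; exists s1, y, s2; rewrite cat_rcons.
Qed.

Lemma connect_invariant (T : finType) (r : rel T) (a : pred T) x y :
  (forall x y, a x -> r x y -> a y) -> connect r x y -> a x -> a y.
Proof.
move=> cl /connectP[p]; elim: p x => [|z p IH] x /=; first by move=> _ ->.
by case/andP=> rz pz ey ax; apply: (IH z) => //; apply: cl rz.
Qed.

(** * Planarity forces a cell below every front *)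

Section Extract.
Variables (Sg : Type) (P : presentation Sg) (K : complex Sg).
Implicit Types (f : option (cell K)) (e : edge K) (x : vert K) (Q : seq (cell K)).

Lemma pos_path_mid (x y : vert K) s1 e e' s2 :
  pos_path x (s1 ++ e :: e' :: s2) y -> src e' = tgt e.
Proof. by case/pos_path_cat=> z _ /= /and3P[_ /eqP]. Qed.

Lemma pos_path_mem_tgt (x y : vert K) s e :
  pos_path x s y -> e \in behead s -> exists2 e', e' \in s & tgt e' = src e.
Proof.
case: s => [//|e0 s] h /= he; case/splitPr: he h => s1 s2.
case/lastP: s1 => [|s1 e1] h.
  exists e0; first exact: mem_head.
  by case/andP: h => _ /andP[/eqP].
exists e1; first by rewrite inE mem_cat mem_rcons mem_head /= orbT.
by move: h; rewrite cat_rcons -cat_cons => /pos_path_mid.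
Qed.

Hypothesis cellP : forall c : cell K, cell_ok P c.
Hypothesis cnt : forall d : edge K * bool,
  (\sum_(f : option (cell K)) count_mem d (face_boundary f) = 1)%N.
Hypothesis rot : forall d d' : edge K * bool,
  origin d = origin d' -> connect (@rotation _ K) d d'.
Hypothesis con : forall x y : vert K, connect (@adjacent _ K) x y.
Hypothesis euler : (nvert K + ncell K = nedge K + 1)%N.
Variables iota tau : vert K.
Hypothesis iotaP : is_source iota.
Hypothesis iota_uniq : forall x, is_source x -> x = iota.
Hypothesis tauP : is_sink tau.
Hypothesis tau_uniq : forall x, is_sink x -> x = tau.
Hypothesis topP : pos_path iota (dtop K) tau.
Hypothesis botP : pos_path iota (dbot K) tau.
Hypothesis top_ne : dtop K <> [::].

Lemma iota_neq_tau : iota != tau.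
Proof.
apply/eqP => e; case/lastP: (dtop K) top_ne topP => [//|s e0] _ /pos_path_tgt.
by rewrite -e => /iotaP.
Qed.

Lemma face_path f : exists x y, pos_path x (ftop f) y /\ pos_path x (fbot f) y.
Proof.
case: f => [c|] /=; first by case: (cellP c).
by exists iota, tau.
Qed.

Lemma face_ne f : (ftop f <> [::]) * (fbot f <> [::]).
Proof.
case: f => [c|] /=; first exact: cell_ok_nonempty (cellP c).
split=> // e; move: botP; rewrite e /= => h.
by move: iota_neq_tau; rewrite h.
Qed.

Definition tops := flatten [seq ftop f | f <- faces K].
Definition bots := flatten [seq fbot f | f <- faces K].
(** Their sources are the vertices interior to some top path. *)
Definition itops := flatten [seq behead (ftop f) | f <- faces K].
Definition ibots := flatten [seq behead (fbot f) | f <- faces K].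

Lemma mem_itops f e : e \in behead (ftop f) -> e \in itops.
Proof.
by move=> h; apply/flattenP; exists (behead (ftop f)) => //; apply: map_f; rewrite mem_enum.
Qed.

Lemma mem_ibots f e : e \in behead (fbot f) -> e \in ibots.
Proof.
by move=> h; apply/flattenP; exists (behead (fbot f)) => //; apply: map_f; rewrite mem_enum.
Qed.

Lemma size_faces : size (faces K) = (ncell K).+1.
Proof. by rewrite -cardE card_option card_ord. Qed.

(** Each of the [ncell K + 1] faces loses one of the [nedge K] edges; by the Euler formula
    [nvert K - 2] remain. *)
Lemma size_inner_list (g : option (cell K) -> seq (edge K)) :
  (forall f, g f <> [::]) -> uniq (flatten [seq g f | f <- faces K]) ->
  (forall e, e \in flatten [seq g f | f <- faces K]) ->
  size (flatten [seq behead (g f) | f <- faces K]) + 2 = nvert K.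
Proof.
move=> ne un all; have := size_full un all; rewrite card_ord.
have -> : [seq behead (g f) | f <- faces K] =
    [seq behead l | l <- [seq g f | f <- faces K]] by rewrite -map_comp.
have := @size_flatten_behead _ [seq g f | f <- faces K].
rewrite size_map size_faces => h h'; rewrite h' in h.
have ne' : forall l, List.In l [seq g f | f <- faces K] -> l <> [::].
  by move=> l; elim: (faces K) => //= f s IH [<-|/IH].
by have := h ne'; move: euler; lia.
Qed.

(* Turning around a vertex from an incoming to an outgoing edge, one meets
   a place where the vertex is interior to a top path, and conversely. *)
Lemma mem_inner_top x : x != iota -> x != tau -> x \in map (@src _ K) itops.
Proof.
move=> ni nt; apply/negPn/negP => nx.
have [e0 he0] : exists e, tgt e = x.
  apply/not_existsP => h; move/eqP: ni; apply; exact: iota_uniq.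
have [e1 he1] : exists e, src e = x.
  apply/not_existsP => h; move/eqP: nt; apply; exact: tau_uniq.
have := @rot (e0, false) (e1, true); rewrite /origin /= he0 he1 => /(_ erefl).
move/(@connect_invariant _ _ [pred d | ~~ d.2 && (tgt d.1 == x)]).
rewrite /= he0 eqxx => /(_ _ isT) H; suff // : false by [].
apply: H => -[e b] d /andP[/negPf /= -> /eqP he] /(rotation_in cnt face_ne) [f].
case: d => e' b'.
case=> [[s1 [e2 [s2 [E [-> _]]]]]|[s1 [b2 [e2 [E E' [-> ->]]]]]].
  move: nx; have [y [z [h _]]] := face_path f; rewrite E in h.
  rewrite -he -(pos_path_mid h) map_f //; apply: (@mem_itops f).
  by rewrite E; case: (s1) => [|a s]; rewrite /= ?mem_head // mem_cat inE mem_head !orbT.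
have [y [z [h h']]] := face_path f; rewrite E in h; rewrite E' in h'.
by rewrite (pos_path_tgt h') -(pos_path_tgt h) he eqxx.
Qed.

Lemma mem_inner_bot x : x != iota -> x != tau -> x \in map (@src _ K) ibots.
Proof.
move=> ni nt; apply/negPn/negP => nx.
have [e0 he0] : exists e, tgt e = x.
  apply/not_existsP => h; move/eqP: ni; apply; exact: iota_uniq.
have [e1 he1] : exists e, src e = x.
  apply/not_existsP => h; move/eqP: nt; apply; exact: tau_uniq.
have := @rot (e1, true) (e0, false); rewrite /origin /= he0 he1 => /(_ erefl).
move/(@connect_invariant _ _ [pred d | d.2 && (src d.1 == x)]).
rewrite /= he1 eqxx => /(_ _ isT) H; suff // : false by [].
apply: H => -[e b] d /andP[/= -> /eqP he] /(rotation_out cnt face_ne) [f].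
case: d => e' b'.
case=> [[s1 [e2 [s2 [E [_ _]]]]]|[s [s' [e2 [E E' [-> ->]]]]]].
  move: nx; rewrite -he map_f //; apply: (@mem_ibots f).
  by rewrite E; case: (s1) => [|a s3]; rewrite /= ?mem_head // mem_cat inE mem_head !orbT.
have [y [z [h h']]] := face_path f; rewrite E in h'; rewrite E' in h.
by rewrite (pos_path_src h) -(pos_path_src h') he eqxx.
Qed.

(** A list of [nvert K] entries that contains every vertex has no repetition: every vertex other
    than the two ends is interior to exactly one top path. This is where the Euler characteristic
    acts. *)
Lemma inner_top_uniq : uniq (iota :: tau :: map (@src _ K) itops).
Proof.
have [un all] := ftop_list cnt.
apply: full_uniq => [x|]; last first.
  rewrite /= size_map card_ord -(size_inner_list (fun f => (face_ne f).1) un all).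
  by rewrite addn2.
rewrite !inE; have [//|ni] := eqVneq x iota; have [//|nt] := eqVneq x tau.
exact: mem_inner_top.
Qed.

Lemma inner_bot_full : uniq (iota :: tau :: map (@src _ K) ibots) /\
  forall x, x \in iota :: tau :: map (@src _ K) ibots.
Proof.
have [un all] := fbot_list cnt.
have H x : x \in iota :: tau :: map (@src _ K) ibots.
  rewrite !inE; have [//|ni] := eqVneq x iota; have [//|nt] := eqVneq x tau.
  exact: mem_inner_bot.
split=> //; apply: full_uniq => //.
rewrite /= size_map card_ord -(size_inner_list (fun f => (face_ne f).2) un all).
by rewrite addn2.
Qed.

Definition islast e := [exists f, (e \in ftop f) && (last e (ftop f) == e)].

Lemma islast_rcons f s e : ftop f = rcons s e -> islast e.
Proof. by move=> E; apply/existsP; exists f; rewrite E mem_rcons mem_head last_rcons /=. Qed.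

Lemma ftop_uniq f : uniq (ftop f).
Proof.
have := @uniq_flatten_sub _ _ (@ftop _ K) (faces K) [:: f] (ftop_list cnt).1.
by rewrite /= cats0; apply=> //; [apply: enum_uniq|move=> g; rewrite mem_enum].
Qed.

(** At a given vertex only one edge continues a top path, so a positive path using only such
    continuing edges stays on the top of one face until that top ends. *)
Lemma top_chain T y s1 f rest a b : ftop f = s1 ++ y :: rest ->
  pos_path a (y :: T) b -> {subset T <= itops} ->
  {in belast y T, forall e, ~~ islast e} -> islast (last y T) -> T = rest.
Proof.
elim: T y s1 rest a => [|z T IH] y s1 rest a E h sub nl l.
  case/existsP: l => f' /andP[/= hy hl].
  have yf : y \in ftop f by rewrite E mem_cat mem_head orbT.
  have := ftop_unique cnt hy yf => ef; subst f'; move: hl (ftop_uniq f).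
  rewrite E last_cat cat_uniq /= => /eqP hl /and3P[_ _ /andP[ny _]].
  by case/lastP: rest hl ny {E yf hy} => // r z; rewrite last_rcons mem_rcons => ->;
    rewrite mem_head.
case: rest E => [|z' rest] E.
  have /negP[] := nl y (mem_head _ _).
  by apply: (@islast_rcons f s1); rewrite E cats1.
have [x0 [y0 [hf _]]] := face_path f; rewrite E in hf.
have ez : z = z'.
  have un : uniq (map (@src _ K) itops) by have := inner_top_uniq => /and3P[].
  apply: (map_injective un).
  - by apply: sub; rewrite mem_head.
  - apply: (@mem_itops f); rewrite E.
    by case: (s1) => [|u s]; rewrite /= ?mem_head // mem_cat inE mem_head !orbT.
  - by rewrite (pos_path_mid hf); case/andP: h => _ /andP[/eqP].
subst z'; congr (_ :: _); apply: (IH z (rcons s1 y) rest (tgt y)) => //.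
- by rewrite cat_rcons.
- by case/andP: h.
- by move=> e he; apply: sub; rewrite inE he orbT.
- by move=> e he; apply: nl; rewrite inE he orbT.
Qed.

(* Take the first edge [y] of [p] that ends a top path, and the last edge [z] up to
   [y] that begins one: from [z] to [y], [p] has to follow a single top path. *)
Lemma sweepable p : pos_path iota p tau -> exists A f B, p = A ++ ftop f ++ B.
Proof.
move=> hp.
have hasl : has islast p.
  case/lastP: p hp => [/= /eqP h|s e hp]; first by move: iota_neq_tau; rewrite h eqxx.
  apply/hasP; exists e; first by rewrite mem_rcons mem_head.
  have [f hf] := ftop_ex cnt e; case/splitPr E: _ / hf => [s1 s2].
  case: s2 E => [|e' s2] E; first by apply: (@islast_rcons f s1); rewrite E cats1.
  have [x0 [y0 [h _]]] := face_path f; rewrite E in h.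
  by have := tauP (e := e'); rewrite (pos_path_mid h) (pos_path_tgt hp).
case: (split_find hasl) hp => y s1 s2 ly ns1 hp.
(* The first edge of [p] leaves the source, which is interior to no path, so the backward search
   succeeds. *)
have hasf : has [pred e | e \notin itops] (rev (rcons s1 y)).
  apply/hasP; case E: (rcons s1 y) hp => [|e s] hp; first by case: (s1) E.
  exists e; first by rewrite mem_rev mem_head.
  apply/negP => /flattenP[_ /mapP[f _ ->] he].
  have [x0 [y0 [h _]]] := face_path f.
  have [e' _ he'] := pos_path_mem_tgt h he.
  by apply: (iotaP (e := e')); rewrite he' (pos_path_src hp).
have [r1 [z [r2 [E0 nz nr1]]]] := split_first hasf.
have E : rcons s1 y = rev r2 ++ z :: rev r1.
  by rewrite -[LHS]revK E0 rev_cat rev_cons cat_rcons.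
exists (rev r2).
have [f hf] := ftop_ex cnt z; exists f, s2.
rewrite E -catA; congr (_ ++ (_ ++ _)).
case/splitPr Ef: _ / hf => [q1 q2].
have q10 : q1 = [::].
  case: q1 Ef => [//|a q1] Ef; move/negP: nz; case; apply: (@mem_itops f).
  by rewrite Ef /= mem_cat mem_head orbT.
subst q1; congr (_ :: _).
rewrite E -catA in hp; case/pos_path_cat: hp => u _ /pos_path_cat [v hz _].
apply: (top_chain Ef hz).
- by move=> e; rewrite mem_rev => he; move/hasPn/(_ _ he): nr1; rewrite negbK.
- move=> e he.
  have : e \in s1.
    move: E; rewrite lastI -rcons_cat => /rcons_inj [-> _].
    by rewrite mem_cat he orbT.
  by move/(hasPn ns1).
- have := congr1 (last z) E; rewrite last_rcons last_cat /= => <-; exact: ly.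
Qed.

Definition seen (Q : seq (cell K)) : seq (option (cell K)) := None :: map Some Q.

Lemma mem_seen Q c : (Some c \in seen Q) = (c \in Q).
Proof. by rewrite inE /= mem_map // => x y []. Qed.

Lemma seen_uniq Q : uniq Q -> uniq (seen Q).
Proof.
move=> u; rewrite /= map_inj_uniq ?u ?andbT; last by move=> x y [].
by apply/negP => /mapP[].
Qed.

Lemma edges_byE Q : edges_by Q = flatten [seq fbot f | f <- seen Q].
Proof. by rewrite /edges_by /= -map_comp. Qed.

Lemma edges_by_uniq Q : uniq Q -> uniq (edges_by Q).
Proof.
move=> u; rewrite edges_byE; apply: (@uniq_flatten_sub _ _ _ (faces K)).
- exact: (fbot_list cnt).1.
- exact: enum_uniq.
- exact: seen_uniq.
- by move=> f _; rewrite mem_enum.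
Qed.

(** For each face, one edge of its boundary is visited if and only if the face is. Being visited
    thus spreads along rotations and adjacency, and [K] is connected. *)
Lemma sweep_all Q d : uniq Q -> sweep (dtop K) Q d (dbot K) -> forall c, c \in Q.
Proof.
move=> uQ sw.
have visb f e : e \in fbot f -> (e \in edges_by Q) = (f \in seen Q).
  move=> he; rewrite edges_byE; apply/flattenP/idP => [[_ /mapP[g hg ->] he']|hf].
    by rewrite (fbot_unique cnt he he').
  by exists (fbot f) => //; apply: map_f.
have vist f e : e \in ftop f -> (e \in edges_by Q) = (f \in seen Q).
  move=> he; rewrite (perm_mem (sweep_perm sw)).
  have -> : dbot K ++ flatten [seq ctop c | c <- Q] = flatten [seq ftop f | f <- seen Q].
    by rewrite /= -map_comp.
  apply/flattenP/idP => [[_ /mapP[g hg ->] he']|hf].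
    by rewrite (ftop_unique cnt he he').
  by exists (ftop f) => //; apply: map_f.
have visd f (x : edge K * bool) : x \in face_boundary f ->
    (x.1 \in edges_by Q) = (f \in seen Q).
  case: x => e [] /=; rewrite face_boundaryE ?mem_walk_true ?mem_walk_false.
    exact: vist.
  exact: visb.
have visr (x y : edge K * bool) : origin x = origin y -> x.1 \in edges_by Q ->
    y.1 \in edges_by Q.
  move=> /rot /(@connect_invariant _ _ [pred d | d.1 \in edges_by Q]); apply.
  move=> {x y} x y hx /existsP[f /andP[h1 /eqP h2]].
  rewrite /= (visd f); last by rewrite -h2 mem_next.
  by rewrite -(visd f _ h1).
pose a x := [exists e, (e \in edges_by Q) && ((src e == x) || (tgt e == x))].
have dart e x : (src e == x) || (tgt e == x) -> exists b, origin (e, b) = x.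
  by case/orP=> /eqP <-; [exists true|exists false].
have ainv x y : a x -> adjacent x y -> a y.
  move=> /existsP[e0 /andP[h0 /dart[b0 o0]]] /existsP[e he].
  have [b ob] : exists b, origin (e, b) = x.
    by apply: dart; case/orP: he => [/andP[-> _]|/andP[_ ->]]; rewrite ?orbT.
  have := @visr (e0, b0) (e, b); rewrite o0 ob => /(_ erefl h0) /= hv.
  apply/existsP; exists e; rewrite hv /=.
  by case/orP: he => [/andP[_ ->]|/andP[-> _]]; rewrite ?orbT.
have [e1 [s1 E1]] : exists e1 s1, dtop K = e1 :: s1.
  by case: (dtop K) top_ne => // e1 s1 _; exists e1, s1.
have a1 : a (src e1).
  by apply/existsP; exists e1; rewrite eqxx /edges_by E1 mem_head.
move=> c; have [e he] : exists e, e \in ctop c.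
  have : ctop c <> [::] := (face_ne (Some c)).1.
  by case: (ctop c) => [/(_ erefl)[]|e s _]; exists e; rewrite mem_head.
have /existsP[e0 /andP[h0 /dart[b0 o0]]] : a (src e).
  exact: connect_invariant ainv (con (src e1) (src e)) a1.
have := @visr (e0, b0) (e, true); rewrite o0 => /(_ erefl h0) /=.
by rewrite (vist (Some c)) // mem_seen.
Qed.

Lemma sweep_step Q d p : uniq Q -> sweep (dtop K) Q d p ->
  p = dbot K \/ exists c A B, p = A ++ ctop c ++ B /\ c \notin Q.
Proof.
move=> uQ sw; have hp := topP; rewrite (sweep_pos_path _ _ cellP sw) in hp.
have [A [[c|] [B ep]]] := sweepable hp.
  (* A cell swept earlier would have its top edges both on the front and among the edges already
     crossed. *)
  right; exists c, A, B; split=> //; apply/negP => cQ.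
  have := edges_by_uniq uQ; rewrite (perm_uniq (sweep_perm sw)) ep cat_uniq.
  case/and3P=> _ /hasPn h _.
  have : ctop c <> [::] := (face_ne (Some c)).1.
  case E : (ctop c) => [//|e s] _; have /h : e \in flatten [seq ctop c | c <- Q].
    by apply/flattenP; exists (ctop c); [apply: map_f|rewrite E mem_head].
  by rewrite /= !mem_cat E mem_head orbT.
(* The face found is the unbounded one. The front contains the whole bottom path, which already runs
   from source to sink, so nothing can precede or follow it. *)
left; rewrite ep /= in hp *.
case/pos_path_cat: hp => x hA /pos_path_cat [y hm hB].
have A0 : A = [::].
  case/lastP: A hA {ep} => // s e /pos_path_tgt ex.
  have ne : dbot K <> [::] := (face_ne None).1.
  case: (dbot K) botP ne hm => [|e0 s0] h // _ hm.
  by move/pos_path_src: hm; rewrite (pos_path_src h) -ex => /esym/iotaP.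
have B0 : B = [::].
  case: B hB {ep} => // e s /pos_path_src ex.
  have ne : dbot K <> [::] := (face_ne None).1.
  case/lastP: (dbot K) botP ne hm => [|s0 e0] h // _ hm.
  by move/pos_path_tgt: hm; rewrite (pos_path_tgt h) -ex => /esym/tauP.
by rewrite A0 B0 cats0.
Qed.

Lemma sweep_extend n Q d p : ncell K - size Q <= n -> uniq Q ->
  sweep (dtop K) Q d p ->
  exists R d', [/\ uniq R, forall c, c \in R & sweep (dtop K) R d' (dbot K)].
Proof.
elim: n Q d p => [|n IH] Q d p hn uQ sw.
  have [e|[c [A [B [_ /negP[]]]]]] := sweep_step uQ sw.
    by rewrite e in sw; exists Q, d; split=> //; apply: sweep_all sw.
  have sz : size (enum (cell K)) <= size Q by rewrite -cardE card_ord; lia.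
  have sub : {subset Q <= enum (cell K)} by move=> x _; rewrite mem_enum.
  by have [_ ->] := uniq_min_size uQ sub sz; rewrite mem_enum.
have [e|[c [A [B [ep cQ]]]]] := sweep_step uQ sw.
  by rewrite e in sw; exists Q, d; split=> //; apply: sweep_all sw.
rewrite ep in sw.
have sw1 := sweep_cons (sweep_nil (A ++ cbot c ++ B)).
apply: (IH (Q ++ [:: c])) (sweep_cat sw sw1); first by rewrite size_cat /=; lia.
by rewrite cats1 rcons_uniq cQ.
Qed.

Lemma extract_layered : exists cs d, @layered _ P K cs d iota tau.
Proof.
have [cs [d [us alls sw]]] := @sweep_extend (ncell K) [::] [::] _ (leq_subr _ _)
  isT (sweep_nil (dtop K)).
exists cs, d.
have p : perm_eq (seen cs) (faces K).
  apply: uniq_perm; [exact: seen_uniq|exact: enum_uniq|].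
  by case=> [c|]; rewrite ?mem_seen mem_enum // alls.
have pe : perm_eq (edges_by cs) bots.
  by rewrite edges_byE; apply: perm_flatten_map.
have pv : perm_eq (verts_by iota tau cs) (iota :: tau :: map (@src _ K) ibots).
  rewrite /verts_by !perm_cons map_flatten -map_comp.
  have -> : inner (dtop K) ++ flatten [seq inner (cbot c) | c <- cs] =
      flatten [seq inner (fbot f) | f <- seen cs] by rewrite /= -map_comp.
  exact: perm_flatten_map.
have [ue alle] := fbot_list cnt; have [uv allv] := inner_bot_full.
split=> //.
- by rewrite (perm_uniq pe).
- by move=> e; rewrite (perm_mem pe).
- by rewrite (perm_uniq pv).
- by move=> e; rewrite (perm_mem pv).
Qed.

End Extract.

Lemma is_diagram_layered (Sg : Type) (P : presentation Sg) (K : complex Sg) :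
  is_diagram P K -> dtop K <> [::] -> exists d, realizes P K d.
Proof.
move=> [[h1 h2 h3 h4] [iota [tau [[i1 i2] [t1 t2] [p1 p2] cs _]]]] ne.
have [cs' [d l]] := extract_layered cs h2 h3 h1 h4 i1 i2 t1 t2 p1 p2 ne.
by exists d, cs', iota, tau.
Qed.

Import Order.TTheory GRing.Theory Num.Theory.

(** * Swept complexes are diagrams *)

Section Rank.
Variables (Sg : Type) (P : presentation Sg) (K : complex Sg).
Implicit Types (e : edge K) (x y z : vert K) (s p q : seq (edge K)).

Lemma pos_path_mem_src x y s e : pos_path x s y -> e \in s ->
  (src e \in x :: inner s) /\ (tgt e \in y :: inner s).
Proof.
elim: s x => [//|e0 s IH] x h; rewrite inE => /orP[/eqP ->|he].
  rewrite (pos_path_src h) mem_head; split=> //.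
  case: s h {IH} => [/andP[_ /= /eqP ->]|e1 s /and3P[_ /eqP h _]].
    by rewrite mem_head.
  by rewrite -h /inner /= !inE eqxx orbT.
have h' : pos_path (tgt e0) s y by case/andP: h.
have [h1 h2] := IH _ h' he; split.
  by rewrite inE /inner /= (map_f _ he) orbT.
move: h2; rewrite !inE => /orP[->//|]; rewrite /inner /= => h2.
apply/orP; right; case: (s) h2 => [//|e1 s1] /=.
by rewrite inE => ->; rewrite orbT.
Qed.

(** Heights strictly increasing along edges exclude closed positive paths. Rationals always leave
    room for new vertices between two old ones. *)
Definition ranks (r : vert K -> rat) s :=
  forall e, e \in s -> (r (src e) < r (tgt e))%R.

Lemma ranks_path r x s y : ranks r s -> pos_path x s y ->
  s <> [::] -> (r x < r y)%R.
Proof.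
elim: s x => [//|e s IH] x hr /andP[/eqP ex h] _.
have lt : (r x < r (tgt e))%R by rewrite -ex; apply: hr; apply: mem_head.
case: s h IH hr => [/eqP <- //|e1 s] h IH hr; apply: lt_trans lt _.
by apply: IH => // e2 h2; apply: hr; rewrite inE h2 orbT.
Qed.

(* The new vertices are placed one after the other halfway to the end. *)
Lemma rank_extend r x s y : pos_path x s y -> s <> [::] ->
  uniq (x :: y :: inner s) -> (r x < r y)%R ->
  exists r', {in predC (mem (inner s)), r' =1 r} /\ ranks r' s.
Proof.
elim: s x r => [//|e s IH] x r /andP[/eqP ex h] _ un lt.
case: s h IH un => [/eqP ey _ _|e2 s].
  exists r; split=> // e'; rewrite inE => /eqP ->; by rewrite ex ey.
move=> h IH; have ez := pos_path_src h.
have -> : inner [:: e, e2 & s] = tgt e :: inner (e2 :: s) by rewrite /inner /= ez.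
rewrite /= !inE !negb_or => /and4P[/and3P[xy xz xs] /andP[yz ys] zs un].
pose m := ((r x + r y) / 2)%R.
have [lt1 lt2] : (r x < m)%R /\ (m < r y)%R by have [] := midf_lt lt.
pose r1 z := if z == tgt e then m else r z.
have r1z : r1 (tgt e) = m by rewrite /r1 eqxx.
have r1N z : z != tgt e -> r1 z = r z by rewrite /r1 => /negPf ->.
have [||| r' [eqr hr]] := IH (tgt e) r1 h.
- by [].
- by rewrite /= inE negb_or eq_sym yz zs ys.
- by rewrite r1z r1N.
exists r'; split=> [z|e'].
  by rewrite !inE negb_or => /andP[z1 z2]; rewrite eqr // r1N.
rewrite inE => /orP[/eqP ->|/hr //].
by rewrite ex !eqr ?r1z ?r1N // inE.
Qed.

(** [S] and [Sv] collect the edges and vertices created so far. The interior of the next bottom path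
    is fresh, so its heights can be chosen without disturbing the earlier ones. *)
Lemma sweep_rank p cs d q S Sv r : (forall c : cell K, cell_ok P c) ->
  sweep p cs d q -> {subset p <= S} ->
  (forall e, e \in S -> src e \in Sv /\ tgt e \in Sv) -> ranks r S ->
  uniq (Sv ++ flatten [seq inner (cbot c) | c <- cs]) ->
  exists r', ranks r' (S ++ flatten [seq cbot c | c <- cs]).
Proof.
move=> ok sw; elim: sw S Sv r => {p cs d q} [p|A c B cs d q _ IH] S Sv r sub ends hr un.
  by exists r; rewrite cats0.
have [[x [y [h1 h2]]] _] := ok c; have [n1 n2] := cell_ok_nonempty (ok c).
have subt : {subset ctop c <= S} by move=> e he; apply: sub; rewrite !mem_cat he orbT.
have lt : (r x < r y)%R.
  by apply: (ranks_path (s := ctop c)) => // e /subt; apply: hr.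
have [xS yS] : x \in Sv /\ y \in Sv.
  case/lastP: (ctop c) h1 n1 subt => [//|s e] h1 _ subt; split.
    case: s h1 subt => [|e1 s] h1 subt; rewrite -(pos_path_src h1).
      by have [] := ends e (subt _ (mem_head _ _)).
    by have [] := ends e1 (subt _ (mem_head _ _)).
  rewrite -(pos_path_tgt h1).
  by have [] := ends e; [apply: subt; rewrite mem_rcons mem_head|].
move: un; rewrite /= catA => un; have := un; rewrite cat_uniq => /andP[].
rewrite cat_uniq => /and3P[uSv /hasPn dis uin] _.
have xy : x != y by apply: contraTneq lt => ->; rewrite ltxx.
have [|r1 [eqr hr1]] := rank_extend h2 n2 _ lt.
  rewrite /= inE negb_or xy uin andbT /=.
  by apply/andP; split; [apply/negP => /dis; rewrite xS|apply/negP => /dis; rewrite yS].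
have eqS z : z \in Sv -> r1 z = r z.
  by move=> hz; apply: eqr; rewrite inE; apply/negP => /dis; rewrite hz.
have [|e|e|r' hr'] := IH (S ++ cbot c) (Sv ++ inner (cbot c)) r1 _ _ _ un.
- move=> e; rewrite !mem_cat => /or3P[he|->|he]; rewrite ?orbT // sub //.
    by rewrite !mem_cat he.
  by rewrite !mem_cat he !orbT.
- rewrite mem_cat => /orP[/ends[s1 s2]|he]; first by rewrite !mem_cat s1 s2.
  have [m1 m2] := pos_path_mem_src h2 he.
  move: m1 m2; rewrite !inE !mem_cat.
  by split; [case/orP: m1 => [/eqP ->|->]|case/orP: m2 => [/eqP ->|->]];
    rewrite ?xS ?yS ?orbT.
- rewrite mem_cat => /orP[he|/hr1 //].
  by have [m1 m2] := ends e he; rewrite !eqS //; apply: hr.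
by exists r'; rewrite /= catA.
Qed.

End Rank.

(** * Planarity of a complex built in layers *)

Section Layered.
Variables (Sg : Type) (P : presentation Sg) (K : complex Sg).
Variables (cs : seq (cell K)) (d : seq (medge Sg)) (i t : vert K).
Hypothesis L : layered P cs d i t.
Implicit Types (e : edge K) (x y : vert K) (f : option (cell K)).

Let ok := lay_ok L.

Lemma lay_neq : i != t.
Proof. by have := lay_uniqv L; rewrite /= inE negb_or => /andP[/andP[]]. Qed.

Lemma lay_bot : pos_path i (dbot K) t.
Proof. by rewrite -(sweep_pos_path i t ok (lay_sweep L)); apply: lay_path L. Qed.

Lemma lay_botne : dbot K <> [::].
Proof. by move=> e; have := lay_bot; rewrite e /= => h; have := lay_neq; rewrite h. Qed.

Lemma lay_ne_face f : (ftop f <> [::]) * (fbot f <> [::]).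
Proof.
case: f => [c|] /=; first exact: cell_ok_nonempty (ok c).
by split; [apply: lay_botne|apply: lay_ne L].
Qed.

Lemma lay_faces : perm_eq (seen cs) (faces K).
Proof.
apply: uniq_perm; [exact: seen_uniq (lay_uniq L)|exact: enum_uniq|].
by case=> [c|]; rewrite ?mem_seen mem_enum // (lay_cells L).
Qed.

Lemma lay_bots : perm_eq (bots K) (edges_by cs).
Proof. by rewrite edges_byE perm_sym; apply: perm_flatten_map; apply: lay_faces. Qed.

Lemma lay_tops : perm_eq (tops K) (edges_by cs).
Proof.
rewrite (permPr (sweep_perm (lay_sweep L))).
have -> : dbot K ++ flatten [seq ctop c | c <- cs] = flatten [seq ftop f | f <- seen cs].
  by rewrite /= -map_comp.
by rewrite perm_sym; apply: perm_flatten_map; apply: lay_faces.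
Qed.

Lemma lay_count (b : edge K * bool) :
  (\sum_(f : option (cell K)) count_mem b (face_boundary f) = 1)%N.
Proof.
have cnt1 e : count_mem e (edges_by cs) = 1.
  by rewrite (count_uniq_mem _ (lay_uniqe L)) (lay_edges L).
case: b => e [].
  rewrite -(cnt1 e) -(permP lay_tops) count_faces.
  by apply: eq_bigr => f _; rewrite face_boundaryE count_walk.
rewrite -(cnt1 e) -(permP lay_bots) count_faces.
by apply: eq_bigr => f _; rewrite face_boundaryE count_walk.
Qed.

Lemma lay_itops : uniq (map (@src _ K) (itops K)).
Proof.
have p : perm_eq (map (@src _ K) (itops K))
    (inner (dbot K) ++ flatten [seq inner (ctop c) | c <- cs]).
  have -> : inner (dbot K) ++ flatten [seq inner (ctop c) | c <- cs] =
    flatten [seq inner (ftop f) | f <- seen cs] by rewrite /= -map_comp.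
  rewrite map_flatten -map_comp perm_sym; apply: perm_flatten_map; exact: lay_faces.
rewrite (perm_uniq p) -(perm_uniq (sweep_inner_perm ok (lay_sweep L))).
by have := lay_uniqv L => /and3P[].
Qed.

Lemma lay_rank : exists r : vert K -> rat, forall e, (r (src e) < r (tgt e))%R.
Proof.
have un := lay_uniqv L.
pose r0 x : rat := if x == t then 1%R else 0%R.
have lt0 : (r0 i < r0 t)%R by rewrite /r0 eqxx (negPf lay_neq).
have [|r [_ hr]] := rank_extend (lay_path L) (lay_ne L) _ lt0.
  by move: un; rewrite /verts_by -!cat_cons cat_uniq => /andP[].
have [|||r' hr'] := sweep_rank (S := dtop K) (Sv := i :: t :: inner (dtop K)) ok (lay_sweep L) _ _ hr.
- by [].
- move=> e he; have [m1 m2] := pos_path_mem_src (lay_path L) he.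
  by move: m1 m2; rewrite !inE => /orP[->|->] /orP[->|->]; rewrite ?orbT.
- exact: un.
by exists r' => e; exact: (hr' e (lay_edges L e)).
Qed.

Lemma lay_through e : exists A B, pos_path i (A ++ e :: B) t.
Proof.
suff H p cs0 d0 q : sweep p cs0 d0 q -> pos_path i p t ->
    forall e, e \in p ++ flatten [seq cbot c | c <- cs0] ->
    exists A B, pos_path i (A ++ e :: B) t.
  exact: (H _ _ _ _ (lay_sweep L) (lay_path L) e (lay_edges L e)).
elim=> {p cs0 d0 q e} [p|A c B cs0 d0 q _ IH] hp e he.
  by rewrite cats0 in he; case/splitPr: he hp => A B hp; exists A, B.
have hp' := hp; rewrite (pos_path_cell _ _ _ _ (ok c)) in hp'.
move: he; rewrite mem_cat => /orP[he|].
  by case/splitPr: he hp => A' B' hp; exists A', B'.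
by rewrite /= mem_cat => /orP[he|he]; apply: IH hp' _ _; rewrite !mem_cat he ?orbT.
Qed.

Lemma lay_reach x : exists p q, pos_path i p x /\ pos_path x q t.
Proof.
have inn y s : y \in inner s -> exists p q, pos_path i p y /\ pos_path y q t.
  case/mapP=> e _ ->; have [A [B /pos_path_cat [z h1 h2]]] := lay_through e.
  by exists A, (e :: B); rewrite (pos_path_src h2).
have := lay_verts L x; rewrite !inE mem_cat => /or4P[/eqP->|/eqP->|/inn //|].
- by exists [::], (dtop K); split; [rewrite /= eqxx|apply: lay_path L].
- by exists (dtop K), [::]; split; [apply: lay_path L|rewrite /= eqxx].
- by case/flattenP=> _ /mapP[c _ ->] /inn.
Qed.

Lemma lay_source e : tgt e <> i.
Proof.
move=> ei; have [r hr] := lay_rank; have := hr e; rewrite ei.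
have [p [_ [h _]]] := lay_reach (src e).
have := @ranks_path _ _ r i p (src e) _ h; case: p h => [/eqP <- _|e1 p h].
  by rewrite ltxx.
move/(_ (fun e _ => hr e)) => H /lt_trans /(_ (H _)); rewrite ltxx.
by move=> F; have : false by apply: F.
Qed.

Lemma lay_sink e : src e <> t.
Proof.
move=> ei; have [r hr] := lay_rank; have := hr e; rewrite ei.
have [_ [p [_ h]]] := lay_reach (tgt e).
have := @ranks_path _ _ r (tgt e) p t _ h; case: p h => [/eqP -> _|e1 p h].
  by rewrite ltxx.
move/(_ (fun e _ => hr e)) => H /lt_trans /(_ (H _)); rewrite ltxx.
by move=> F; have : false by apply: F.
Qed.

Lemma lay_face_path f : exists x y, pos_path x (ftop f) y /\ pos_path x (fbot f) y.
Proof.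
case: f => [c|] /=; first by case: (ok c).
by exists i, t; split; [apply: lay_bot|apply: lay_path L].
Qed.

Lemma lay_simple x p y : pos_path x p y -> uniq (x :: map (@tgt _ K) p).
Proof.
have [r hr] := lay_rank.
have lts q z z' : pos_path z q z' -> forall e, e \in q -> (r z < r (tgt e))%R.
  elim: q z => [//|e q IH] z /= /andP[/eqP <- h] e'.
  rewrite inE => /orP[/eqP -> //|/(IH _ h)]; exact: lt_trans.
elim: p x => [//|e p IH] x h; have := lts _ _ _ h.
case/andP: (h) => /eqP ex h' lt; rewrite map_cons cons_uniq (IH _ h') andbT.
rewrite -map_cons; apply/mapP => -[e' he ee].
by have := lt e' he; rewrite -ee ltxx.
Qed.

(** The dart at which turning from incoming edges is stopped: the outgoing edge that continues a top
    path at [x] or, at the sink, the last edge of the bottom path. *)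
Definition top_goal x (D : edge K * bool) : Prop :=
  if x == t then D = (last (head D.1 (dbot K)) (dbot K), false)
  else [/\ D.2, D.1 \in itops K & src D.1 = x].

(** An incoming edge that ends the top of a cell turns to the last edge of its bottom, which the
    sweep meets later. Induction on the remaining sweep ends at the goal. *)
Lemma lay_in e : exists D, connect (@rotation _ K) (e, false) D /\
  top_goal (tgt e) D.
Proof.
have mid f s1 e1 e2 s2 : ftop f = s1 ++ e1 :: e2 :: s2 ->
    exists D, connect (@rotation _ K) (e1, false) D /\ top_goal (tgt e1) D.
  move=> E; exists (e2, true); split.
    apply/connect1/(rotation_in lay_count lay_ne_face); exists f; left.
    by exists s1, e2, s2.
  have [x [y [h _]]] := lay_face_path f; rewrite E in h.
  have es := pos_path_mid h.
  rewrite /top_goal -es; have /negPf -> : src e2 != t by apply/eqP; apply: lay_sink.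
  split=> //; apply: (@mem_itops _ _ f); rewrite E.
  by case: (s1) => [|a s]; rewrite /= ?mem_head // mem_cat inE mem_head !orbT.
suff H p cs0 d0 q : sweep p cs0 d0 q -> q = dbot K ->
    forall e, e \in p ++ flatten [seq cbot c | c <- cs0] ->
    exists D, connect (@rotation _ K) (e, false) D /\ top_goal (tgt e) D.
  exact: (H _ _ _ _ (lay_sweep L) erefl e (lay_edges L e)).
elim=> {p cs0 d0 q e} [p|A c B cs0 d0 q _ IH] eq e he.
  rewrite cats0 eq in he; case/splitPr E: _ / he => [s1 s2].
  case: s2 E => [|e2 s2] E; last exact: (mid None s1 e e2 s2).
  exists (e, false); split; first exact: connect0.
  have := lay_bot; rewrite E cats1 => /pos_path_tgt ->.
  by rewrite /top_goal eqxx E last_cat.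
have {}IH := IH eq; move: he; rewrite mem_cat => /orP[|he]; last first.
  by apply: IH; move: he; rewrite /= !mem_cat => /orP[->|->]; rewrite ?orbT.
rewrite !mem_cat => /or3P[he|he|he].
- by apply: IH; rewrite !mem_cat he.
- case/splitPr E: _ / he => [s1 s2].
  case: s2 E => [|e2 s2] E; last exact: (mid (Some c) s1 e e2 s2).
  have [[x [y [h1 h2]]] _] := ok c; have [_ n2] := cell_ok_nonempty (ok c).
  case/lastP Eb: (cbot c) n2 h2 => [//|b e'] _ h2.
  rewrite E cats1 in h1.
  have [|D [hc hD]] := IH e'; first by rewrite Eb !mem_cat mem_rcons mem_head ?orbT.
  exists D; split; last by rewrite (pos_path_tgt h1) -(pos_path_tgt h2).
  apply: connect_trans hc; apply/connect1/(rotation_in lay_count lay_ne_face).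
  by exists (Some c); right; exists s1, b, e'; split=> //=; rewrite E cats1.
- by apply: IH; rewrite !mem_cat he !orbT.
Qed.

Definition bot_goal x (D : edge K * bool) : Prop :=
  if x == i then D = (head D.1 (dtop K), true) else D.2 = false /\ tgt D.1 = x.

(** Turning goes upwards here: the first edge of a bottom turns to the first edge of the top, which
    is on an earlier front. Hence the property is carried from each front to the next. *)
Lemma lay_out e : exists D, connect (@rotation _ K) (e, true) D /\
  bot_goal (src e) D.
Proof.
have mid f s1 e1 e2 s2 : fbot f = s1 ++ e1 :: e2 :: s2 ->
    exists D, connect (@rotation _ K) (e2, true) D /\ bot_goal (src e2) D.
  move=> E; exists (e1, false); split.
    apply/connect1/(rotation_out lay_count lay_ne_face); exists f; left.
    by exists s1, e1, s2.
  have [x [y [_ h]]] := lay_face_path f; rewrite E in h.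
  have es := pos_path_mid h.
  rewrite /bot_goal es; have /negPf -> // : tgt e1 != i by apply/eqP; apply: lay_source.
suff H p cs0 d0 q : sweep p cs0 d0 q ->
    (forall e, e \in p ->
      exists D, connect (@rotation _ K) (e, true) D /\ bot_goal (src e) D) ->
    forall e, e \in q ++ flatten [seq ctop c | c <- cs0] ->
      exists D, connect (@rotation _ K) (e, true) D /\ bot_goal (src e) D.
  apply: (H _ _ _ _ (lay_sweep L)).
    move=> e' he; case/splitPr E: _ / he => [s1 s2].
    case/lastP: s1 E => [|s1 e1] E; last first.
      by rewrite cat_rcons in E; apply: (mid None s1 e1 e' s2).
    exists (e', true); split; first exact: connect0.
    have := lay_path L; rewrite E => /pos_path_src ->.
    by rewrite /bot_goal eqxx E.
  by rewrite -(perm_mem (sweep_perm (lay_sweep L))) (lay_edges L).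
elim=> {p cs0 d0 q e} [p|A c B cs0 d0 q _ IH] hp.
  by move=> e; rewrite cats0; apply: hp.
have hb e : e \in A ++ cbot c ++ B ->
    exists D, connect (@rotation _ K) (e, true) D /\ bot_goal (src e) D.
  rewrite !mem_cat => /or3P[he|he|he]; try by apply: hp; rewrite !mem_cat he ?orbT.
  case/splitPr E: _ / he => [s1 s2].
  case/lastP: s1 E => [|s1 e1] E; last first.
    by rewrite cat_rcons in E; apply: (mid (Some c) s1 e1 e s2).
  have [[x [y [h1 h2]]] _] := ok c; have [n1 _] := cell_ok_nonempty (ok c).
  case Et: (ctop c) n1 h1 => [//|e' s'] _ h1; rewrite E in h2.
  have [|D [hc hD]] := hp e'; first by rewrite Et !mem_cat mem_head orbT.
  exists D; split; last by rewrite (pos_path_src h2) -(pos_path_src h1).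
  apply: connect_trans hc; apply/connect1/(rotation_out lay_count lay_ne_face).
  by exists (Some c); right; exists s2, s', e'.
move=> e; rewrite mem_cat => /orP[he|].
  by apply: (IH hb); rewrite mem_cat he.
rewrite /= mem_cat => /orP[he|he]; first by apply: hp; rewrite !mem_cat he orbT.
by apply: (IH hb); rewrite mem_cat he orbT.
Qed.

(** Each dart lies on one face boundary, without repetition, so rotation is the graph of an
    injective map of a finite set and its orbits are cycles. *)
Lemma rotation_sym : connect_sym (@rotation _ K).
Proof.
have ex (x : edge K * bool) : exists f, flip x \in face_boundary f.
  case: x => e [].
    have [f hf] := fbot_ex lay_count e; exists f.
    by rewrite face_boundaryE mem_walk_false.
  have [f hf] := ftop_ex lay_count e; exists f.
  by rewrite face_boundaryE mem_walk_true.
have [F hF] := choice ex.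
pose g (x : edge K * bool) := next (face_boundary (F x)) (flip x).
have rE : @rotation _ K =2 frel g.
  move=> x y; apply/existsP/eqP => [[f /andP[h /eqP <-]]|<-].
    by rewrite /g (boundary_unique lay_count (hF x) h).
  by exists (F x); rewrite hF /= eqxx.
have gi : injective g.
  move=> x y E; have hx : g x \in face_boundary (F x) by rewrite mem_next.
  have hy : g x \in face_boundary (F y) by rewrite E mem_next.
  have EF := boundary_unique lay_count hx hy.
  have un := boundary_uniq lay_count (F x).
  have : flip x = flip y.
    by rewrite -(prev_next un (flip x)) -[next _ _]/(g x) E /g -EF prev_next.
  case: x y {E hx hy EF un} => [e b] [e' b'] [-> ]; by case: b b' => [] [].
move=> x y; rewrite !(eq_connect rE); exact: fconnect_sym.
Qed.

(** All darts at [x] lead to one and the same dart: outgoing ones reach an incoming one, and the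
    goal of the incoming ones is unique by [lay_itops]. The two ends are treated by their own
    goals. *)
Lemma lay_rotation (D D' : edge K * bool) :
  origin D = origin D' -> connect (@rotation _ K) D D'.
Proof.
move=> o; suff [D0 H] : exists D0, forall D1, origin D1 = origin D ->
    connect (@rotation _ K) D1 D0.
  by apply: connect_trans (H D erefl) _; rewrite rotation_sym; apply: H.
set x := origin D; have [xi|xi] := eqVneq x i.
  have [e0 _] : exists e0 : edge K, True by case: (dtop K) (lay_ne L) => // e0; exists e0.
  exists (head e0 (dtop K), true); case=> e [] /= o1; last first.
    by move: o1; rewrite /origin /= xi => /lay_source.
  have [D1 [hc]] := lay_out e; rewrite -[src e]/(origin (e, true)) o1 /bot_goal xi eqxx => ED.
  by move: hc; rewrite ED; case: (dtop K) (lay_ne L).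
have [xt|xt] := eqVneq x t.
  have [e0 _] : exists e0 : edge K, True by case: (dtop K) (lay_ne L) => // e0; exists e0.
  exists (last (head e0 (dbot K)) (dbot K), false); case=> e [] /= o1.
    by move: o1; rewrite /origin /= xt => /lay_sink.
  have [D1 [hc]] := lay_in e; rewrite -[tgt e]/(origin (e, false)) o1 /top_goal xt eqxx => ED.
  by move: hc; rewrite ED; case: (dbot K) lay_botne.
have hin e : tgt e = x -> exists e', [/\ connect (@rotation _ K) (e, false) (e', true),
    e' \in itops K & src e' = x].
  move=> ex; have [[e' b] [hc]] := lay_in e; rewrite /top_goal ex (negPf xt) /=.
  by case=> bt h1 h2; exists e'; split=> //; rewrite bt in hc.
have [e1 he1] : exists e, tgt e = x.
  have [p [_ [h _]]] := lay_reach x; case/lastP: p h => [/eqP ix|p e1 /pos_path_tgt <-].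
    by move: xi; rewrite -ix eqxx.
  by exists e1.
have [e2 [_ h1 h2]] := hin e1 he1.
have fin e : tgt e = x -> connect (@rotation _ K) (e, false) (e2, true).
  move=> ex; have [e3 [hc h3 h4]] := hin e ex.
  suff -> : e2 = e3 by [].
  by apply: (map_injective lay_itops h1 h3); rewrite h2 h4.
exists (e2, true); case=> e [] /= o1; last exact: fin.
have [[e3 b] [hc]] := lay_out e; rewrite -[src e]/(origin (e, true)) o1 -/x /bot_goal (negPf xi) /=.
by case=> b0 h3; rewrite b0 in hc; apply: connect_trans hc (fin _ h3).
Qed.

Lemma lay_connected x y : connect (@adjacent _ K) x y.
Proof.
have adj_sym : connect_sym (@adjacent _ K).
  apply: sym_connect_sym => u v; rewrite /adjacent; apply: eq_existsb => e.
  by rewrite orbC.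
have path_conn p u v : pos_path u p v -> connect (@adjacent _ K) u v.
  elim: p u => [|e p IH] u /=; first by move/eqP ->; apply: connect0.
  case/andP=> /eqP eu /IH; apply: connect_trans; apply: connect1.
  by apply/existsP; exists e; rewrite eu !eqxx.
have from u : connect (@adjacent _ K) i u.
  by have [p [_ [h _]]] := lay_reach u; apply: path_conn h.
by apply: connect_trans (from y); rewrite adj_sym.
Qed.

(** Every layer creates one more edge than vertices; the initial path has two further vertices, its
    ends. *)
Lemma lay_euler : (nvert K + ncell K = nedge K + 1)%N.
Proof.
have sv := size_full (lay_uniqv L) (lay_verts L).
have se := size_full (lay_uniqe L) (lay_edges L).
have sc := size_full (lay_uniq L) (lay_cells L).
rewrite !card_ord in sv se sc.
have ne : forall l, List.In l [seq fbot f | f <- seen cs] -> l <> [::].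
  by move=> l; elim: (seen cs) => //= f s IH [<-|/IH //]; apply: (lay_ne_face f).2.
have := size_flatten_behead ne.
rewrite -edges_byE se size_map /= size_map sc.
have <- : size (inner (dtop K) ++ flatten [seq inner (cbot c) | c <- cs]) =
    size (behead (dtop K) ++ flatten [seq behead l | l <- [seq fbot i | i <- [seq Some i | i <- cs]]]).
  rewrite !size_cat size_map -!map_comp; congr (_ + _).
  by elim: (cs) => //= c s IH; rewrite !size_cat IH size_map.
by move: sv; rewrite /verts_by /=; lia.
Qed.

Lemma layered_is_diagram : is_diagram P K.
Proof.
split.
  split; [exact: lay_connected|exact: lay_count|exact: lay_rotation|exact: lay_euler].
exists i, t; split=> //.
- split; first exact: lay_source.
  move=> x hx; have [p [_ [h _]]] := lay_reach x.
  by case/lastP: p h => [/eqP -> //|p e /pos_path_tgt /hx].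
- split; first exact: lay_sink.
  move=> x hx; have [_ [p [_ h]]] := lay_reach x.
  by case: p h => [/eqP -> //|e p /pos_path_src /hx].
- by split; [apply: lay_path L|apply: lay_bot].
- by split; [apply: lay_reach|move=> x p y; apply: lay_simple].
Qed.

End Layered.

Lemma realizes_is_diagram (Sg : Type) (P : presentation Sg) (K : complex Sg) d :
  realizes P K d -> is_diagram P K.
Proof. by case=> cs [i [t L]]; apply: layered_is_diagram L. Qed.

Lemma uniq_full (T : finType) (s : seq T) :
  uniq s -> size s = #|T| -> forall x, x \in s.
Proof.
move=> u sz x; have sub : {subset s <= enum T} by move=> y _; rewrite mem_enum.
have le : size (enum T) <= size s by rewrite -cardE sz.
by have [_ ->] := uniq_min_size u sub le; rewrite mem_enum.
Qed.

Lemma shift_disjoint m n (s : seq 'I_m) (s' : seq 'I_n) :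
  ~~ has [in map (@lshift m n) s] (map (@rshift m n) s').
Proof.
apply/hasPn => e /mapP[j _ ->] /=; apply/mapP => -[e' _ /eqP].
by rewrite eq_rlshift.
Qed.

(** * Sweeps under maps, reflection and swaps *)

Section SweepMaps.
Variables (Sg : Type) (P : presentation Sg).

Lemma pos_path_of (K : complex Sg) (x y : vert K) p vs :
  map (@src _ K) p = x :: vs -> map (@tgt _ K) p = rcons vs y -> pos_path x p y.
Proof.
elim: p x vs => [//|e p IH] x vs /= [-> es] et; rewrite eqxx /=.
case: vs es et => [|z vs] es et.
  by case: p es et {IH} => //= _ [->].
by move: et => /= [ez et]; rewrite ez; apply: IH et.
Qed.

Lemma pos_path_map (K K' : complex Sg) (fV : vert K -> vert K') fE x y s :
  (forall e, e \in s -> src (fE e) = fV (src e) /\ tgt (fE e) = fV (tgt e)) ->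
  pos_path x s y -> pos_path (fV x) (map fE s) (fV y).
Proof.
elim: s x => [|e s IH] x /= g; first by move/eqP ->.
have [-> ->] := g e (mem_head _ _).
case/andP=> /eqP -> h; rewrite eqxx /=; apply: IH h => e' he.
by apply: g; rewrite inE he orbT.
Qed.

Lemma sweep_map (K K' : complex Sg) (fE : edge K -> edge K') (fC : cell K -> cell K')
    p cs d q :
  (forall e, lab (fE e) = lab e) -> (forall c, ctop (fC c) = map fE (ctop c)) ->
  (forall c, cbot (fC c) = map fE (cbot c)) ->
  sweep p cs d q -> sweep (map fE p) (map fC cs) d (map fE q).
Proof.
move=> hl ht hb; elim=> [p'|A c B cs' d' q' _ IH]; first exact: sweep_nil.
have lE s : label (map fE s) = label s.
  by rewrite /label -map_comp; apply: eq_map => e /=.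
rewrite !map_cat -ht -(lE A) -(lE B) -(lE (ctop c)) -(lE (cbot c)) -ht -hb.
by apply: sweep_cons; rewrite hb -!map_cat.
Qed.

Lemma sweep_mirror (K : complex Sg) p cs d q :
  @sweep _ K p cs d q -> @sweep _ (mirror K) q (rev cs) (drev d) p.
Proof.
elim=> [p'|A c B cs' d' q' _ IH]; first exact: sweep_nil.
rewrite rev_cons -cats1 /drev map_cons rev_cons -cats1.
apply: sweep_cat IH _.
exact: (@sweep_cons _ (mirror K) A c B [::] [::] _ (@sweep_nil _ (mirror K) _)).
Qed.

Lemma pos_path_mirror (K : complex Sg) (x y : vert K) p :
  @pos_path _ (mirror K) x p y = @pos_path _ K x p y.
Proof. by elim: p x => //= e p IH x; rewrite IH. Qed.

Lemma realizes_mirror (K : complex Sg) d :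
  realizes P K d -> realizes P (mirror K) (drev d).
Proof.
case=> cs [i [t L]]; exists (rev cs), i, t.
have pr : perm_eq (rev cs) cs by rewrite perm_rev.
have sw := lay_sweep L; have ok := lay_ok L.
have pe : perm_eq (@edges_by _ (mirror K) (rev cs)) (edges_by cs).
  rewrite (permPr (sweep_perm sw)) perm_cat2l; exact: perm_flatten_map.
have pv : perm_eq (@verts_by _ (mirror K) i t (rev cs)) (verts_by i t cs).
  rewrite /verts_by !perm_cons (permPr (sweep_inner_perm ok sw)) perm_cat2l.
  exact: perm_flatten_map.
split.
- exact: sweep_mirror sw.
- by rewrite rev_uniq (lay_uniq L).
- by move=> c; rewrite mem_rev; apply: (lay_cells L).
- move=> c; have [[x [y [h1 h2]]] uv] := ok c; split; last exact: moveC.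
  by exists x, y; rewrite !pos_path_mirror.
- by rewrite pos_path_mirror; exact: lay_bot L.
- exact: lay_botne L.
- by rewrite (perm_uniq pe) (lay_uniqe L).
- by move=> e; rewrite (perm_mem pe); apply: (lay_edges L).
- by rewrite (perm_uniq pv) (lay_uniqv L).
- by move=> x; rewrite (perm_mem pv); apply: (lay_verts L).
Qed.

Lemma cell_swap (K : complex Sg) p cs1 q a u v b u' v' r :
  (@sweep _ K p cs1 [:: Medge a u v (b ++ u' ++ r); Medge (a ++ v ++ b) u' v' r] q ->
   exists2 cs2, perm_eq cs2 cs1 & sweep p cs2
     [:: Medge (a ++ u ++ b) u' v' r; Medge a u v (b ++ v' ++ r)] q) /\
  (@sweep _ K p cs1 [:: Medge (a ++ u ++ b) u' v' r; Medge a u v (b ++ v' ++ r)] q ->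
   exists2 cs2, perm_eq cs2 cs1 & sweep p cs2
     [:: Medge a u v (b ++ u' ++ r); Medge (a ++ v ++ b) u' v' r] q).
Proof.
split=> h.
  case: cs1 h => [|c1 [|c2 [|c3 cs]]] h; have := sweep_size h => //= _.
  have [A [R [d [-> [ea eu ev er] ed] h2]]] := sweep_consP h; subst d.
  have [A' [B' [d [e [ea' eu' ev' er'] ed] /sweep_nilP [e0 eq]]]] := sweep_consP h2.
  subst d a u v r u' v'.
  have s1 : size A + size (cbot c1) <= size A'.
    by have := congr1 size ea'; rewrite !size_cat !size_map; lia.
  have [X [eA' eR]] := cat_eq_split e s1; subst A' R.
  have eb : b = label X.
    by move: ea'; rewrite !label_cat => /(cat_inj_size erefl) [_ /(cat_inj_size erefl) []].
  exists [:: c2; c1]; first by apply/permP => z /=; lia.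
  subst b q; rewrite -!label_cat.
  have -> : A ++ ctop c1 ++ X ++ ctop c2 ++ B' = (A ++ ctop c1 ++ X) ++ ctop c2 ++ B'.
    by rewrite -!catA.
  apply: sweep_cons.
  have -> : (A ++ ctop c1 ++ X) ++ cbot c2 ++ B' = A ++ ctop c1 ++ X ++ cbot c2 ++ B'.
    by rewrite -!catA.
  apply: sweep_cons; rewrite -!catA; exact: sweep_nil.
case: cs1 h => [|c2 [|c1 [|c3 cs]]] h; have := sweep_size h => //= _.
have [A' [B' [d [-> [ea' eu' ev' er'] ed] h2]]] := sweep_consP h; subst d.
have [A [R [d [e [ea eu ev er] ed] /sweep_nilP [e0 eq]]]] := sweep_consP h2.
subst d a u v r u' v'.
have s1 : size A + size (ctop c1) <= size A'.
  by have := congr1 size ea'; rewrite !size_cat !size_map; lia.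
have [X [eA' eR]] := cat_eq_split (esym e) s1; subst A' R.
have eb : b = label X.
  by move: ea'; rewrite !label_cat => /(cat_inj_size erefl) [_ /(cat_inj_size erefl) []].
exists [:: c1; c2]; first by apply/permP => z /=; lia.
subst b q; rewrite -!label_cat -!catA.
apply: sweep_cons.
have E Y : A ++ cbot c1 ++ X ++ Y ++ B' = (A ++ cbot c1 ++ X) ++ Y ++ B'.
  by rewrite -!catA.
rewrite !E; apply: sweep_cons; exact: sweep_nil.
Qed.

Lemma sweep_swap (K : complex Sg) d d' : swap d d' -> forall p cs q,
  @sweep _ K p cs d q -> exists2 cs', perm_eq cs' cs & sweep p cs' d' q.
Proof.
(* Both directions are proved together because [swap] is closed under symmetry. *)
move=> s; suff : (forall p cs q, @sweep _ K p cs d q ->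
      exists2 cs', perm_eq cs' cs & sweep p cs' d' q) /\
    (forall p cs q, @sweep _ K p cs d' q ->
      exists2 cs', perm_eq cs' cs & sweep p cs' d q) by case.
elim: s => [d0|d0 d1 _ [] //|d0 d1 d2 _ [h1 h1'] _ [h2 h2']|d1 a u v b u' v' r d2].
- by split=> p cs q h; exists cs.
- split=> p cs q h.
    have [cs1 p1 /h2 [cs2 p2 s2]] := h1 _ _ _ h.
    by exists cs2 => //; apply: perm_trans p2 p1.
  have [cs1 p1 /h1' [cs2 p2 s2]] := h2' _ _ _ h.
  by exists cs2 => //; apply: perm_trans p2 p1.
- split=> p cs q /sweep_splitd [z1 [z2 [p1 [-> sw1]]]]
    /sweep_splitd [z3 [z4 [p2 [-> sw2 sw3]]]].
    have [z5 pz sw5] := (cell_swap _ _ _ _ _ _ _ _ _ _).1 sw2.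
    exists (z1 ++ z5 ++ z4); first by rewrite perm_cat2l perm_cat2r.
    by apply: sweep_cat sw1 (sweep_cat sw5 sw3).
  have [z5 pz sw5] := (cell_swap _ _ _ _ _ _ _ _ _ _).2 sw2.
  exists (z1 ++ z5 ++ z4); first by rewrite perm_cat2l perm_cat2r.
  by apply: sweep_cat sw1 (sweep_cat sw5 sw3).
Qed.

Lemma realizes_swap (K : complex Sg) d d' :
  swap d d' -> realizes P K d -> realizes P K d'.
Proof.
move=> s [cs [i [t L]]]; have [cs' p sw] := sweep_swap s (lay_sweep L).
by exists cs', i, t; apply: layered_perm L p sw.
Qed.

End SweepMaps.

(** * Diagrams of derivations *)

Section AttachPath.
Variables (Sg : Type) (V E : nat) (src0 tgt0 : 'I_E -> 'I_V) (lab0 : 'I_E -> Sg).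
Variables (s t : 'I_V) (x0 : Sg) (v : seq Sg).
Let k := size v.

(** The attached label is [x0 :: v], so it is non-empty by construction: [k + 1] new edges and [k]
    new vertices. Edge [j] starts at new vertex [j - 1], or at [s] for [j = 0], and ends at new
    vertex [j], or at [t] for [j = k]. *)
Definition asrc (e : 'I_(E + k.+1)) : 'I_(V + k) :=
  match split e with
  | inl e0 => lshift k (src0 e0)
  | inr j => oapp (@rshift V k) (lshift k s) (unlift ord0 j)
  end.

Definition atgt (e : 'I_(E + k.+1)) : 'I_(V + k) :=
  match split e with
  | inl e0 => lshift k (tgt0 e0)
  | inr j => oapp (@rshift V k) (lshift k t) (unlift ord_max j)
  end.

Definition alab (e : 'I_(E + k.+1)) : Sg :=
  match split e with inl e0 => lab0 e0 | inr j => nth x0 (x0 :: v) j end.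

Definition anew : seq 'I_(E + k.+1) := map (@rshift E k.+1) (enum 'I_k.+1).

Lemma split_l m n (j : 'I_m) : split (lshift n j) = inl j.
Proof. exact: (unsplitK (inl j)). Qed.

Lemma split_r m n (j : 'I_n) : split (rshift m j) = inr j.
Proof. exact: (unsplitK (inr j)). Qed.

Lemma asrc_old e : asrc (lshift k.+1 e) = lshift k (src0 e).
Proof. by rewrite /asrc split_l. Qed.

Lemma atgt_old e : atgt (lshift k.+1 e) = lshift k (tgt0 e).
Proof. by rewrite /atgt split_l. Qed.

Lemma alab_old e : alab (lshift k.+1 e) = lab0 e.
Proof. by rewrite /alab split_l. Qed.

Lemma alab_new : map alab anew = x0 :: v.
Proof.
rewrite /anew -map_comp; apply: (@eq_from_nth _ x0).
  by rewrite size_map size_enum_ord.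
move=> j; rewrite size_map size_enum_ord => hj.
rewrite (nth_map (Ordinal hj)) ?size_enum_ord //= /alab split_r.
by rewrite nth_enum_ord.
Qed.

Lemma asrc_new : map asrc anew = lshift k s :: map (@rshift V k) (enum 'I_k).
Proof.
rewrite /anew enum_ordSl /= /asrc split_r unlift_none /=; congr (_ :: _).
rewrite -!map_comp; apply: eq_map => j /=.
by rewrite split_r liftK.
Qed.

Lemma atgt_new : map atgt anew = rcons (map (@rshift V k) (enum 'I_k)) (lshift k t).
Proof.
rewrite /anew enum_ordSr !map_rcons /atgt split_r unlift_none /=; congr (rcons _ _).
rewrite -!map_comp; apply: eq_map => j /=.
rewrite split_r (_ : widen_ord _ j = lift ord_max j) ?liftK //.
by apply: val_inj; rewrite /= /bump leqNgt ltn_ord.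
Qed.

Lemma anew_uniq : uniq anew.
Proof. by rewrite map_inj_uniq ?enum_uniq //; apply: rshift_inj. Qed.

End AttachPath.

(** * Building a diagram by hanging cells below the bottom path *)

Section Builder.
Variables (Sg : Type) (P : presentation Sg).

Definition path_complex (x0 : Sg) (v : seq Sg) : complex Sg :=
  let no (e : 'I_0) : 'I_2 := ord0 in
  let nolab (e : 'I_0) : Sg := x0 in
  let p := anew 0 v in
  @Complex Sg (2 + size v) (0 + (size v).+1) 0
    (asrc no ord0 (v := v)) (atgt no ord_max (v := v)) (alab nolab x0 (v := v))
    (fun _ => [::]) (fun _ => [::]) p p.

Lemma path_complex_layered x0 v : realizes P (path_complex x0 v) [::] /\
  label (dtop (path_complex x0 v)) = x0 :: v.
Proof.
set K := path_complex x0 v.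
have lE : label (dtop K) = x0 :: v by exact: alab_new.
split=> //; exists [::], (lshift (size v) (ord0 : 'I_2)), (lshift (size v) (ord_max : 'I_2)).
have srcE : map (@src _ K) (dtop K) = lshift (size v) (ord0 : 'I_2) :: map (@rshift 2 _) (enum 'I_(size v)).
  exact: asrc_new.
have tgtE : map (@tgt _ K) (dtop K) = rcons (map (@rshift 2 _) (enum 'I_(size v))) (lshift (size v) (ord_max : 'I_2)).
  exact: atgt_new.
have innE : inner (dtop K) = map (@rshift 2 _) (enum 'I_(size v)).
  by rewrite /inner -behead_map srcE.
have ue : uniq (edges_by (K := K) [::]) by rewrite /edges_by cats0; exact: anew_uniq.
have uv : uniq (@verts_by _ K (lshift (size v) (ord0 : 'I_2)) (lshift (size v) (ord_max : 'I_2)) [::]).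
  rewrite /verts_by cats0 innE /= inE map_inj_uniq ?enum_uniq ?andbT; last exact: rshift_inj.
  rewrite (inj_eq (@lshift_inj _ _)) /=.
  by apply/andP; split; apply/mapP => -[j _ /eqP]; rewrite eq_lrshift.
split=> //.
- exact: sweep_nil.
- by case.
- by case.
- exact: pos_path_of srcE tgtE.
- by move=> e; rewrite e in lE.
- apply: uniq_full => //; rewrite /edges_by cats0 size_map size_enum_ord.
  by rewrite card_ord.
- apply: uniq_full => //; rewrite /verts_by cats0 innE /= size_map size_enum_ord.
  by rewrite card_ord.
Qed.

Definition attach_cell (K : complex Sg) (A U B : seq (edge K)) (s t : vert K)
    (x0 : Sg) (v : seq Sg) : complex Sg :=
  let k := size v in
  let old := map (@lshift (nedge K) k.+1) in
  @Complex Sg (nvert K + k) (nedge K + k.+1) (ncell K + 1)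
    (asrc (@src _ K) s (v := v)) (atgt (@tgt _ K) t (v := v))
    (alab (@lab _ K) x0 (v := v))
    (fun c => match split c with inl c0 => old (ctop c0) | inr _ => old U end)
    (fun c => match split c with
              | inl c0 => old (cbot c0) | inr _ => anew (nedge K) v end)
    (old (dtop K)) (old A ++ anew (nedge K) v ++ old B).

Lemma attach_cell_layered (K : complex Sg) (cs : seq (cell K)) d i t A U B x y x0 v :
  layered P cs d i t -> dbot K = A ++ U ++ B -> pos_path x U y ->
  move P (label U) (x0 :: v) ->
  let K' := attach_cell A U B x y x0 v in
  realizes P K' (d ++ [:: Medge (label A) (label U) (x0 :: v) (label B)]) /\
  label (dtop K') = label (dtop K).
Proof.
move=> L eb hU mvU K'; set k := size v.
pose fV : vert K -> vert K' := @lshift _ k.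
pose fE : edge K -> edge K' := @lshift _ k.+1.
pose fC : cell K -> cell K' := @lshift _ 1.
pose new : cell K' := rshift (ncell K) ord0.
have srcE e : src (fE e) = fV (src e) by exact: asrc_old.
have tgtE e : tgt (fE e) = fV (tgt e) by exact: atgt_old.
have labE e : lab (fE e) = lab e by exact: alab_old.
have topE c : ctop (fC c) = map fE (ctop c) by rewrite /= split_l.
have botE c : cbot (fC c) = map fE (cbot c) by rewrite /= split_l.
have topN : ctop new = map fE U by rewrite /= split_r.
have botN : cbot new = anew (nedge K) v by rewrite /= split_r.
have labelE s : label (map fE s) = label s.
  by rewrite /label -map_comp; apply: eq_map.
have labelN : label (cbot new) = x0 :: v by rewrite botN; exact: alab_new.
have srcN : map (@src _ K') (cbot new) = fV x :: map (@rshift (nvert K) k) (enum 'I_k).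
  by rewrite botN; exact: asrc_new.
have tgtN : map (@tgt _ K') (cbot new) = rcons (map (@rshift (nvert K) k) (enum 'I_k)) (fV y).
  by rewrite botN; exact: atgt_new.
have innE s : inner (map fE s) = map fV (inner s).
  by rewrite /inner behead_map -!map_comp; apply: eq_map.
have innN : inner (cbot new) = map (@rshift (nvert K) k) (enum 'I_k).
  by rewrite /inner -behead_map srcN.
have sw0 := sweep_map labE topE botE (lay_sweep L).
split; last exact: labelE.
exists (rcons (map fC cs) new), (fV i), (fV t).
have eE : edges_by (K := K') (rcons (map fC cs) new) =
    map fE (edges_by cs) ++ anew (nedge K) v.
  have E1 : [seq cbot c | c <- map fC cs] = map (map fE) [seq cbot c | c <- cs].
    by rewrite -!map_comp; apply: eq_map => c; rewrite /comp botE.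
  by rewrite /edges_by map_rcons flatten_rcons E1 botN -map_flatten catA map_cat.
have eV : verts_by (K := K') (fV i) (fV t) (rcons (map fC cs) new) =
    map fV (verts_by i t cs) ++ map (@rshift (nvert K) k) (enum 'I_k).
  have E1 : [seq inner (cbot c) | c <- map fC cs] =
      map (map fV) [seq inner (cbot c) | c <- cs].
    by rewrite -!map_comp; apply: eq_map => c; rewrite /comp botE innE.
  rewrite /verts_by map_rcons flatten_rcons E1 innN -map_flatten catA.
  by rewrite (innE (dtop K)) !map_cons map_cat.
split.
- rewrite -cats1; apply: sweep_cat sw0 _.
  rewrite eb !map_cat -(labelE A) -(labelE B) -(labelE U) -topN -labelN.
  by apply: sweep_cons; rewrite botN; exact: sweep_nil.
- rewrite rcons_uniq map_inj_uniq ?(lay_uniq L) ?andbT; last exact: lshift_inj.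
  by apply/mapP => -[c _ /eqP]; rewrite eq_rlshift.
- move=> c; rewrite mem_rcons inE; case: (splitP c) => j hj.
    apply/orP; right; have -> : c = fC j by apply: val_inj.
    by apply: map_f; apply: (lay_cells L).
  by apply/orP; left; apply/eqP; apply: ord_inj; rewrite hj /= (ord1 j).
- move=> c; case: (splitP c) => j hj.
    have -> : c = fC j by apply: val_inj.
    have [[x1 [y1 [h1 h2]]] uv] := lay_ok L j.
    rewrite /cell_ok topE botE !labelE; split=> //.
    by exists (fV x1), (fV y1); split; apply: pos_path_map.
  have -> : c = new by apply: ord_inj; rewrite hj /= (ord1 j).
  rewrite /cell_ok labelN topN labelE; split=> //.
  by exists (fV x), (fV y); split; [apply: pos_path_map|apply: pos_path_of srcN tgtN].
- by apply: pos_path_map (lay_path L).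
- by move=> /(congr1 size); rewrite size_map; case: (dtop K) (lay_ne L).
- rewrite eE cat_uniq anew_uniq map_inj_uniq ?(lay_uniqe L) ?andbT; last exact: lshift_inj.
  apply/hasPn => e /mapP[j _ ->]; apply/mapP => -[e' _ /eqP].
  by rewrite eq_rlshift.
- move=> e; rewrite eE mem_cat; case: (splitP e) => j hj.
    have -> : e = fE j by apply: val_inj.
    by rewrite map_f // (lay_edges L).
  have -> : e = rshift (nedge K) j by apply: val_inj.
  by rewrite map_f ?orbT // mem_enum.
- rewrite eV cat_uniq (map_inj_uniq (@lshift_inj _ _)) (map_inj_uniq (@rshift_inj _ _)).
  rewrite (lay_uniqv L) enum_uniq andbT andTb; exact: shift_disjoint.
- move=> e; rewrite eV mem_cat; case: (splitP e) => j hj.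
    have -> : e = fV j by apply: val_inj.
    by rewrite map_f // (lay_verts L).
  have -> : e = rshift (nvert K) j by apply: val_inj.
  by rewrite map_f ?orbT // mem_enum.
Qed.

Lemma realizable w d y : w <> [::] -> dpath P w d y ->
  exists K, realizes P K d /\ label (dtop K) = w.
Proof.
move=> wn; elim/last_ind: d y => [|d m IH] y.
  case: w wn => // x0 v _ _; exists (path_complex x0 v).
  exact: path_complex_layered.
rewrite -cats1 => /dpath_cat [z h1 /= [uv ez _]].
have [K [[cs [i [t L]]] eK]] := IH _ h1.
have lb : label (dbot K) = msrc m.
  rewrite -ez; apply: (dpath_fun (P := P) (x := w) (d := d)) => //.
  by rewrite -eK; exact: sweep_dpath (lay_ok L) (lay_sweep L).
pose A := take (size (ml m)) (dbot K).
pose U := take (size (mu m)) (drop (size (ml m)) (dbot K)).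
pose B := drop (size (mu m)) (drop (size (ml m)) (dbot K)).
have eb : dbot K = A ++ U ++ B by rewrite !cat_take_drop.
have [lA [lU lB]] : label A = ml m /\ label U = mu m /\ label B = mr m.
  rewrite /label /A /U /B !map_take !map_drop -/(label (dbot K)) lb /msrc.
  by rewrite take_size_cat // !drop_size_cat // take_size_cat.
case ev : (mv m) (move_nonempty uv).2 => [//|x0 v] _.
have [x [y' hU]] : exists x y', pos_path x U y'.
  have := lay_bot L; rewrite eb => /pos_path_cat [x _ /pos_path_cat [y' h _]].
  by exists x, y'.
have uv' : move P (label U) (x0 :: v) by rewrite lU -ev.
have [h1' h2'] := attach_cell_layered L eb hU uv'.
exists (attach_cell A U B x y' x0 v); split; last by rewrite h2'.
by move: h1'; rewrite lA lU lB -ev; case: (m).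
Qed.

End Builder.

(** * Concatenation and dipoles *)

Section Reorder.
Variables (Sg : Type) (P : presentation Sg) (K : complex Sg).
Implicit Types (c : cell K) (cs x : seq (cell K)) (p q : seq (edge K)).
Hypothesis ok : forall c, cell_ok P c.

(** The argument of [adjacent_swap] inside a figure, with edges in the role of wires. *)
Lemma cells_swap p c1 c m1 m q : sweep p [:: c1; c] [:: m1; m] q ->
  {in ctop c, forall e, e \notin cbot c1} ->
  exists m0 m1', swap [:: m1; m] [:: m0; m1'] /\
    sweep p [:: c; c1] [:: m0; m1'] q.
Proof.
move=> h dis; have [A [B [d [-> ed h2]]]] := sweep_consP h.
case: ed => -> ed; subst d.
have [A' [B' [d [E ed /sweep_nilP [e0 eq]]]]] := sweep_consP h2.
case: ed => -> ed; subst d q.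
have over : ~~ ((size A' < size A + size (cbot c1)) &&
                (size A < size A' + size (ctop c))).
  apply/negP => /andP[l1 l2]; have [] := cat_eq_overlap (esym E) _ _ l1 l2.
  - by apply/eqP; have [] := cell_ok_nonempty (ok c).
  - by apply/eqP; have [] := cell_ok_nonempty (ok c1).
  - by move=> e /dis /negP.
rewrite negb_and -!leqNgt in over; case/orP: over => le.
  have [X [eA eB]] := cat_eq_split E le; subst A' B.
  exists (Medge (label A ++ label (ctop c1) ++ label X) (label (ctop c)) (label (cbot c)) (label B')),
    (Medge (label A) (label (ctop c1)) (label (cbot c1)) (label X ++ label (cbot c) ++ label B')).
  split; first by rewrite !label_cat; exact: (@swap_step _ [::]).
  have -> : A ++ ctop c1 ++ X ++ ctop c ++ B' = (A ++ ctop c1 ++ X) ++ ctop c ++ B'.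
    by rewrite -!catA.
  rewrite -!label_cat; apply: sweep_cons.
  have -> : (A ++ ctop c1 ++ X) ++ cbot c ++ B' = A ++ ctop c1 ++ X ++ cbot c ++ B'.
    by rewrite -!catA.
  apply: sweep_cons; rewrite -!catA; exact: sweep_nil.
have [X [eA eB]] := cat_eq_split (esym E) le; subst A B'.
exists (Medge (label A') (label (ctop c)) (label (cbot c)) (label X ++ label (ctop c1) ++ label B)),
  (Medge (label A' ++ label (cbot c) ++ label X) (label (ctop c1)) (label (cbot c1)) (label B)).
split; first by rewrite !label_cat; apply: swap_sym; exact: (@swap_step _ [::]).
rewrite -!label_cat -!catA; apply: sweep_cons.
have E' Y : A' ++ cbot c ++ X ++ Y ++ B = (A' ++ cbot c ++ X) ++ Y ++ B.
  by rewrite -!catA.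
rewrite !E'; apply: sweep_cons; exact: sweep_nil.
Qed.

Lemma sweep_cons_cat p c cs d q : sweep p (c :: cs) d q -> exists m d' p1,
  [/\ d = m :: d', sweep p [:: c] [:: m] p1 & sweep p1 cs d' q].
Proof.
rewrite -cat1s => /sweep_split [d1 [d' [p1 [-> h1 h2]]]].
case: d1 h1 => [|m [|m' d1]] h1; have := sweep_size h1 => //= _.
by exists m, d', p1.
Qed.

Lemma sweep_rcons_cat p c cs d q : sweep p (rcons cs c) d q -> exists m d' p1,
  [/\ d = rcons d' m, sweep p cs d' p1 & sweep p1 [:: c] [:: m] q].
Proof.
rewrite -cats1 => /sweep_split [d' [d1 [p1 [-> h1 h2]]]].
case: d1 h2 => [|m [|m' d1]] h2; have := sweep_size h2 => //= _.
by exists m, d', p1; rewrite cats1.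
Qed.

Lemma move_right p c x d q : sweep p (c :: x) d q ->
  {in x, forall c', {in ctop c', forall e, e \notin cbot c}} ->
  exists d', swap d d' /\ sweep p (rcons x c) d' q.
Proof.
elim: x p d => [|c' x IH] p d h dis; first by exists d; split=> //; apply: swap_refl.
have [m [d1 [p1 [ed h1 h2]]]] := sweep_cons_cat h.
have [m' [d2 [p2 [ed' h3 h4]]]] := sweep_cons_cat h2; subst d d1.
have [m0 [m1 [sw h5]]] := cells_swap (sweep_cat h1 h3) (dis c' (mem_head _ _)).
have [n [e1 [p3 [en h6 h7]]]] := sweep_cons_cat h5; case: en => en1 en2; subst n e1.
have [|d' [sw' h8]] := IH _ _ (sweep_cat h7 h4).
  by move=> c1 hc1; apply: dis; rewrite inE hc1 orbT.
exists (m0 :: d'); split; last by rewrite rcons_cons -cat1s -[m0 :: d']cat1s; apply: sweep_cat h6 h8.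
apply: swap_trans (swap_cat [::] d2 sw) _.
by have := swap_cat [:: m0] [::] sw'; rewrite !cats0.
Qed.

Lemma move_left p c x d q : sweep p (rcons x c) d q ->
  {in x, forall c', {in ctop c, forall e, e \notin cbot c'}} ->
  exists d', swap d d' /\ sweep p (c :: x) d' q.
Proof.
elim/last_ind: x d q => [|x c' IH] d q h dis; first by exists d; split=> //; apply: swap_refl.
have [m [d1 [p1 [ed h1 h2]]]] := sweep_rcons_cat h.
have [m' [d2 [p2 [ed' h3 h4]]]] := sweep_rcons_cat h1; subst d d1.
have [|m0 [m1 [sw h5]]] := cells_swap (sweep_cat h4 h2).
  by apply: dis; rewrite mem_rcons mem_head.
have [n [e1 [p3 [en h6 h7]]]] := sweep_cons_cat h5; case: en => en1 en2; subst n e1.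
have [||d' [sw' h8]] := IH (rcons d2 m0) p3.
- by rewrite -!cats1; apply: sweep_cat h3 h6.
- by move=> c1 hc1; apply: dis; rewrite mem_rcons inE hc1 orbT.
exists (rcons d' m1); split.
  rewrite -!cats1 -catA /=; apply: swap_trans (swap_cat d2 [::] sw) _.
  by have := swap_cat [::] [:: m1] sw'; rewrite cats0 -!cats1 -!catA.
by rewrite -rcons_cons -!cats1; apply: sweep_cat h8 h7.
Qed.

(** Two sweeps of the same cells agree up to swaps: the first cell of one is brought to the front of
    the other, and the rest follows by induction. *)
Lemma sweep_unique p cs1 d1 q1 cs2 d2 q2 :
  sweep p cs1 d1 q1 -> sweep p cs2 d2 q2 -> perm_eq cs1 cs2 ->
  uniq (p ++ flatten [seq cbot c | c <- cs1]) -> swap d1 d2.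
Proof.
elim: cs1 p d1 cs2 d2 => [|c cs1 IH] p d1 cs2 d2 h1 h2 pm un.
  have e1 : cs2 = [::] by apply/nilP; rewrite /nilp -(perm_size pm).
  subst cs2; have [-> _] := sweep_nilP h1; have [-> _] := sweep_nilP h2.
  exact: swap_refl.
have cc : c \in cs2 by rewrite -(perm_mem pm) mem_head.
case/splitPr: cc h2 pm => x1 x2 h2 pm.
rewrite -cat_rcons in h2; have [e1 [e2 [r [ed h3 h4]]]] := sweep_split h2; subst d2.
have pm' : perm_eq cs1 (x1 ++ x2).
  by rewrite -(perm_cons c) (permPl pm) -cat1s perm_catCA.
have [A [B [d' [ep ed h5]]]] := sweep_consP h1; subst p d1.
(* The top of [c] lies on the initial front, so by uniqueness no cell before [c] can have produced
   any of its edges. *)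
have [c' hc' e he|d3 [sw h6]] := move_left h3.
  apply/negP => he'.
  have he1 : e \in flatten [seq cbot c | c <- c :: cs1].
    apply/flattenP; exists (cbot c') => //; apply: map_f.
    by rewrite inE (perm_mem pm') mem_cat hc' orbT.
  move: un; rewrite cat_uniq => /and3P[_ /hasPn/(_ e he1)].
  by rewrite /= !mem_cat he orbT.
apply: swap_sym; apply: swap_trans (swap_cat [::] e2 sw) _; rewrite cat0s.
have [A' [B' [d4 [ep ed h7]]]] := sweep_consP h6; subst d3.
have [eA eB] : A' = A /\ B' = B.
  have [n1 _] := cell_ok_nonempty (ok c).
  case E: (ctop c) n1 ep un => [//|e s] _ ep un.
  have eA : A = A'.
    by apply: uniq_pos (esym _); last (symmetry; exact: ep);
      move: un; rewrite [X in is_true X -> _]cat_uniq => /andP[].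
  subst A'; split=> //.
  by have [_ /(cat_inj_size erefl) []] := cat_inj_size (erefl (size A)) ep.
subst A' B' => /=; apply: swap_sym.
have /(swap_cat [:: Medge (label A) (label (ctop c)) (label (cbot c)) (label B)] [::]) :
    swap d' (d4 ++ e2).
  apply: (IH _ _ _ _ h5 (sweep_cat h7 h4)) => //.
  move: un; rewrite (_ : uniq _ = uniq (ctop c ++ ((A ++ cbot c ++ B) ++ flatten [seq cbot c | c <- cs1]))).
    by rewrite cat_uniq => /and3P[].
  by apply: perm_uniq; apply/permP => z; rewrite /= !count_cat; lia.
by rewrite !cats0.
Qed.

End Reorder.

Section Gluing.
Variables (Sg : Type) (P : presentation Sg).
Implicit Type K : complex Sg.

(** That new edges and vertices are distinct depends only on the set of cells, so it passes from the
    sweep given by planarity to any complete sweep. *)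
Lemma diagram_realizes K cs d : is_diagram P K -> dtop K <> [::] ->
  uniq cs -> (forall c, c \in cs) -> sweep (dtop K) cs d (dbot K) -> realizes P K d.
Proof.
move=> hK ne us all sw; have [d0 [cs0 [i [t L]]]] := is_diagram_layered hK ne.
exists cs, i, t; apply: (layered_perm L _ sw).
by apply: uniq_perm => //; [apply: lay_uniq L|move=> c; rewrite all (lay_cells L)].
Qed.

Lemma realizes_same K d d' : realizes P K d -> realizes P K d' -> swap d d'.
Proof.
move=> [cs [i [t L]]] [cs' [i' [t' L']]].
apply: (sweep_unique (lay_ok L) (lay_sweep L) (lay_sweep L')).
  apply: uniq_perm; [exact: lay_uniq L|exact: lay_uniq L'|].
  by move=> c; rewrite (lay_cells L) (lay_cells L').
exact: lay_uniqe L.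
Qed.

Lemma map_label K K' (fE : edge K -> edge K') s :
  (forall e, lab (fE e) = lab e) -> label (map fE s) = label s.
Proof. by move=> h; rewrite /label -map_comp; apply: eq_map. Qed.

Lemma concatenation_realizes K1 K2 K d1 d2 : concatenation K1 K2 K ->
  is_diagram P K -> realizes P K1 d1 -> realizes P K2 d2 ->
  realizes P K (d1 ++ d2) /\
  label (dtop K) = label (dtop K1) /\ label (dbot K) = label (dbot K2).
Proof.
move=> [f1V [f1E [f1C [f2V [f2E [f2C [[p1 p2] [i1 i2] [_ _ cov] [e1 e2 e3] [_ _ dis]]]]]]]].
move=> hK [cs1 [i [t L1]]] [cs2 [i' [t' L2]]].
case: p1 => s1 t1 l1 ct1 cb1; case: p2 => s2 t2 l2 ct2 cb2.
split; last by rewrite e1 e3 !map_label.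
have [_ _ c1i] := i1; have [_ _ c2i] := i2.
apply: (@diagram_realizes _ (map f1C cs1 ++ map f2C cs2)) => //.
- by rewrite e1 => /(congr1 size); rewrite size_map; case: (dtop K1) (lay_ne L1).
- rewrite cat_uniq !map_inj_uniq // (lay_uniq L1) (lay_uniq L2) andbT /=.
  by apply/hasPn => _ /mapP[c _ ->]; apply/mapP => -[b _ e]; apply: (dis b c).
- move=> c; rewrite mem_cat.
  case: (cov c) => -[b ->]; apply/orP; [left|right]; apply: map_f.
    exact: (lay_cells L1).
  exact: (lay_cells L2).
- rewrite e1 e3; apply: sweep_cat (sweep_map l1 ct1 cb1 (lay_sweep L1)) _.
  by rewrite e2; apply: sweep_map l2 ct2 cb2 (lay_sweep L2).
Qed.

End Gluing.

Section Concatenation.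
Variables (Sg : Type) (P : presentation Sg).

Lemma good_preserves K K' fV fE fC (cs : seq (cell K)) (cs' : seq (cell K')) :
  (forall e, @good Sg K K' fV fE e) -> (forall c, c \in cs) -> map fC cs = cs' ->
  [seq map fE (ctop c) | c <- cs] = [seq ctop c | c <- cs'] ->
  [seq map fE (cbot c) | c <- cs] = [seq cbot c | c <- cs'] ->
  preserves fV fE fC.
Proof.
move=> g all <- e1 e2; split; try by move=> e; case: (g e).
  by move=> c; rewrite (map_zip_cells e1 (all c)).
by move=> c; rewrite (map_zip_cells e2 (all c)).
Qed.

Lemma layered_good K K' (fV : vert K -> vert K') (fE : edge K -> edge K')
    cs d i t p' cs' q' x' y' :
  layered P cs d i t -> (forall c : cell K', cell_ok P c) ->
  sweep p' cs' d q' -> map fE (dtop K) = p' -> label (dtop K) = label p' ->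
  pos_path x' p' y' -> fV i = x' -> fV t = y' ->
  map fV (inner (dtop K)) = inner p' ->
  map fE (flatten [seq cbot c | c <- cs]) = flatten [seq cbot c | c <- cs'] ->
  map fV (flatten [seq inner (cbot c) | c <- cs]) =
    flatten [seq inner (cbot c) | c <- cs'] ->
  [/\ forall e, good fV fE e, map fE (dbot K) = q',
      [seq map fE (ctop c) | c <- cs] = [seq ctop c | c <- cs']
    & [seq map fE (cbot c) | c <- cs] = [seq cbot c | c <- cs']].
Proof.
move=> L ok' sw' ep el hp ei et eI eE eV.
have gT : forall e, e \in dtop K -> good fV fE e.
  by apply: (good_path (lay_path L)); rewrite ep ?ei ?et.
have [e1 gE _ e2 e3] := sweep_transport (lay_ok L) ok' (lay_sweep L) sw' ep gT eE eV.
split=> // e; have := lay_edges L e; rewrite mem_cat => /orP[/gT|/gE] //.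
Qed.

(** The front [q] reached after [d1] cuts [K] into two halves, each matched with its factor by order
    of creation. *)
Lemma realizes_concatenation K1 K2 K d1 d2 :
  realizes P K1 d1 -> realizes P K2 d2 -> realizes P K (d1 ++ d2) ->
  label (dtop K) = label (dtop K1) -> label (dbot K1) = label (dtop K2) ->
  concatenation K1 K2 K.
Proof.
move=> [cs1 [i1 [t1 L1]]] [cs2 [i2 [t2 L2]]] [cs [i [t L]]] el el2.
have [z1 [z2 [q [ecs sw1 sw2]]]] := sweep_splitd (lay_sweep L); subst cs.
have ok := lay_ok L.
have lq : label q = label (dtop K2).
  rewrite -el2; apply: (dpath_fun (P := P) (x := label (dtop K)) (d := d1)).
    exact: sweep_dpath ok sw1.
  rewrite el; exact: sweep_dpath (lay_ok L1) (lay_sweep L1).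
have [sE1 sV1] := sweep_same_size (lay_sweep L1) sw1.
have [sE2 sV2] := sweep_same_size (lay_sweep L2) sw2.
have sz1 := sweep_size (lay_sweep L1); have sz2 := sweep_size (lay_sweep L2).
rewrite -(sweep_size sw1) in sz1; rewrite -(sweep_size sw2) in sz2.
have sT1 := label_eq_size el; have sT2 := label_eq_size lq.
pose bE z := flatten [seq cbot c | c : cell K <- z].
pose bV z := flatten [seq inner (cbot c) | c : cell K <- z].
have ue := lay_uniqe L; have uv := lay_uniqv L.
(* Counted from the front [q] instead of the top path, the edges of the lower half are again
   distinct; likewise for vertices below. *)
have pe : perm_eq (edges_by (z1 ++ z2)) ((q ++ bE z2) ++ flatten [seq ctop c | c <- z1]).
  rewrite /edges_by map_cat flatten_cat catA.
  have /permP p := sweep_perm sw1; apply/permP => a; have := p a.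
  by rewrite /bE !count_cat; lia.
have pv : perm_eq (verts_by i t (z1 ++ z2))
    ((i :: t :: inner q ++ bV z2) ++ flatten [seq inner (ctop c) | c <- z1]).
  rewrite /verts_by map_cat flatten_cat catA.
  have /permP p := sweep_inner_perm ok sw1; apply/permP => a; have := p a.
  by rewrite /bV /= !count_cat => h; congr (_ + (_ + _)); move: h; lia.
have uq : uniq (q ++ bE z2).
  by move: ue; rewrite (perm_uniq pe) cat_uniq => /andP[].
have uqv : uniq (i :: t :: inner q ++ bV z2).
  by move: uv; rewrite (perm_uniq pv) cat_uniq => /andP[].
have ue1 : uniq (edges_by z1).
  by move: ue; rewrite /edges_by map_cat flatten_cat catA cat_uniq => /andP[].
have uv1 : uniq (verts_by i t z1).
  by move: uv; rewrite /verts_by map_cat flatten_cat catA -!cat_cons cat_uniq => /andP[].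
have [f1E h1E] : exists f, map f (edges_by cs1) = edges_by z1.
  by apply: list_map (lay_uniqe L1) _ (lay_edges L1); rewrite !size_cat sE1 sT1.
have [f1V h1V] : exists f, map f (verts_by i1 t1 cs1) = verts_by i t z1.
  apply: list_map (lay_uniqv L1) _ (lay_verts L1).
  by rewrite /= !size_cat sV1 !size_inner sT1.
have [f2E h2E] : exists f, map f (edges_by cs2) = q ++ bE z2.
  by apply: list_map (lay_uniqe L2) _ (lay_edges L2); rewrite !size_cat sE2 sT2.
have [f2V h2V] : exists f, map f (verts_by i2 t2 cs2) = i :: t :: inner q ++ bV z2.
  apply: list_map (lay_uniqv L2) _ (lay_verts L2).
  by rewrite /= !size_cat sV2 !size_inner sT2.
have [f1C h1C] := list_map (lay_uniq L1) sz1 (lay_cells L1).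
have [f2C h2C] := list_map (lay_uniq L2) sz2 (lay_cells L2).
have sI1 : size (inner (dtop K1)) = size (inner (dtop K)) by rewrite !size_inner sT1.
have sI2 : size (inner (dtop K2)) = size (inner q) by rewrite !size_inner sT2.
have [a1 a2] := map_cat_eq (esym sT1) h1E.
have [b1 b2 b3] : [/\ f1V i1 = i, f1V t1 = t & map f1V (inner (dtop K1) ++
    flatten [seq inner (cbot c) | c <- cs1]) = inner (dtop K) ++ bV z1].
  by case: h1V => -> -> ->.
have [b4 b5] := map_cat_eq sI1 b3.
have [a1' a2'] := map_cat_eq (esym sT2) h2E.
have [b1' b2' b3'] : [/\ f2V i2 = i, f2V t2 = t & map f2V (inner (dtop K2) ++
    flatten [seq inner (cbot c) | c <- cs2]) = inner q ++ bV z2].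
  by case: h2V => -> -> ->.
have [b4' b5'] := map_cat_eq sI2 b3'.
have hq : pos_path i q t by rewrite -(sweep_pos_path i t ok sw1); apply: lay_path L.
have [g1 e1 ct1 cb1] := layered_good L1 ok sw1 a1 (esym el) (lay_path L) b1 b2 b4 a2 b5.
have [g2 e2 ct2 cb2] := layered_good L2 ok sw2 a1' (esym lq) hq b1' b2' b4' a2' b5'.
have i1E : injective f1E.
  by move=> x y; apply: (map_injective (l := edges_by cs1)); rewrite ?h1E //; apply: (lay_edges L1).
have i1V : injective f1V.
  by move=> x y; apply: (map_injective (l := verts_by i1 t1 cs1)); rewrite ?h1V //; apply: (lay_verts L1).
have i2E : injective f2E.
  by move=> x y; apply: (map_injective (l := edges_by cs2)); rewrite ?h2E //; apply: (lay_edges L2).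
have i2V : injective f2V.
  by move=> x y; apply: (map_injective (l := verts_by i2 t2 cs2)); rewrite ?h2V //; apply: (lay_verts L2).
have uz := lay_uniq L; rewrite cat_uniq in uz; case/and3P: uz => uz1 /hasPn dz uz2.
have i1C : injective f1C.
  by move=> x y; apply: (map_injective (l := cs1)); rewrite ?h1C //; apply: (lay_cells L1).
have i2C : injective f2C.
  by move=> x y; apply: (map_injective (l := cs2)); rewrite ?h2C //; apply: (lay_cells L2).
(* What the lower half creates is new, so anything common to both halves must lie on [q]. *)
have dE e : e \in edges_by z1 -> e \notin bE z2.
  move: ue; rewrite /edges_by map_cat flatten_cat catA cat_uniq => /and3P[_ /hasPn h _] he.
  by apply/negP => /h /negP; apply.
have dV x : x \in verts_by i t z1 -> x \notin bV z2.
  move: uv; rewrite /verts_by map_cat flatten_cat catA -!cat_cons cat_uniq => /and3P[_ /hasPn h _] hx.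
  by apply/negP => /h /negP; apply.
exists f1V, f1E, f1C, f2V, f2E, f2C; split.
- split; first exact: good_preserves g1 (lay_cells L1) h1C ct1 cb1.
  exact: good_preserves g2 (lay_cells L2) h2C ct2 cb2.
- by [].
- split.
  + move=> x; have := lay_verts L x.
    rewrite /verts_by map_cat flatten_cat catA -!cat_cons mem_cat => /orP[].
      by rewrite -[X in _ \in X]h1V => /mapP[y _ ->]; left; exists y.
    by rewrite -/(bV z2) -b5' => /mapP[y _ ->]; right; exists y.
  + move=> x; have := lay_edges L x.
    rewrite /edges_by map_cat flatten_cat catA mem_cat => /orP[].
      by rewrite -[X in _ \in X]h1E => /mapP[y _ ->]; left; exists y.
    by rewrite -/(bE z2) -a2' => /mapP[y _ ->]; right; exists y.
  + move=> x; have := lay_cells L x; rewrite mem_cat -h1C -h2C.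
    by case/orP=> /mapP[y _ ->]; [left|right]; exists y.
- by rewrite a1 e1 a1' e2.
- split.
  + move=> x y exy.
    have hx : f1V x \in verts_by i t z1 by rewrite -h1V map_f // (lay_verts L1).
    have : f1V x \in i :: t :: inner q ++ bV z2 by rewrite exy -h2V map_f // (lay_verts L2).
    rewrite -!cat_cons mem_cat (negPf (dV _ hx)) orbF !inE => /or3P[/eqP ex|/eqP ex|].
    * have -> : x = i1 by apply: i1V; rewrite ex b1.
      have := lay_bot L1; case: (dbot K1) (lay_botne L1) => // e s _ /pos_path_src <-.
      by exists e; [apply: mem_head|left].
    * have -> : x = t1 by apply: i1V; rewrite ex b2.
      have := lay_bot L1; case/lastP: (dbot K1) (lay_botne L1) => // s e _ /pos_path_tgt <-.
      by exists e; [rewrite mem_rcons mem_head|right].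
    * case/mapP=> e /mem_behead; rewrite -e1 => /mapP[e' he' ->] ex.
      exists e' => //; left; apply: i1V; rewrite ex.
      by have [-> _ _] := g1 e'.
  + move=> x y exy.
    have hx : f1E x \in edges_by z1 by rewrite -h1E map_f // (lay_edges L1).
    have : f1E x \in q ++ bE z2 by rewrite exy -h2E map_f // (lay_edges L2).
    rewrite mem_cat (negPf (dE _ hx)) orbF -e1 => /mapP[e' he'].
    by move/i1E ->.
  + move=> b c ebc; have := dz (f2C c); rewrite -h2C map_f; last exact: (lay_cells L2).
    by rewrite /= -ebc -h1C map_f ?(lay_cells L1) // => /(_ isT).
Qed.

End Concatenation.

(** * Dipoles and cancelling pairs *)

Section Dipoles.
Variables (Sg : Type) (P : presentation Sg) (K : complex Sg).
Implicit Types (c : cell K) (A B : seq (edge K)).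

Definition dipole_move A B c := Medge (label A) (label (ctop c)) (label (cbot c)) (label B).

Definition dipole_sweep c1 c2 z1 z2 A B d1 d2 i t :=
  [/\ dipole c1 c2,
      layered P (z1 ++ [:: c2; c1] ++ z2)
        (d1 ++ [:: dipole_move A B c2; minv (dipole_move A B c2)] ++ d2) i t,
      sweep (dtop K) z1 d1 (A ++ ctop c2 ++ B)
    & sweep (A ++ cbot c1 ++ B) z2 d2 (dbot K)].

Lemma frontier_uniq cs d i t z1 d1 p z2 : layered P cs d i t ->
  perm_eq (z1 ++ z2) cs -> sweep (dtop K) z1 d1 p ->
  uniq (p ++ flatten [seq cbot c | c <- z2]).
Proof.
move=> L pz sw; have := lay_uniqe L.
have pe : perm_eq (edges_by cs)
    ((p ++ flatten [seq cbot c | c <- z2]) ++ flatten [seq ctop c | c <- z1]).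
  apply: (@perm_trans _ (edges_by (z1 ++ z2))).
    by rewrite perm_cat2l perm_sym; apply: perm_flatten_map.
  rewrite /edges_by map_cat flatten_cat catA.
  have /permP q := sweep_perm sw; apply/permP => a; have := q a.
  by rewrite !count_cat; lia.
by rewrite (perm_uniq pe) cat_uniq => /andP[].
Qed.

(** [c2] produces what [c1] consumes, and no cell between them touches these edges, so [c2] can be
    delayed until it directly precedes [c1]. *)
Lemma dipole_sweep_ex d c1 c2 : realizes P K d -> dipole c1 c2 ->
  exists z1 z2 A B d1 d2 i t, dipole_sweep c1 c2 z1 z2 A B d1 d2 i t /\
    swap d (d1 ++ [:: dipole_move A B c2; minv (dipole_move A B c2)] ++ d2).
Proof.
move=> [cs [i [t L]]] dip; have [e1 e2] := dip; have ok := lay_ok L.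
have ne : c1 != c2.
  apply/eqP => ec; subst c2; have [_ uv] := ok c1.
  by apply: (move_neq uv); rewrite -e2.
have := lay_cells L c2; have := lay_uniq L; have := lay_sweep L.
move=> sw un hc2; case/splitPr: hc2 L sw un => x1 x2 L sw un.
have [n1 _] := cell_ok_nonempty (ok c1).
have [e [he _]] : exists e, e \in ctop c1 /\ True.
  by case: (ctop c1) n1 => // e s _; exists e; rewrite mem_head.
have [da [db [p [ed sw1 sw2]]]] := sweep_split sw.
(* Swept before [c2], the cell [c1] would consume edges that only [c2] creates. *)
have hx1 : c1 \notin x1.
  apply/negP => h; have := lay_uniqe L.
  have : e \in flatten [seq ctop c | c <- x1] by apply/flattenP; exists (ctop c1) => //; apply: map_f.
  move=> h1; have : e \in dtop K ++ flatten [seq cbot c | c <- x1].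
    by rewrite (perm_mem (sweep_perm sw1)) mem_cat h1 orbT.
  move=> h2; rewrite /edges_by map_cat flatten_cat catA cat_uniq => /and3P[_ /hasPn h3 _].
  have : e \in flatten [seq cbot c | c <- c2 :: x2] by rewrite /= mem_cat -e1 he.
  by move/h3; rewrite /= h2.
have hc1 : c1 \in x2.
  by have := lay_cells L c1; rewrite mem_cat inE (negPf hx1) (negPf ne).
case/splitPr: hc1 L sw2 un {sw} => x3 x4 L sw2 un.
rewrite -cat_cons in sw2; have [dc [dd [p2 [ed2 sw3 sw4]]]] := sweep_split sw2; subst db d.
have hx3 : c1 \notin x3.
  move: un; rewrite cat_uniq => /and3P[_ _] /=; rewrite cat_uniq.
  by case/and4P=> _ _ /hasPn/(_ c1 (mem_head _ _)).
have topU e' c' : e' \in ctop c' -> e' \in ctop c1 -> c' = c1.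
  by move=> h h'; have := @ftop_unique _ K (lay_count L) e' (Some c') (Some c1) h h' => -[].
have [|dc' [swc sw5]] := move_right ok sw3.
  move=> c' hc' e' he'; apply/negP; rewrite -e1 => he1.
  by move: hx3; rewrite -(topU _ _ he' he1) hc'.
have [m [d1 [p3 [ed sw6 sw7]]]] := sweep_rcons_cat sw5; subst dc'.
have [A [B [d0 [ep3 [em ed0] /sweep_nilP [_ ep2]]]]] := sweep_consP sw7; subst m d0 p3.
have [A' [B' [d2 [ep2' edd sw8]]]] := sweep_consP sw4; subst dd.
have up2 : uniq p2.
  have := @frontier_uniq _ _ _ _ (x1 ++ c2 :: x3) (da ++ dc) p2 (c1 :: x4) L.
  rewrite -catA; move=> /(_ (perm_refl _) (sweep_cat sw1 sw3)).
  by rewrite cat_uniq => /andP[].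
have [eA eB] : A = A' /\ B = B'.
  move: up2 ep2 ep2'; rewrite -e1; case: (ctop c1) n1 => // e0 s _ up2 ep2 ep2'.
  have eA : A = A' by apply: uniq_pos; [rewrite -ep2 in up2; exact: up2|rewrite ep2 ep2'].
  subst A'; split=> //; rewrite -ep2 in ep2'.
  have [_ ee] := cat_inj_size (erefl (size A)) ep2'.
  by have [] := cat_inj_size (erefl (size (e0 :: s))) ee.
subst A' B'; set M := dipole_move A B c2.
have eM : Medge (label A) (label (ctop c1)) (label (cbot c1)) (label B) = minv M.
  by rewrite e1 e2.
rewrite eM in sw4.
have sws : swap (da ++ dc ++ minv M :: d2) ((da ++ d1) ++ [:: M; minv M] ++ d2).
  have := swap_cat da (minv M :: d2) swc.
  by rewrite -cats1 -!catA.
have s1 : sweep (dtop K) (x1 ++ x3) (da ++ d1) (A ++ ctop c2 ++ B).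
  exact: sweep_cat sw1 sw6.
exists (x1 ++ x3), x4, A, B, (da ++ d1), d2, i, t; split; last by rewrite eM.
split=> //.
apply: (layered_perm L).
  by apply/permP => a; rewrite !count_cat /= !count_cat /=; lia.
apply: sweep_cat s1 _.
have := sweep_cat sw7 sw4; rewrite /=; by [].
Qed.

Lemma realizes_dipole_sweep d1 m d2 : realizes P K (d1 ++ [:: m; minv m] ++ d2) ->
  exists c1 c2 z1 z2 A B i t, dipole_sweep c1 c2 z1 z2 A B d1 d2 i t /\
    m = dipole_move A B c2.
Proof.
move=> [cs [i [t L]]].
have [z1 [z3 [p [ecs sw1 sw2]]]] := sweep_splitd (lay_sweep L); subst cs.
have [z4 [z2 [p2 [ecs sw3 sw4]]]] := sweep_splitd sw2; subst z3.
case: z4 L sw2 sw3 => [|c2 [|c1 [|c0 z4]]] L sw2 sw3; have := sweep_size sw3 => //= _.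
have [A [B [d0 [ep [em ed] sw5]]]] := sweep_consP sw3; subst p d0 m.
have [A' [B' [d0 [ep [eA et eb eB ed] /sweep_nilP [_ ep2]]]]] := sweep_consP sw5.
subst p2 d0.
have [eA' ep'] := cat_inj_size (label_eq_size eA) ep; subst A'.
have [et' eB'] := cat_inj_size (label_eq_size et) ep'; subst B'.
by exists c1, c2, z1, z2, A, B, i, t; do 2 split.
Qed.

End Dipoles.

Lemma zip_map_mem (T T' : eqType) (f : T -> T') (s s' : seq T) e :
  map f s = map f s' -> e \in s' -> exists d, [/\ d \in s, (d, e) \in zip s s' & f d = f e].
Proof.
elim: s s' => [|x s IH] [|x' s'] //= [h1 h2]; rewrite inE => /orP[/eqP ->|he].
  by exists x; rewrite !mem_head.
by have [d [m1 m2 m3]] := IH _ h2 he; exists d; rewrite !inE m1 m2 !orbT.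
Qed.

Lemma mem_zip_behead (T : eqType) (s s' : seq T) z :
  z \in zip (behead s) (behead s') -> z \in zip s s'.
Proof.
case: s => [|x s]; case: s' => [|x' s'] //=.
- by case: s'.
- by case: s.
- by move=> h; rewrite inE h orbT.
Qed.

Lemma subseq_behead_mid (T : eqType) (a s b : seq T) :
  subseq (behead s) (behead (a ++ s ++ b)).
Proof.
case: a => [|x a] /=.
  by case: s => [|x s] /=; [apply: sub0seq|apply: prefix_subseq].
have h : subseq (behead s) s by case: (s) => [|y s'] //=; apply: subseq_cons.
apply: subseq_trans h _; apply: subseq_trans (suffix_subseq a _).
exact: prefix_subseq.
Qed.

Lemma mem_cat3 (T : eqType) (x : T) a b c :
  x \in a ++ b ++ c -> x \in a ++ c \/ x \in b.
Proof. by rewrite !mem_cat => /or3P[->|->|->]; rewrite ?orbT; auto. Qed.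

Lemma mem_cat_mid (T : eqType) (x : T) a b c : x \in a ++ c -> x \in a ++ b ++ c.
Proof. by rewrite !mem_cat => /orP[->|->]; rewrite ?orbT. Qed.

Lemma perm_insert2 (T : eqType) (s : seq T) x y s' :
  perm_eq (s ++ [:: x; y] ++ s') (y :: x :: s ++ s').
Proof. by apply/permP => a; rewrite /= !count_cat /=; lia. Qed.

(** * Removing a dipole *)

Section Removal.
Variables (Sg : Type) (P : presentation Sg).

Lemma pos_path_ends (K : complex Sg) (x y x' y' : vert K) s : s <> [::] ->
  pos_path x s y -> pos_path x' s y' -> x = x' /\ y = y'.
Proof.
move=> n h h'; split.
  by case: s n h h' => // e s _ /pos_path_src <- /pos_path_src <-.
by case/lastP: s n h h' => // s e _ /pos_path_tgt <- /pos_path_tgt <-.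
Qed.

(** [fE] is meaningful on kept edges only, so the fronts must be shown to avoid the removed ones. *)
Lemma sweep_image (K K' : complex Sg) (fE : edge K -> edge K')
    (gC : cell K' -> cell K) (kept : edge K -> Prop) p cs' d q :
  (forall c, ctop c = map fE (ctop (gC c))) ->
  (forall c, cbot c = map fE (cbot (gC c))) ->
  (forall e, kept e -> lab (fE e) = lab e) ->
  sweep p (map gC cs') d q ->
  (forall e, e \in p ++ flatten [seq cbot c | c <- map gC cs'] -> kept e) ->
  sweep (map fE p) cs' d (map fE q) /\ forall e, e \in q -> kept e.
Proof.
move=> ht hb hl; elim: cs' p d => [|c cs' IH] p d h hk.
  have [-> <-] := sweep_nilP h; split; first exact: sweep_nil.
  by move=> e he; apply: hk; rewrite mem_cat he.
have [A [B [d' [ep ed sw]]]] := sweep_consP h; subst p d.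
have lE s : (forall e, e \in s -> kept e) -> label (map fE s) = label s.
  move=> ks; rewrite /label -map_comp; apply/eq_in_map => e he /=.
  by apply: hl; apply: ks.
have kA : label (map fE A) = label A.
  by apply: lE => e he; apply: hk; rewrite !mem_cat he.
have kT : label (map fE (ctop (gC c))) = label (ctop (gC c)).
  by apply: lE => e he; apply: hk; rewrite !mem_cat he ?orbT.
have kB : label (map fE B) = label B.
  by apply: lE => e he; apply: hk; rewrite !mem_cat he ?orbT.
have kb : label (map fE (cbot (gC c))) = label (cbot (gC c)).
  by apply: lE => e he; apply: hk; rewrite /= !mem_cat he ?orbT.
have [e he|sw' hq] := IH _ _ sw; last first.
  split=> //; rewrite !map_cat -ht -kA -kT -kB -kb -ht -hb.
  by apply: sweep_cons; move: sw'; rewrite !map_cat -hb.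
apply: hk; move: he; rewrite /= !mem_cat.
by case/orP=> [/or3P[->|->|->]|->]; rewrite ?orbT.
Qed.

(** The removed path appears only when [c2] is crossed and vanishes with [c1]. The sweeps before and
    after the pair therefore survive, and the identification of the two outer paths joins them. *)
Lemma dipole_removal_realizes (K K' : complex Sg) c1 c2 z1 z2 A B d1 d2 i t :
  @dipole_sweep _ P K c1 c2 z1 z2 A B d1 d2 i t -> dipole_removal c1 c2 K' ->
  is_diagram P K' -> realizes P K' (d1 ++ d2) /\
  label (dtop K') = label (dtop K) /\ label (dbot K') = label (dbot K).
Proof.
move=> [dip L sw1 sw2] [fV [fE [gC [[hs ht hl hct hcb] [et eb] [_ _ hk] eT [_ _ gi]]]]] hK.
have [e1 e2] := dip.
have un := lay_uniqe L; have uz := lay_uniq L.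
have keptz c : c \in z1 ++ z2 -> exists c', c = gC c'.
  move=> hc; apply/hk; split=> ec; move: uz hc; rewrite -ec => {ec}.
    rewrite cat_uniq => /and3P[_ /hasPn h /= /and3P[_ h2 _]].
    have := h c; rewrite !inE eqxx orbT => /(_ isT) /= /negPf.
    by rewrite mem_cat => ->; rewrite (negPf h2).
  rewrite cat_uniq => /and3P[_ /hasPn h /= /and3P[h2 _ _]].
  have := h c; rewrite !inE eqxx => /(_ isT) /= /negPf.
  by rewrite mem_cat => ->; move: h2; rewrite inE negb_or => /andP[_ /negPf ->].
have lift z : {subset z <= z1 ++ z2} -> exists z', map gC z' = z.
  elim: z => [|c z IH] sub; first by exists [::].
  have [c' ec] := keptz c (sub c (mem_head _ _)).
  have [|z' ez] := IH; first by move=> x hx; apply: sub; rewrite inE hx orbT.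
  by exists (c' :: z'); rewrite /= ec ez.
have [z1' ez1] : exists z', map gC z' = z1 by apply: lift => x hx; rewrite mem_cat hx.
have [z2' ez2] : exists z', map gC z' = z2 by apply: lift => x hx; rewrite mem_cat hx orbT.
have u1 : uniq ((A ++ ctop c2 ++ B) ++ flatten [seq cbot c | c <- [:: c2; c1] ++ z2]).
  exact: frontier_uniq L (perm_refl _) sw1.
have swm : sweep (A ++ ctop c2 ++ B) [:: c2] [:: dipole_move A B c2] (A ++ cbot c2 ++ B).
  by apply: sweep_cons; apply: sweep_nil.
have u2 : uniq ((A ++ cbot c2 ++ B) ++ flatten [seq cbot c | c <- c1 :: z2]).
  apply: (frontier_uniq (z1 := z1 ++ [:: c2]) L _ (sweep_cat sw1 swm)).
  by rewrite -catA.
pose kept e := e \notin ctop c1.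
have k1 e : e \in dtop K ++ flatten [seq cbot c | c <- map gC z1'] -> kept e.
  rewrite ez1 => he; rewrite /kept e1; apply/negP => he'.
  move: un; rewrite /edges_by map_cat flatten_cat catA cat_uniq => /and3P[_ /hasPn h _].
  by have := h e; rewrite /= mem_cat he' he => /(_ isT).
have k2 e : e \in (A ++ cbot c1 ++ B) ++ flatten [seq cbot c | c <- map gC z2'] -> kept e.
  rewrite ez2 => he; rewrite /kept e1; apply/negP => he'.
  have p : perm_eq ((A ++ cbot c2 ++ B) ++ flatten [seq cbot c | c <- c1 :: z2])
     (cbot c2 ++ (A ++ cbot c1 ++ B) ++ flatten [seq cbot c | c <- z2]).
    by apply/permP => a; rewrite /= !count_cat; lia.
  move: u2; rewrite (perm_uniq p) cat_uniq => /and3P[_ /hasPn h _].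
  by have := h _ he; rewrite /= he'.
rewrite -ez1 in sw1; rewrite -ez2 in sw2.
have [sw1' kq1] := sweep_image hct hcb hl sw1 k1.
have [sw2' kq2] := sweep_image hct hcb hl sw2 k2.
split; last first.
  rewrite et eb; split; rewrite /label -map_comp; apply/eq_in_map => e he /=; apply: hl.
    by apply: k1; rewrite mem_cat he.
  exact: kq2.
apply: (@diagram_realizes _ _ _ (z1' ++ z2')) => //.
- by rewrite et => /(congr1 size); rewrite size_map; case: (dtop K) (lay_ne L).
- rewrite -(map_inj_uniq gi) map_cat ez1 ez2.
  have : subseq (z1 ++ z2) (z1 ++ [:: c2; c1] ++ z2).
    by apply: cat_subseq => //; apply: (suffix_subseq [:: c2; c1]).
  by move/subseq_uniq; apply.
- move=> c; rewrite -(mem_map gi) map_cat ez1 ez2.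
  have [nc1 nc2] : gC c <> c1 /\ gC c <> c2 by apply/hk; exists c.
  have := lay_cells L (gC c); rewrite !mem_cat !inE.
  by move/eqP/negPf: nc1 => ->; move/eqP/negPf: nc2 => ->.
- rewrite et eb; apply: sweep_cat sw1' _.
  by move: sw2'; rewrite !map_cat eT.
Qed.

(** [LE] and [LV] omit the path to be removed. [LE'] and [LV'] list the segment [X'] twice, as the
    image of [ctop c2] and of [cbot c1]: this repetition is the identification required of a
    removal. *)
Lemma realizes_dipole_removal (K K' : complex Sg) c1 c2 z1 z2 A B d1 d2 i t :
  @dipole_sweep _ P K c1 c2 z1 z2 A B d1 d2 i t -> realizes P K' (d1 ++ d2) ->
  label (dtop K') = label (dtop K) -> dipole_removal c1 c2 K'.
Proof.
move=> [dip L sw1 sw2] [cs' [i' [t' L']]] el; have [e1 e2] := dip.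
have ok := lay_ok L; have ok' := lay_ok L'.
have [z1' [z2' [p' [ecs sw1' sw2']]]] := sweep_splitd (lay_sweep L'); subst cs'.
have lp : label p' = label (A ++ ctop c2 ++ B).
  apply: (dpath_fun (P := P) (x := label (dtop K)) (d := d1)).
    by rewrite -el; exact: sweep_dpath ok' sw1'.
  exact: sweep_dpath ok sw1.
have sp := label_eq_size lp.
pose A' := take (size A) p'.
pose X' := take (size (ctop c2)) (drop (size A) p').
pose B' := drop (size (ctop c2)) (drop (size A) p').
have ep' : p' = A' ++ X' ++ B' by rewrite !cat_take_drop.
have sA : size A = size A' by rewrite size_takel // sp size_cat leq_addr.
have sX : size (ctop c2) = size X'.
  by rewrite size_takel // size_drop sp !size_cat addKn leq_addr.
have sb : size (cbot c1) = size X' by rewrite (label_eq_size e2).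
have [sE1 sV1] := sweep_same_size sw1 sw1'.
have [sE2 sV2] := sweep_same_size sw2 sw2'.
have sT := label_eq_size el.
pose LE := (dtop K ++ flatten [seq cbot c | c <- z1]) ++
  cbot c1 ++ flatten [seq cbot c | c <- z2].
pose LV := (i :: t :: inner (dtop K) ++ flatten [seq inner (cbot c) | c <- z1]) ++
  inner (cbot c1) ++ flatten [seq inner (cbot c) | c <- z2].
pose LE' := (dtop K' ++ flatten [seq cbot c | c <- z1']) ++
  X' ++ flatten [seq cbot c | c <- z2'].
pose LV' := (i' :: t' :: inner (dtop K') ++ flatten [seq inner (cbot c) | c <- z1']) ++
  inner X' ++ flatten [seq inner (cbot c) | c <- z2'].
have pE : perm_eq (edges_by (z1 ++ [:: c2; c1] ++ z2)) (LE ++ cbot c2).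
  rewrite /edges_by /LE !map_cat !flatten_cat /=; apply/permP => a.
  by rewrite !count_cat /=; lia.
have pV : perm_eq (verts_by i t (z1 ++ [:: c2; c1] ++ z2)) (LV ++ inner (cbot c2)).
  rewrite /verts_by /LV !map_cat !flatten_cat /=; apply/permP => a.
  by rewrite /= !count_cat /=; congr (_ + (_ + _)); lia.
have uE := lay_uniqe L; rewrite (perm_uniq pE) cat_uniq in uE.
case/and3P: uE => uLE /hasPn disE _.
have uV := lay_uniqv L; rewrite (perm_uniq pV) cat_uniq in uV.
case/and3P: uV => uLV /hasPn disV _.
(* A default edge is needed as image of the removed edges, which [LE] does not list. *)
have [y0 _] : exists y0 : edge K', True by case: (dtop K') (lay_ne L') => // y0; exists y0.
have [fE hE] : exists f, map f LE = LE'.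
  by apply: (list_map_default y0) => //; rewrite !size_cat sT sE1 sE2 sb.
have [fV hV] : exists f, map f LV = LV'.
  apply: (list_map_default i') => //.
  by rewrite /= !size_cat !size_inner sT sV1 sV2 sb.
have uz' := lay_uniq L'.
have [gC hC] : exists f, map f (z1' ++ z2') = z1 ++ z2.
  apply: list_map uz' _ (lay_cells L'); rewrite !size_cat.
  by rewrite (sweep_size sw1) (sweep_size sw2) (sweep_size sw1') (sweep_size sw2').
have [gC1 gC2] : map gC z1' = z1 /\ map gC z2' = z2.
  by apply: map_cat_eq hC; rewrite (sweep_size sw1) (sweep_size sw1').
have [hE1 hE2] : map fE (dtop K ++ flatten [seq cbot c | c <- z1]) =
    dtop K' ++ flatten [seq cbot c | c <- z1'] /\
    map fE (cbot c1 ++ flatten [seq cbot c | c <- z2]) =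
    X' ++ flatten [seq cbot c | c <- z2'].
  by apply: map_cat_eq hE; rewrite !size_cat sT sE1.
have [hT hb1] := map_cat_eq (esym sT) hE1.
have [hX hb2] := map_cat_eq sb hE2.
have [hV1 hV2] : map fV (i :: t :: inner (dtop K) ++ flatten [seq inner (cbot c) | c <- z1]) =
    (i' :: t' :: inner (dtop K') ++ flatten [seq inner (cbot c) | c <- z1']) /\
    map fV (inner (cbot c1) ++ flatten [seq inner (cbot c) | c <- z2]) =
    inner X' ++ flatten [seq inner (cbot c) | c <- z2'].
  by apply: map_cat_eq hV; rewrite /= !size_cat !size_inner sT sV1.
case: (hV1) => fi ft hV1'.
have sI : size (inner (dtop K)) = size (inner (dtop K')) by rewrite !size_inner sT.
have [hI hi1] := map_cat_eq sI hV1'.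
have sI2 : size (inner (cbot c1)) = size (inner X') by rewrite !size_inner sb.
have [hIX hi2] := map_cat_eq sI2 hV2.
have gT : forall e, e \in dtop K -> good fV fE e.
  apply: (good_path (lay_path L)); rewrite hT ?fi ?ft //; exact: lay_path L'.
have [mp gb1 gp ct1 cb1] := sweep_transport ok ok' sw1 sw1' hT gT hb1 hi1.
have [mA mXB] : map fE A = A' /\ map fE (ctop c2 ++ B) = X' ++ B'.
  by apply: map_cat_eq; rewrite // mp.
have [mX mB] := map_cat_eq sX mXB.
have [n2 nb2] := cell_ok_nonempty (ok c2); have [n1 nb1] := cell_ok_nonempty (ok c1).
have [[x [y [h2t h2b]]] _] := ok c2.
have [h1t h1b] : pos_path x (ctop c1) y /\ pos_path x (cbot c1) y.
  have [[x1 [y1 [h1 h1']]] _] := ok c1.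
  by rewrite e1 in h1; have [-> ->] := pos_path_ends nb2 h2b h1; rewrite e1.
have gc2 e : e \in ctop c2 -> good fV fE e.
  by move=> he; apply: gp; rewrite !mem_cat he orbT.
have lX : label X' = label (cbot c1).
  rewrite e2 -mX /label -map_comp; apply/eq_in_map => e he /=.
  by have [] := gc2 e he.
have hX' : pos_path (fV x) X' (fV y).
  by rewrite -mX; apply: pos_path_map h2t => e /gc2 [].
have gc1 : forall e, e \in cbot c1 -> good fV fE e.
  by apply: (good_path h1b); rewrite hX.
have mq : map fE (A ++ cbot c1 ++ B) = p' by rewrite !map_cat mA hX mB -ep'.
have gq e : e \in A ++ cbot c1 ++ B -> good fV fE e.
  rewrite !mem_cat => /or3P[he|/gc1 //|he]; apply: gp; by rewrite !mem_cat he ?orbT.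
have [mbot gb2 _ ct2 cb2] := sweep_transport ok ok' sw2 sw2' mq gq hb2 hi2.
have goodLE e : e \in LE -> good fV fE e.
  by rewrite !mem_cat => /orP[/orP[/gT|/gb1]|/orP[/gc1|/gb2]].
have keptE e : e \notin ctop c1 -> e \in LE.
  have := lay_edges L e; rewrite (perm_mem pE) mem_cat -e1.
  by case/orP=> [//|->].
have LEkept e : e \in LE -> e \notin ctop c1.
  by move=> he; apply/negP; rewrite e1 => /disE; rewrite /= he.
have keptV v : ~ (exists d e, [/\ d \in ctop c1, e \in ctop c1, v = tgt d & v = src e]) ->
    v \in LV.
  move=> nv; have := lay_verts L v; rewrite (perm_mem pV) mem_cat -e1.
  case/orP=> [//|/mapP[e he ev]]; case: nv.
  have [d hd ed] := pos_path_mem_tgt h1t he.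
  by exists d, e; rewrite hd (mem_behead he) ed.
have LVkept v : v \in LV ->
    ~ (exists d e, [/\ d \in ctop c1, e \in ctop c1, v = tgt d & v = src e]).
  move=> hv [d [e [hd he ed ee]]].
  suff /disV : v \in inner (cbot c2) by rewrite /= hv.
  rewrite -e1; have := lay_simple L h1t; move: h1t hd he.
  case: (ctop c1) => // e0 s /pos_path_src e0x hd.
  rewrite inE => /orP[/eqP e00|he]; last by move=> _; rewrite ee; apply: map_f.
  rewrite cons_uniq => /andP[/negP[]]; apply/mapP; exists d => //.
  by rewrite -e0x -e00 -ee ed.
(* Without [cbot c1] the maps are injective, the images being the creation lists of [K']. Hence only
   an item of [cbot c1] and its partner on [ctop c2] can be identified. *)
pose M0 := (i :: t :: inner (dtop K) ++ flatten [seq inner (cbot c) | c <- z1]) ++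
  flatten [seq inner (cbot c) | c <- z2].
pose L0 := (dtop K ++ flatten [seq cbot c | c <- z1]) ++ flatten [seq cbot c | c <- z2].
have iL0 : {in L0 &, injective fE}.
  apply: map_injective; rewrite map_cat hE1 hb2.
  by have := lay_uniqe L'; rewrite /edges_by map_cat flatten_cat catA.
have iM0 : {in M0 &, injective fV}.
  apply: map_injective; rewrite map_cat hV1 hi2.
  by have := lay_uniqv L'; rewrite /verts_by map_cat flatten_cat catA -!cat_cons.
have c2L0 e : e \in ctop c2 -> e \in L0.
  move=> he; rewrite mem_cat (perm_mem (sweep_perm sw1)) !mem_cat he.
  by rewrite ?orbT.
have c2M0 v : v \in inner (ctop c2) -> v \in M0.
  move=> hv; rewrite mem_cat !inE (perm_mem (sweep_inner_perm ok sw1)) mem_cat.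
  have /mem_subseq -> // : subseq (inner (ctop c2)) (inner (A ++ ctop c2 ++ B)).
    by apply: map_subseq; apply: subseq_behead_mid.
  by rewrite !orbT.
have uX : uniq X' .
  have := frontier_uniq L' (perm_refl _) sw1'.
  by rewrite cat_uniq ep' => /andP[]; rewrite !cat_uniq => /and3P[_ _ /and3P[]].
have uIX : uniq (inner X').
  have : uniq (inner p').
    have := lay_uniqv L'; rewrite /verts_by map_cat flatten_cat catA 2!cons_uniq => /and3P[_ _].
    rewrite cat_uniq (perm_uniq (sweep_inner_perm ok' sw1')) => /andP[].
    by rewrite cat_uniq => /andP[].
  by apply: subseq_uniq; rewrite ep'; apply: map_subseq; apply: subseq_behead_mid.
have iX : {in cbot c1 &, injective fE} by apply: map_injective; rewrite hX.
have iIX : {in inner (cbot c1) &, injective fV} by apply: map_injective; rewrite hIX.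
have splitE e : e \in LE -> e \in L0 \/ e \in cbot c1 := @mem_cat3 _ _ _ _ _.
have splitV v : v \in LV -> v \in M0 \/ v \in inner (cbot c1) := @mem_cat3 _ _ _ _ _.
have twinE e : e \in cbot c1 ->
    exists d, [/\ d \in L0, (d, e) \in zip (ctop c2) (cbot c1) & fE d = fE e].
  have eXX : map fE (ctop c2) = map fE (cbot c1) by rewrite mX hX.
  move=> he; have [d [h1 h2 h3]] := zip_map_mem eXX he.
  by exists d; split=> //; apply: c2L0.
have twinV v : v \in inner (cbot c1) ->
    exists d e, [/\ src d \in M0, (d, e) \in zip (ctop c2) (cbot c1), v = src e
      & fV (src d) = fV v].
  case/mapP=> e he ev; have eXX : map fE (behead (ctop c2)) = map fE (behead (cbot c1)).
    by rewrite -!behead_map mX hX.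
  have [d [h1 h2 h3]] := zip_map_mem eXX he; exists d, e; split=> //.
  - by apply: c2M0; apply: map_f.
  - exact: mem_zip_behead.
  - have [<- _ _] := gc2 d (mem_behead h1); rewrite h3 ev.
    by have [-> _ _] := gc1 e (mem_behead he).
have gCtop c : ctop c = map fE (ctop (gC c)).
  have := lay_cells L' c; rewrite mem_cat => /orP[] hc; apply/esym.
    by rewrite -gC1 -map_comp in ct1; apply: (eq_map_mem ct1).
  by rewrite -gC2 -map_comp in ct2; apply: (eq_map_mem ct2).
have gCbot c : cbot c = map fE (cbot (gC c)).
  have := lay_cells L' c; rewrite mem_cat => /orP[] hc; apply/esym.
    by rewrite -gC1 -map_comp in cb1; apply: (eq_map_mem cb1).
  by rewrite -gC2 -map_comp in cb2; apply: (eq_map_mem cb2).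
have uz := lay_uniq L.
exists fV, fE, gC; split.
- split.
  + by move=> e /keptE /goodLE [].
  + by move=> e /keptE /goodLE [].
  + by move=> e /keptE /goodLE [].
  + exact: gCtop.
  + exact: gCbot.
- by rewrite hT mbot.
- split.
  + move=> v; have : v \in LV'.
      have := lay_verts L' v.
      rewrite /verts_by map_cat flatten_cat catA -!cat_cons; exact: mem_cat_mid.
    by rewrite -hV => /mapP[u hu ->]; exists u => //; apply: LVkept.
  + move=> e; have : e \in LE'.
      have := lay_edges L' e; rewrite /edges_by map_cat flatten_cat catA.
      exact: mem_cat_mid.
    by rewrite -hE => /mapP[u hu ->]; exists u => //; apply: LEkept.
  + move=> c; split.
      move=> [nc1 nc2]; have := lay_cells L c; rewrite !mem_cat !inE.
      move/eqP/negPf: nc1 => ->; move/eqP/negPf: nc2 => -> /=.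
      by rewrite -mem_cat -hC => /mapP[c' _ ->]; exists c'.
    move=> [c' ->]; have : gC c' \in z1 ++ z2 by rewrite -hC map_f // (lay_cells L').
    move: uz; rewrite (perm_uniq (perm_insert2 z1 c2 c1 z2)).
    rewrite /= inE negb_or => /and3P[/andP[_ /negP m1] /negP m2 _] hc.
    by split=> ec; rewrite ec in hc.
- by rewrite mX hX.
- split.
  + move=> v u /keptV hv /keptV hu evu.
    case: (splitV _ hv) (splitV _ hu) => [hv0|hv1] [hu0|hu1].
    * by apply: Or31; apply: iM0.
    * have [d [e [h1 h2 h3 h4]]] := twinV _ hu1.
      apply: Or32; exists d, e; split=> //; left; split=> //.
      by apply: iM0 => //; rewrite h4.
    * have [d [e [h1 h2 h3 h4]]] := twinV _ hv1.
      apply: Or33; exists d, e; split=> //; left; split=> //.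
      by apply: iM0 => //; rewrite h4.
    * by apply: Or31; apply: iIX.
  + move=> v u /keptE hv /keptE hu evu.
    case: (splitE _ hv) (splitE _ hu) => [hv0|hv1] [hu0|hu1].
    * by apply: Or31; apply: iL0.
    * have [d [h1 h2 h3]] := twinE _ hu1.
      by apply: Or32; rewrite (iL0 v d) // h3.
    * have [d [h1 h2 h3]] := twinE _ hv1.
      by apply: Or33; rewrite (iL0 u d) // h3.
    * by apply: Or31; apply: iX.
  + move=> c c'; apply: (map_injective (l := z1' ++ z2')); try exact: (lay_cells L').
    rewrite hC; apply: subseq_uniq uz; apply: cat_subseq => //.
    exact: (suffix_subseq [:: c2; c1]).
Qed.

End Removal.

Local Open Scope classical_set_scope.

(** * The diagram group in terms of derivations *)

Section Reverse.
Variables (Sg : Type) (P : presentation Sg).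
Implicit Types (d : seq (medge Sg)).

Lemma drev_cat d d' : drev (d ++ d') = drev d' ++ drev d.
Proof. by rewrite /drev map_cat rev_cat. Qed.

Lemma swap_drev d d' : swap d d' -> swap (drev d) (drev d').
Proof.
elim=> [d0|d0 d1 _|d0 d1 d2 _ h1 _ h2|d1 a u v b u' v' c d2].
- exact: swap_refl.
- exact: swap_sym.
- exact: swap_trans h1 h2.
- rewrite !drev_cat -!catA; apply: swap_sym.
  have := swap_step (drev d2) a v u b v' u' c (drev d1).
  exact.
Qed.

Lemma drev_dipole d1 (m : medge Sg) d2 :
  drev (d1 ++ [:: m; minv m] ++ d2) = drev d2 ++ [:: m; minv m] ++ drev d1.
Proof. by rewrite !drev_cat -!catA; case: m. Qed.

Lemma dreduced_drev d : dreduced d -> dreduced (drev d).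
Proof.
move=> h d1 m d2 /swap_drev; rewrite drevK drev_dipole; exact: h.
Qed.

Lemma hom_drev x y d d' : hom P x y d d' -> hom P y x (drev d) (drev d').
Proof.
elim=> [d0 d1 h s|d0 d1 _ h|d0 d1 d2 _ h1 _ h2|d1 m d2 h].
- by apply: hom_swap (swap_drev s); apply: dpath_rev.
- exact: hom_sym.
- exact: hom_trans h1 h2.
- move/dpath_rev: h; rewrite drev_dipole drev_cat; exact: hom_cancel.
Qed.

End Reverse.

(** * Isotopy classes of reduced diagrams as homotopy classes of loops *)

Section Classes.
Variables (Sg : Type) (P : presentation Sg) (w : seq Sg).
Hypothesis w_ne : w <> [::].
Hypothesis fin : squier_finite_dim P w.
Implicit Types (D : diagram P) (d e f : seq (medge Sg)).

Lemma diagram_word D : label (dtop D) = w ->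
  exists2 d, realizes P D d & dpath P w d (label (dbot D)).
Proof.
move=> lD; have ne : dtop D <> [::] by move=> e; apply: w_ne; rewrite -lD e.
have [d r] := is_diagram_layered (diagramP D) ne; exists d => //.
have [cs [i [t L]]] := r; rewrite -lD; exact: sweep_dpath (lay_ok L) (lay_sweep L).
Qed.

Lemma realizes_dpath (K : complex Sg) d : realizes P K d ->
  dpath P (label (dtop K)) d (label (dbot K)).
Proof. by case=> cs [i [t L]]; exact: sweep_dpath (lay_ok L) (lay_sweep L). Qed.

Lemma reduced_realizes (K : complex Sg) d : realizes P K d ->
  (reduced K <-> dreduced d).
Proof.
move=> r; split=> h.
  move=> d1 m d2 s.
  have [c1 [c2 [z1 [z2 [A [B [i [t [[dip _ _ _] _]]]]]]]]] :=
    realizes_dipole_sweep (realizes_swap s r).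
  exact: h dip.
move=> c1 c2 dip.
have [z1 [z2 [A [B [d1 [d2 [i [t [_ s]]]]]]]]] := dipole_sweep_ex r dip.
exact: h s.
Qed.

Lemma build_diagram d y : dpath P w d y ->
  exists D, [/\ realizes P D d, label (dtop D) = w & label (dbot D) = y].
Proof.
move=> h; have [K [r lK]] := realizable w_ne h.
exists (Diagram (realizes_is_diagram r)); split=> //=.
by have := realizes_dpath r; rewrite lK => h'; exact: dpath_fun h' h.
Qed.

Lemma isotopic_realizes (K : complex Sg) D d : isotopic K D -> realizes P K d ->
  [/\ realizes P D d, label (dtop D) = label (dtop K) & label (dbot D) = label (dbot K)].
Proof.
move=> [fV [fE [fC [[hs ht hl hct hcb] [bV bE bC] et eb]]]] [cs [i [t L]]].
split; rewrite ?et ?eb ?map_label //.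
apply: (@diagram_realizes _ _ _ (map fC cs)).
- exact: diagramP.
- by rewrite et => /(congr1 size); rewrite size_map; case: (dtop K) (lay_ne L).
- by rewrite map_inj_uniq ?(lay_uniq L) //; apply: bij_inj.
- by case: bC => g _ gK c; rewrite -(gK c) map_f // (lay_cells L).
- rewrite et eb; exact: sweep_map hl hct hcb (lay_sweep L).
Qed.

(* For a loop [d] at [w], the isotopy class of the reduced diagram of [d]. *)
Definition cls d : set (diagram P) :=
  [set D | [/\ uv_diagram w w D, reduced D &
    exists2 d', hom P w w d' d & realizes P D d']].

Lemma cls_hom d d' : hom P w w d d' -> cls d = cls d'.
Proof.
move=> h; apply/seteqP; split=> D [h1 h2 [f h3 h4]]; split=> //; exists f => //.
  exact: hom_trans h3 h.
exact: hom_trans h3 (hom_sym h).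
Qed.

(** Homotopic reduced derivations differ by swaps, a figure realizing one realizes the other, and
    figures of the same derivation are isotopic. *)
Lemma isotopy_class_cls D d : uv_diagram w w D -> reduced D -> realizes P D d ->
  isotopy_class D = cls d.
Proof.
move=> [l1 l2] red r; have dd := realizes_dpath r; rewrite l1 l2 in dd.
have rd := (reduced_realizes r).1 red.
apply/seteqP; split=> D'.
  move=> iso; have [r' l1' l2'] := isotopic_realizes iso r.
  split; first by split; rewrite ?l1' ?l2'.
    exact/(reduced_realizes r').
  by exists d => //; apply: hom_refl.
case=> [[l1' l2'] red' [d' h r']].
have rd' := (reduced_realizes r').1 red'.
have s := dreduced_unique fin h rd' rd.
apply: realizes_isotopic r (realizes_swap s r') _; by rewrite l1 l1'.
Qed.

Lemma cls_diagram d : dpath P w d w -> exists D d',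
  [/\ uv_diagram w w D, reduced D, realizes P D d' & cls d = isotopy_class D] /\
  hom P w w d d' /\ (size d' <= size d)%N.
Proof.
move=> h; have [d' [h1 h2 h3]] := hom_dreduced h.
have [D [r l1 l2]] := build_diagram (hom_dpath h1).2.
have red : reduced D by apply/(reduced_realizes r).
exists D, d'; split; last by [].
by split=> //; rewrite (isotopy_class_cls _ red r) //; apply: cls_hom.
Qed.

Lemma diagram_groupP X : diagram_group P w X <-> exists2 d, dpath P w d w & X = cls d.
Proof.
split=> [[D [uv red ->]]|[d h ->]].
  have [d r h] := diagram_word uv.1; rewrite uv.2 in h.
  by exists d => //; apply: isotopy_class_cls.
by have [D [d' [[h1 h2 h3 h4] _]]] := cls_diagram h; exists D.
Qed.

Lemma cls_inj d d' : dpath P w d w -> cls d = cls d' -> hom P w w d d'.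
Proof.
move=> h E; have [D [d1 [[uv red r _] [h1 _]]]] := cls_diagram h.
have : cls d D by split=> //; exists d1 => //; apply: hom_sym.
rewrite E => -[_ _ [d2 h2 r2]]; apply: (hom_trans h1); apply: hom_trans h2.
by apply: hom_swap (realizes_same r r2); have [] := hom_dpath h1.
Qed.

Lemma ncell_realizes (K : complex Sg) d : realizes P K d -> ncell K = size d.
Proof.
case=> cs [i [t L]]; rewrite -(sweep_size (lay_sweep L)).
by rewrite (size_full (lay_uniq L) (lay_cells L)) card_ord.
Qed.

Lemma dg_one_cls : dg_one P w = cls [::].
Proof.
have d0 : dpath P w [::] w by [].
apply/seteqP; split=> D.
  move=> [uv n0]; have [d r h] := diagram_word uv.1; rewrite uv.2 in h.
  have d00 : d = [::] by apply/nilP; rewrite /nilp -(ncell_realizes r) n0.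
  split=> //; last by exists d => //; rewrite d00; apply: hom_refl.
  by move=> c1; exfalso; have := ltn_ord c1; move: (nat_of_ord c1) => k; rewrite n0.
case=> uv red [d h r]; split=> //; rewrite (ncell_realizes r).
have rn : @dreduced Sg [::].
  by move=> d1 m d2 /swap_size; rewrite !size_cat /=; lia.
by have /swap_size := dreduced_unique fin h ((reduced_realizes r).1 red) rn.
Qed.

Lemma dg_inv_cls d : dpath P w d w -> dg_inv (cls d) = cls (drev d).
Proof.
move=> hd; apply/seteqP; split=> D.
  case=> D' [[l1 l2] red [d' h r] iso].
  have [r' l1' l2'] := isotopic_realizes iso (realizes_mirror r).
  split.
  - by split; [rewrite l1'|rewrite l2'].
  - apply/(reduced_realizes r')/dreduced_drev; exact/(reduced_realizes r).
  - by exists (drev d') => //; apply: hom_drev.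
case=> [[l1 l2] red [f h r]].
have hf := dpath_rev (hom_dpath h).1.
have [D' [r' l1' l2']] := build_diagram hf.
have rr := realizes_mirror r'; rewrite drevK in rr.
exists D'; last by apply: realizes_isotopic rr r _; rewrite l1.
split=> //.
  apply/(reduced_realizes r')/dreduced_drev; exact/(reduced_realizes r).
by exists (drev f) => //; have := hom_drev h; rewrite drevK.
Qed.

Lemma reduced_form_realizes D0 D f : uv_diagram w w D0 -> realizes P D0 f ->
  clos_refl_trans (diagram P) (@dipole_reduction _ P) D0 D ->
  uv_diagram w w D /\ exists2 f', hom P w w f' f & realizes P D f'.
Proof.
move=> uv r h; elim: h f uv r => {D0 D} [D D' [c1 [c2 [dip rem]]]|D|D D1 D2 _ IH1 _ IH2] f uv r.
- have hf := realizes_dpath r; rewrite uv.1 uv.2 in hf.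
  have [z1 [z2 [A [B [d1 [d2 [i [t [ds s]]]]]]]]] := dipole_sweep_ex r dip.
  have [r' [l1 l2]] := dipole_removal_realizes ds rem (diagramP D').
  split; first by split; rewrite ?l1 ?l2; case: uv.
  exists (d1 ++ d2) => //; apply: hom_sym; apply: hom_trans (hom_swap hf s) _.
  by apply: hom_cancel; apply/(swap_dpath P w w s).
- split=> //; exists f => //; apply: hom_refl.
  by have := realizes_dpath r; rewrite uv.1 uv.2.
- have [uv1 [f1 h1 r1]] := IH1 _ uv r; have [uv2 [f2 h2 r2]] := IH2 _ uv1 r1.
  by split=> //; exists f2 => //; apply: hom_trans h2 h1.
Qed.

(** Each cancelling pair met while shortening [g] is a dipole of a figure built for [g], and the
    figure of the shortened derivation is a legitimate result of its removal. *)
Lemma reduction_to D f g : uv_diagram w w D -> realizes P D f -> dreduced f ->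
  hom P w w g f -> exists D0, [/\ realizes P D0 g, uv_diagram w w D0
    & clos_refl_trans (diagram P) (@dipole_reduction _ P) D0 D].
Proof.
move=> uv r rf; elim: {g}_.+1 {-2}g (ltnSn (size g)) => // n IH g; rewrite ltnS => gn h.
have hg := (hom_dpath h).1.
have [rg|] := pselect (dreduced g).
  exists D; split=> //; last exact: rt_refl.
  by apply: realizes_swap r; apply: swap_sym; apply: dreduced_unique fin h rg rf.
move=> /existsNP [d1 /existsNP [m /existsNP [d2 /contrapT s]]].
have hg' := (swap_dpath P w w s).1 hg.
have sz := swap_size s; rewrite !size_cat /= in sz.
have [||D1 [r1 uv1 c1]] := IH (d1 ++ d2).
- by rewrite size_cat; lia.
- apply: hom_trans h; apply: hom_sym; apply: hom_trans (hom_swap hg s) _.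
  exact: hom_cancel.
have [D0 [r0 l1 l2]] := build_diagram hg'.
have [c [c' [z1 [z2 [A [B [i [t [ds em]]]]]]]]] := realizes_dipole_sweep r0.
exists D0; split=> //; first by apply: realizes_swap r0; apply: swap_sym.
apply: rt_trans c1; apply: rt_step; exists c, c'; split; first by case: ds.
by apply: realizes_dipole_removal ds r1 _; rewrite l1 uv1.1.
Qed.

(** For the inclusion from right to left, reduced factors are built first; their juxtaposition then
    has to be realized and reduced to the given [D] itself. *)
Lemma dg_mul_cls d e : dpath P w d w -> dpath P w e w ->
  dg_mul (cls d) (cls e) = cls (d ++ e).
Proof.
move=> hd he; apply/seteqP; split=> D.
  move=> [D1 [D2 [D0 [[[l1 l1'] red1 [d1 h1 r1]] [[l2 l2'] red2 [e1 h2 r2]] con [ct red]]]]].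
  have [r0 [l0 l0']] := concatenation_realizes con (diagramP D0) r1 r2.
  have uv0 : uv_diagram w w D0 by split; rewrite ?l0 ?l0'.
  have [uv [f hf rf]] := reduced_form_realizes uv0 r0 ct.
  split=> //; exists f => //; apply: hom_trans hf _.
  apply: (@hom_trans _ _ _ _ (d ++ e1)).
    by have := hom_cat (l := [::]) (erefl w) (hom_dpath h2).1 h1.
  by have := hom_cat (r := [::]) hd (erefl w) h2; rewrite !cats0.
move=> [uv red [f h r]]; have rf := (reduced_realizes r).1 red.
have [d1 [h1 rd1 _]] := hom_dreduced hd; have [e1 [h2 re1 _]] := hom_dreduced he.
have [D1 [r1 l1 l1']] := build_diagram (hom_dpath h1).2.
have [D2 [r2 l2 l2']] := build_diagram (hom_dpath h2).2.
have [|D0 [r0 uv0 ct]] := reduction_to (g := d1 ++ e1) uv r rf.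
  apply: hom_trans (hom_sym h); apply: (@hom_trans _ _ _ _ (d ++ e1)).
    by have := hom_cat (l := [::]) (erefl w) (hom_dpath h2).2 (hom_sym h1).
  by have := hom_cat (r := [::]) hd (erefl w) (hom_sym h2); rewrite !cats0.
exists D1, D2, D0; split=> //.
- split=> //; first exact/(reduced_realizes r1).
  by exists d1 => //; apply: hom_sym.
- split=> //; first exact/(reduced_realizes r2).
  by exists e1 => //; apply: hom_sym.
- by apply: realizes_concatenation r1 r2 r0 _ _; rewrite ?uv0.1 ?l1 ?l1' ?l2.
Qed.

End Classes.

(** * Word length *)

Section WordLength.
Variables (Sg : Type) (P : presentation Sg) (w : seq Sg).
Hypothesis w_ne : w <> [::].
Hypothesis fin : squier_finite_dim P w.
Implicit Types (d e f p q : seq (medge Sg)) (X Y : set (diagram P)).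
Implicit Types S : set (set (diagram P)).
Local Notation cl := (@cls Sg P w).

Lemma is_product0 S X : is_product w S 0 X <-> X = dg_one P w.
Proof.
split=> [[s [_ ->]]|->]; first by rewrite big_ord0.
exists (fun _ => dg_one P w); rewrite big_ord0; split=> // -[j hj]; by exfalso.
Qed.

Lemma is_productS S k X : is_product w S k.+1 X <->
  exists Y Z, [/\ letter S Y, is_product w S k Z & X = dg_mul Y Z].
Proof.
split=> [[s [hs ->]]|[Y [Z [hY [s [hs ->]] ->]]]].
  rewrite big_ord_recl; exists (s ord0), (\big[@dg_mul _ P/dg_one P w]_(i < k) s (lift ord0 i)).
  by split=> //; exists (fun i => s (lift ord0 i)).
exists (fun i => oapp s Y (unlift ord0 i)); split.
  by move=> i; case: (unlift ord0 i).
rewrite big_ord_recl unlift_none /=; congr (dg_mul _ _).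
by apply: eq_bigr => i _; rewrite liftK.
Qed.

Lemma letter_cls S Y : S `<=` diagram_group P w -> letter S Y ->
  exists2 q, dpath P w q w & Y = cl q.
Proof.
move=> sub [/sub /(diagram_groupP w_ne fin) //|[Z /sub /(diagram_groupP w_ne fin) [q h ->] ->]].
by exists (drev q); [apply: dpath_rev|rewrite dg_inv_cls].
Qed.

Lemma is_product_cls S k X : S `<=` diagram_group P w -> is_product w S k X ->
  exists2 q, dpath P w q w & X = cl q.
Proof.
move=> sub; elim: k X => [|k IH] X.
  by move/is_product0 ->; exists [::] => //; apply: dg_one_cls.
move/is_productS=> [Y [Z [/(letter_cls sub) [q hq ->] /IH [q' hq' ->] ->]]].
exists (q ++ q'); first by apply/dpath_cat; exists w.
by rewrite dg_mul_cls.
Qed.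

Lemma is_product_cat S j k p q : S `<=` diagram_group P w ->
  dpath P w p w -> dpath P w q w ->
  is_product w S j (cl p) -> is_product w S k (cl q) ->
  is_product w S (j + k) (cl (p ++ q)).
Proof.
move=> sub hp hq hj hk; rewrite -dg_mul_cls //.
(* The induction controls the left factor only as a class, so the loop representing it must be free
   to change. *)
suff [p0 [h0 E H]] : exists p0, [/\ dpath P w p0 w, cl p = cl p0 &
    is_product w S (j + k) (cl (p0 ++ q))] by rewrite E dg_mul_cls.
move: (cl p) hj {hp} => X; elim: j X => [|j IH] X.
  move/is_product0 ->; exists [::]; split=> //; exact: dg_one_cls.
move/is_productS=> [Y [Z [lY /IH [p0 [h0 -> h]] ->]]].
have [q0 hq0 EY] := letter_cls sub lY.
exists (q0 ++ p0); have h1 : dpath P w (q0 ++ p0) w by apply/dpath_cat; exists w.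
have h2 : dpath P w (p0 ++ q) w by apply/dpath_cat; exists w.
split=> //; first by rewrite EY dg_mul_cls.
rewrite addSn; apply/is_productS; exists Y, (cl (p0 ++ q)); split=> //.
by rewrite EY dg_mul_cls // catA.
Qed.

Lemma is_product_bound S M j X : S `<=` diagram_group P w ->
  (forall Y, letter S Y -> exists q, [/\ dpath P w q w, Y = cl q & (size q <= M)%N]) ->
  is_product w S j X ->
  exists q, [/\ dpath P w q w, X = cl q & (size q <= M * j)%N].
Proof.
move=> sub hM; elim: j X => [|j IH] X.
  by move/is_product0 ->; exists [::]; split=> //; apply: dg_one_cls.
move/is_productS=> [Y [Z [/hM [q [hq -> sq]] /IH [q' [hq' -> sq']] ->]]].
exists (q ++ q'); split; first by apply/dpath_cat; exists w.
  by rewrite dg_mul_cls.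
by rewrite size_cat mulnS leq_add.
Qed.

Lemma is_product_subst S S0 M j p : S `<=` diagram_group P w ->
  S0 `<=` diagram_group P w ->
  (forall Y, letter S0 Y -> exists2 k, (k <= M)%N & is_product w S k Y) ->
  dpath P w p w -> is_product w S0 j (cl p) ->
  exists2 k, (k <= M * j)%N & is_product w S k (cl p).
Proof.
move=> sub sub0 hM hp; move: (cl p) => X {hp}; elim: j X => [|j IH] X.
  by move/is_product0 ->; exists 0%N; rewrite ?muln0 //; apply/is_product0.
move/is_productS=> [Y [Z [lY hZ ->]]].
have [q hq EY] := letter_cls sub0 lY; have [k1 hk1 pr1] := hM _ lY.
have [k2 hk2 pr2] := IH _ hZ.
have [q' hq' EZ] := is_product_cls sub0 hZ.
exists (k1 + k2)%N; first by rewrite mulnS leq_add.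
rewrite EY EZ dg_mul_cls //; apply: is_product_cat => //; by rewrite -?EY -?EZ.
Qed.

Lemma word_length_le S j X : is_product w S j X -> (word_length w S X <= j)%N.
Proof.
(* In the default case of [xget] the length is 0 and the bound is trivial. *)
move=> h; rewrite /word_length; case: xgetP => [k _ [_ min]|//]; exact: min.
Qed.

Lemma word_length_product S j X : is_product w S j X ->
  is_product w S (word_length w S X) X.
Proof.
move=> h; rewrite /word_length; set A := (X in xget _ X).
suff [k hk] : exists k, A k by case: (xgetPex 0%N (ex_intro _ k hk)).
pose Q := [pred k | `[< is_product w S k X >]].
have exQ : exists k, Q k by exists j; apply/asboolP.
case: (ex_minnP exQ) => k /asboolP hk mink; exists k; split=> // m hm.
by apply: mink; apply/asboolP.
Qed.

Lemma finite_bound S (Q : set (diagram P) -> nat -> Prop) : finite_set S ->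
  (forall Y, S Y -> exists k, Q Y k) ->
  exists M, forall Y, S Y -> exists2 k, (k <= M)%N & Q Y k.
Proof.
move=> /finite_seqP [s ->]; elim: s => [|Z s IH] h; first by exists 0%N.
have [|M hM] := IH; first by move=> Y hY; apply: h => /=; rewrite inE hY orbT.
have [k hk] := h Z (mem_head _ _).
exists (maxn k M) => Y /=; rewrite inE => /orP[/eqP ->|/hM [k' h1 h2]].
  by exists k; rewrite ?leq_maxl.
by exists k' => //; rewrite leq_max h1 orbT.
Qed.

Lemma letters_bounded S : finite_generating_set w S -> exists M,
  forall Y, letter S Y -> exists q, [/\ dpath P w q w, Y = cl q & (size q <= M)%N].
Proof.
move=> [fS sub _].
have [Y hY|M hM] := @finite_bound S
    (fun Y k => exists q, [/\ dpath P w q w, Y = cl q & size q = k]) fS.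
  have [q hq ->] := letter_cls sub (or_introl hY).
  by exists (size q), q.
exists M => Y [/hM [k hk [q [hq eq sq]]]|[Z /hM [k hk [q [hq eq sq]]] ->]].
  by exists q; rewrite sq.
exists (drev q); split; first exact: dpath_rev.
  by rewrite eq dg_inv_cls.
by rewrite /drev size_rev size_map sq.
Qed.

Lemma letters_length S S0 : finite_generating_set w S -> finite_generating_set w S0 ->
  exists M, forall Y, letter S0 Y -> exists2 k, (k <= M)%N & is_product w S k Y.
Proof.
move=> [_ sub gen] [fS0 sub0 _].
have [Y hY|M1 hM1] := @finite_bound S0 (fun Y k => is_product w S k Y) fS0.
  exact: gen (sub0 _ hY).
have [Y hY|M2 hM2] := @finite_bound S0 (fun Y k => is_product w S k (dg_inv Y)) fS0.
  apply: gen; apply/(diagram_groupP w_ne fin).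
  by apply: letter_cls sub0 _; right; exists Y.
exists (maxn M1 M2) => Y [/hM1 [k h1 h2]|[Z /hM2 [k h1 h2] ->]]; exists k => //.
  by rewrite leq_max h1.
by rewrite leq_max h1 orbT.
Qed.

Lemma hom_quotient d e q : dpath P w d w -> dpath P w e w ->
  (hom P w w (drev d ++ e) q <-> hom P w w e (d ++ q)).
Proof.
move=> hd he; have hd' := dpath_rev hd.
have c1 : hom P w w (d ++ drev d ++ e) e.
  rewrite catA -[X in hom _ _ _ _ X]cat0s.
  exact: (hom_cat (l := [::]) (erefl w) he (hom_rev_cancel hd)).
split=> h.
  apply: hom_trans (hom_sym c1) _.
  by have := hom_cat (r := [::]) hd (erefl w) h; rewrite !cats0.
have [_ hdq] := hom_dpath h.
have hq : dpath P w q w.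
  by move/dpath_cat: hdq => [y h1]; rewrite -(dpath_fun hd h1).
apply: (@hom_trans _ _ _ _ (drev d ++ d ++ q)).
  by have := hom_cat (r := [::]) hd' (erefl w) h; rewrite !cats0.
have := hom_rev_cancel hd'; rewrite drevK => c2.
have := hom_cat (l := [::]) (erefl w) hq c2.
by rewrite /= -catA.
Qed.

Lemma word_dist_cls S d e : dpath P w d w -> dpath P w e w ->
  word_dist w S (cl d) (cl e) = word_length w S (cl (drev d ++ e)).
Proof.
move=> hd he; have hd' := dpath_rev hd.
by rewrite /word_dist dg_inv_cls // dg_mul_cls.
Qed.

(** [M] bounds the length of loops representing the generators and their inverses, so a product of
    [j] letters is a path of at most [M * j] moves. *)
Lemma word_dist_path S : finite_generating_set w S -> exists M, forall d e,
  dpath P w d w -> dpath P w e w ->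
  exists q, (size q <= M * word_dist w S (cl d) (cl e))%N /\ hom P w w e (d ++ q).
Proof.
move=> gen; have [M hM] := letters_bounded gen; have [_ sub ex] := gen.
exists M => d e hd he; rewrite word_dist_cls //.
have hde : dpath P w (drev d ++ e) w by apply/dpath_cat; exists w; first exact: dpath_rev hd.
have [|j hj] := ex (cl (drev d ++ e)).
  by apply/(diagram_groupP w_ne fin); exists (drev d ++ e).
have [q [hq E sq]] := is_product_bound sub hM (word_length_product hj).
by exists q; split=> //; apply/hom_quotient => //; apply: (cls_inj w_ne fin).
Qed.

(** Reducing [q] gives a diagram with at most [N] cells, whose word length over the generators of
    Property B is at most [C2 * N]. Rewriting those generators over [S] costs the factor [M]. *)
Lemma path_word_dist (R : realType) S : property_B P w R -> finite_generating_set w S ->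
  forall N, exists B, forall d e q, dpath P w d w -> dpath P w e w ->
  (size q <= N)%N -> hom P w w e (d ++ q) -> (word_dist w S (cl d) (cl e) <= B)%N.
Proof.
move=> [S0 gen0 [C1 [C2 [_ C2_gt0 hB]]]] gen N.
have [M hM] := letters_length gen gen0.
have [_ sub0 ex0] := gen0; have [_ sub _] := gen.
pose K := Num.bound (C2 * N%:R)%R.
exists (M * K)%N => d e q hd he sq h; rewrite word_dist_cls //.
have hq : dpath P w q w.
  by have [_ /dpath_cat [y h1]] := hom_dpath h; rewrite -(dpath_fun hd h1).
have -> : cl (drev d ++ e) = cl q by apply: cls_hom; apply/hom_quotient.
have [D [d' [[uv red r E] [hd' sd']]]] := cls_diagram w_ne fin hq.
have [|j hj] := ex0 (cl q); first by apply/(diagram_groupP w_ne fin); exists q.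
have hK : (word_length w S0 (cl q) <= K)%N.
  have /andP[_ h2] := hB D uv red.
  rewrite E -(ler_nat R); apply: le_trans h2 _.
  rewrite (ncell_realizes r); apply: le_trans (ltW (archi_boundP _)); last first.
    by rewrite mulr_ge0 ?ler0n // ltW.
  by rewrite ler_pM2l // ler_nat; apply: leq_trans sq.
have [k hk pr] := is_product_subst sub sub0 hM hq (word_length_product hj).
apply: leq_trans (word_length_le pr) _; apply: leq_trans hk _.
by rewrite leq_mul2l hK orbT.
Qed.

End WordLength.

(** * Asymptotic dimension *)

(** The residues modulo [n.+1 * L] form [n.+1] slots of length [L]. The shift carries slot [t] onto
    the last one, so avoiding slot [t] becomes lying below the last slot. *)
Lemma residue_shift n L h t : 0 < L -> t <= n ->
  (h %% (n.+1 * L)) %/ L <> t ->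
  (h + (n.+1 * L - t.+1 * L)) %% (n.+1 * L) < n.+1 * L - L.
Proof.
move=> L0 tn; set l := n.+1 * L; set a := h %% l => bt.
have al : a < l by rewrite ltn_mod muln_gt0.
rewrite -modnDml -/a.
have := divn_eq a L; have := ltn_pmod a L0.
move: (a %/ L) bt (a %% L) => b bt c cL aE.
have tl : t.+1 * L <= l by rewrite leq_mul2r ltnS tn orbT.
have Ll : L <= t.+1 * L by rewrite leq_pmull.
case: (ltnP b t) => bt'.
  have h1 : b.+1 * L <= t * L by rewrite leq_mul2r bt' orbT.
  rewrite modn_small; move: h1 tl Ll; rewrite !mulSn; lia.
have h1 : t.+1 * L <= b * L by rewrite leq_mul2r; apply/orP; right; lia.
have -> : a + (l - t.+1 * L) = l + (a - t.+1 * L) by lia.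
rewrite modnDl modn_small; lia.
Qed.

(** Below the last slot, more than [N] steps remain before the next multiple of [l]. *)
Lemma quotient_close l L N h h' s : N < L -> L <= l -> h <= h' + N ->
  (h' + s) %% l < l - L -> (h + s) %/ l <= (h' + s) %/ l.
Proof.
move=> NL Ll hh m'; have l0 : 0 < l by lia.
rewrite leqNgt; apply/negP => q.
have := divn_eq (h + s) l; have := divn_eq (h' + s) l.
have : ((h' + s) %/ l).+1 * l <= (h + s) %/ l * l by rewrite leq_mul2r q orbT.
rewrite mulSn; lia.
Qed.

(** * Connecting two derivations whose branches agree up to a cut *)

Section Cover.
Variables (Sg : Type) (P : presentation Sg) (w : seq Sg).
Hypothesis fin : squier_finite_dim P w.
Implicit Types (d e q : seq (medge Sg)).
Local Notation n := (squier_dim P w).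

Definition branch k d := [seq c <- gcells P (inits w) d | tcol c == k].

Lemma mem_branch k d c :
  c \in branch k d = (tcol c == k) && (c \in gcells P (inits w) d).
Proof. by rewrite mem_filter. Qed.

Lemma hom_complete z e e' d d' : dpath P w d w -> dpath P w d' w ->
  swap d (z ++ e) -> swap d' (z ++ e') -> hom P w w d' (d ++ drev e ++ e').
Proof.
move=> hd hd' sw sw'.
have /dpath_cat [y hz he] : dpath P w (z ++ e) w by apply/(swap_dpath P w w sw).
have /dpath_cat [y' hz' he'] : dpath P w (z ++ e') w.
  by apply/(swap_dpath P w w sw').
rewrite -(dpath_fun hz hz') in he'.
apply: (hom_trans (hom_swap hd' sw')); apply: hom_sym.
have hr : dpath P w (drev e ++ e') w by apply/dpath_cat; exists y => //; apply: dpath_rev.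
apply: (@hom_trans _ _ _ _ (z ++ (e ++ drev e) ++ e')).
  have := hom_cat (l := [::]) (erefl w) hr (hom_swap hd sw).
  by rewrite /= -!catA.
exact: hom_cat hz he' (hom_rev_cancel he).
Qed.

(** A cell of [e] before the cut of its colour would occur in [z ++ e'], hence in [z], and so twice
    in [z ++ e]. Thus [e] injects into [n] pieces of size at most [L]. *)
Lemma tail_size y y' d z e e' (cut : nat -> nat) L :
  dpath P w d y -> dpath P w (z ++ e') y' -> swap d (z ++ e) ->
  {in gcells P (gend P (inits w) z) e,
        forall c, c \notin gcells P (gend P (inits w) z) e'} ->
  (forall k, k < n -> take (cut k) (branch k d) = take (cut k) (branch k (z ++ e'))) ->
  (forall k, k < n -> size (drop (cut k) (branch k d)) <= L) ->
  size e <= n * L.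
Proof.
move=> hd hd' sw dis tk dr.
have [_ pe] := swap_gend sw hd (size_inits w).
have hze : dpath P w (z ++ e) y by apply/(swap_dpath P w y sw).
have [_ _ + _] := history_inits hze.
rewrite gcells_cat cat_uniq => /and3P[_ zNe ue].
rewrite -(size_gcells P (gend P (inits w) z)).
pose F := flatten [seq drop (cut k) (branch k d) | k <- iota 0 n].
apply: (@leq_trans (size F)).
  apply: uniq_leq_size ue _ => c ce.
  have cd : c \in gcells P (inits w) d.
    by rewrite (perm_mem pe) gcells_cat mem_cat ce orbT.
  have kn := gcells_color fin hd cd.
  apply/flatten_mapP; exists (tcol c); first by rewrite mem_iota.
  have : c \in branch (tcol c) d by rewrite mem_branch eqxx.
  rewrite -{1}[branch _ _](cat_take_drop (cut (tcol c))) mem_cat => /orP[|//].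
  rewrite tk // => /mem_take; rewrite mem_branch eqxx /= gcells_cat mem_cat.
  rewrite (negbTE (dis c ce)) orbF => cz.
  by case/negP: zNe; apply/hasP; exists c.
rewrite /F size_flatten /shape -map_comp sumnE big_map.
have -> : (n * L = \sum_(k <- iota 0 n) L)%N.
  by rewrite big_const_seq iter_addn_0 count_predT size_iota mulnC.
rewrite !big_seq; apply: leq_sum => k; rewrite mem_iota /= add0n => kn; exact: dr.
Qed.

Lemma connecting_path d d' (cut : nat -> nat) L :
  dpath P w d w -> dpath P w d' w ->
  (forall k, k < n -> take (cut k) (branch k d) = take (cut k) (branch k d')) ->
  (forall k, k < n -> size (drop (cut k) (branch k d)) <= L) ->
  (forall k, k < n -> size (drop (cut k) (branch k d')) <= L) ->
  exists2 q, size q <= n * L + n * L & hom P w w d' (d ++ q).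
Proof.
move=> hd hd' tk dr dr'.
have [z [e [e' [sw sw' dis]]]] := common_prefix hd hd'.
have hze : dpath P w (z ++ e) w by apply/(swap_dpath P w w sw).
have hze' : dpath P w (z ++ e') w by apply/(swap_dpath P w w sw').
have bE k : branch k d = branch k (z ++ e).
  exact: swap_color sw _ _ _ _ hd (size_inits w) fin.
have bE' k : branch k d' = branch k (z ++ e').
  exact: swap_color sw' _ _ _ _ hd' (size_inits w) fin.
exists (drev e ++ e'); last exact: hom_complete hd hd' sw sw'.
rewrite size_cat /drev size_rev size_map leq_add //.
  apply: (tail_size (cut := cut) hd hze' sw dis) => // k kn.
  by rewrite tk // bE'.
apply: (tail_size (cut := cut) hd' hze sw') => // [c ce'|k kn].
  by apply: contraL ce' => /dis.
by rewrite -tk // bE.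
Qed.

End Cover.

Lemma ord_avoid n (b : nat -> nat) : exists t : 'I_n.+1, forall k, k < n -> b k <> t.
Proof.
have [[t ht]|no] := pselect (exists t : 'I_n.+1, forall k, k < n -> b k <> t).
  by exists t.
have : {subset iota 0 n.+1 <= [seq b k | k <- iota 0 n]}.
  move=> t; rewrite mem_iota add0n => /= tn.
  have [//|nt] := boolP (t \in _); case: no.
  exists (Ordinal tn) => k kn E; case/negP: nt.
  by apply/mapP; exists k; rewrite ?mem_iota.
move/(uniq_leq_size (iota_uniq _ _)).
by rewrite size_map !size_iota ltnn.
Qed.

Section AsymptoticDimension.
Variables (R : realType) (Sg : Type) (P : presentation Sg) (w : seq Sg).
Hypothesis w_ne : w <> [::].
Hypothesis fin : squier_finite_dim P w.
Hypothesis propB : property_B P w R.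
Implicit Types (d e q : seq (medge Sg)) (X Y : set (diagram P)).
Local Notation n := (squier_dim P w).
Local Notation cl := (@cls Sg P w).

(** Representatives are reduced so that their branches are the stacks of the machine, to which the
    Lipschitz bound applies. *)
Lemma representatives : exists rep : set (diagram P) -> seq (medge Sg),
  forall X, diagram_group P w X ->
    [/\ dpath P w (rep X) w, dreduced (rep X) & X = cl (rep X)].
Proof.
suff /choice [rep h] : forall X, exists d, diagram_group P w X ->
    [/\ dpath P w d w, dreduced d & X = cl d] by exists rep.
move=> X.
have [/(diagram_groupP w_ne fin) [d hd ->]|no] := pselect (diagram_group P w X).
  have [e [h red _]] := hom_dreduced hd; exists e => _; split=> //.
    exact: (hom_dpath h).2.
  exact: cls_hom.
by exists [::].
Qed.

(** * Blocks of the cover *)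

Section Blocks.
Variables (rep : set (diagram P) -> seq (medge Sg)) (N : nat).
Let L := N.+1.
Let l := n.+1 * L.

(** With [n.+1] slots of length [L], this shift turns slot [t] into the gap at the top of each
    period [l]. *)
Definition offset t := l - t.+1 * L.
Definition height k X := size (branch P w k (rep X)).
(* Modulo [l], the shifted heights avoid a gap of length [L > N], which a path of
   length [N] cannot jump over. *)
Definition window t X : Prop := diagram_group P w X /\
  forall k, k < n -> (height k X + offset t) %% l < l - L.
Definition level t k X := (height k X + offset t) %/ l.
(** [level * l - offset] is the floor of the level in unshifted heights. The cut is taken [N] lower,
    because branches of elements joined by [N] moves may already separate [N] cells below the lower
    of their tips. Truncation at 0 is harmless. *)
Definition cut t k X := level t k X * l - offset t - N.
Definition root t k X := take (cut t k X) (branch P w k (rep X)).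
Definition same_block t X Y : Prop := forall k, k < n ->
  level t k Y = level t k X /\ root t k Y = root t k X.
Definition block t X := [set Y | window t Y /\ same_block t X Y].

Lemma block_eq t X Y : same_block t X Y -> block t X = block t Y.
Proof.
move=> s; apply/seteqP; split=> Z [wZ h]; split=> // k kn;
  have [a b] := s k kn; have [a' b'] := h k kn; by rewrite a' b' a b.
Qed.

Lemma windows_cover X : diagram_group P w X -> exists t : 'I_n.+1, window t X.
Proof.
move=> hX; have [t ht] := ord_avoid n (fun k => (height k X %% l) %/ L).
exists t; split=> // k kn; apply: residue_shift => //; last exact: ht.
by rewrite -ltnS.
Qed.

Hypothesis repP : forall X, diagram_group P w X ->
  [/\ dpath P w (rep X) w, dreduced (rep X) & X = cl (rep X)].

Lemma root_tail t k X : size (drop (cut t k X) (branch P w k (rep X))) <= l + N.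
Proof.
rewrite size_drop -/(height k X) /cut /level.
have l0 : 0 < l by rewrite /l /L; lia.
have := divn_eq (height k X + offset t) l.
have := ltn_pmod (height k X + offset t) l0.
have : offset t <= l by rewrite leq_subr.
lia.
Qed.

(** Both branches of each colour exceed the common root by at most [l + N], and there are [n]
    colours and two tails. *)
Lemma block_path t X Y : window t X -> window t Y -> same_block t X Y ->
  exists2 q, size q <= n * (l + N) + n * (l + N) & hom P w w (rep Y) (rep X ++ q).
Proof.
move=> [gX _] [gY _] s; have [hX _ _] := repP gX; have [hY _ _] := repP gY.
apply: (connecting_path fin hX hY (cut := fun k => cut t k X)) => k kn.
- have [lv rt] := s k kn; move: rt; rewrite /root {1}/cut lv -/(cut t k X).
  by move->.
- exact: root_tail.
- have [lv _] := s k kn; rewrite /cut -lv; exact: root_tail.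
Qed.

(** Heights differ by at most [N] and both avoid the gap, so the levels agree. The common part of
    the branches reaches at least up to the cut, so the roots agree. *)
Lemma close_same_block t X Y q : window t X -> window t Y -> size q <= N ->
  hom P w w (rep Y) (rep X ++ q) -> same_block t X Y.
Proof.
move=> [gX wX] [gY wY] sq h k kn.
have [hX rX _] := repP gX; have [_ rY _] := repP gY.
have [Z [S [T [EX EY sS sT]]]] := color_lipschitz k fin hX rX rY h.
have l0 : 0 < l by rewrite /l /L; lia.
have Ll : L <= l by rewrite /l leq_pmull.
have szX : height k X = size Z + size S by rewrite /height /branch EX size_cat.
have szY : height k Y = size Z + size T by rewrite /height /branch EY size_cat.
have lv : level t k Y = level t k X.
  apply/eqP; rewrite eqn_leq /level; apply/andP; split;
    apply: (@quotient_close l L N); rewrite ?wX ?wY //; lia.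
split=> //; rewrite /root.
have cutE : cut t k Y = cut t k X by rewrite /cut lv.
have cz : cut t k X <= size Z.
  by rewrite /cut /level; have := divn_eq (height k X + offset t) l; lia.
by rewrite cutE /branch EX EY !takel_cat.
Qed.

End Blocks.

Theorem diagram_group_asdim : diagram_group_asdim_le R P w n.
Proof.
move=> S gen r r0; have [rep repP] := representatives.
have [M hM] := word_dist_path w_ne fin gen.
(* Elements at distance at most [r] are joined by a path of at most [N] moves. *)
pose N := M * Num.bound r.
have [B hB] := path_word_dist w_ne fin propB gen
  (n * (n.+1 * N.+1 + N) + n * (n.+1 * N.+1 + N)).
exists (fun t => [set V | exists2 X, window rep N t X & V = block rep N t X]), B%:R%R.
split.
- by move=> t V [X _ ->] Y [[gY _] _].
- move=> X gX; have [t wX] := windows_cover rep N gX.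
  by exists t; exists (block rep N t X); [exists X|split].
- move=> t V X Y [Z wZ ->] [wX sX] [wY sY].
  have [[gX _] [gY _]] := (wX, wY).
  have [hX _ EX] := repP _ gX; have [hY _ EY] := repP _ gY.
  rewrite ler_nat EX EY.
  have [|q sq h] := block_path repP wX wY; last exact: hB h.
  by move=> k kn; have [a b] := sX k kn; have [a' b'] := sY k kn; rewrite a b a' b'.
- move=> t V W X Y [X0 wX0 ->] [Y0 wY0 ->] VW [wX sX] [wY sY].
  (* By contraposition: elements of the same shift [t] within distance [r] lie in one block, which
     makes [V] and [W] equal. *)
  rewrite ltNge; apply/negP => close; apply: VW.
  rewrite (block_eq sX) (block_eq sY); apply: block_eq.
  have [[gX _] [gY _]] := (wX, wY).
  have [hX _ EX] := repP _ gX; have [hY _ EY] := repP _ gY.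
  move: close; rewrite {1}EX {1}EY => close.
  have [q [sq h]] := hM _ _ hX hY.
  apply: (close_same_block repP wX wY _ h); apply: leq_trans sq _.
  rewrite leq_mul2l; apply/orP; right.
  rewrite ltnW // -(ltr_nat R); apply: le_lt_trans close _.
  by apply: archi_boundP; apply: ltW.
Qed.

End AsymptoticDimension.

Theorem corollary4p19 (R : realType) (Sg : Type) (P : presentation Sg)
  (w : seq Sg) (w_nonempty : w <> [::])
  (fin_dim : squier_finite_dim P w)
  (fin_gen : finitely_generated P w)
  (propB : property_B P w R) :
  diagram_group_asdim_le R P w (squier_dim P w).
Proof. exact: diagram_group_asdim w_nonempty fin_dim propB. Qed.
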